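(* Assume that $\mathbb{E}[L^2+R^2]=1$ (that is, $\mathbb{E}[L^\alpha+R^\alpha]=1$ with $\alpha=2$) and that $\mathcal{S}(\gamma)<0$ for some $\gamma>0$. If $\mathbb{E}[X_0]=0$ and $\sigma^2=\mathbb{E}[X_0^2]<+\infty$, then $V_t$ converges in distribution, as $t\to+\infty$, to a random variable $V_\infty$ with characteristic function $$\phi_\infty(\xi)=\mathbb{E}[\exp(i\xi V_\infty)]=\mathbb{E}\Big[\exp\Big(-\xi^2\frac{\sigma^2}{2}M_\infty^{(2)}\Big)\Big]\qquad(\xi\in\mathbb{R}).$$ In particular, $V_\infty$ is a non-degenerate random variable if $\gamma>2$ and $\sigma^2>0$, whereas $V_\infty=0$ a.s. if $\gamma<2$. Moreover, if $L^2+R^2=1$ a.s., then $V_\infty$ is a Gaussian random variable. Finally, if $V_\infty$ is non-degenerate and $p>2$, then $\mathbb{E}[|V_\infty|^p]<+\infty$ if and only if $\mathcal{S}(p)<0$.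
   Context: $(L,R)$ is a fixed random vector with $L,R\ge 0$. For $s\ge0$, $\mathcal{S}(s)=\mathbb{E}[L^s+R^s]-1\in[-1,\infty]$ (with $0^0=0$). $X_0$ is a real random variable with distribution function $F_0$ and characteristic function $\phi_0$. On a sufficiently large probability space $(\Omega,\mathcal{F},P)$ let the following stochastically independent families be given: i.i.d. random variables $(X_n)_{n\ge1}$ with distribution function $F_0$; i.i.d. random vectors $(L_n,R_n)_{n\ge1}$ distributed as $(L,R)$; independent random variables $(I_n)_{n\ge1}$ with $I_n$ uniform on $\{1,\dots,n\}$; a process $(\nu_t)_{t\ge0}$ with $P\{\nu_t=n\}=e^{-t}(1-e^{-t})^{n-1}$, $n\ge1$ (so $\nu_0=1$). Define $\beta_{1,1}=1$, $(\beta_{1,2},\beta_{2,2})=(L_1,R_1)$ and, for $n\ge2$, $$(\beta_{1,n+1},\dots,\beta_{n+1,n+1})=(\beta_{1,n},\dots,\beta_{I_n-1,n},L_n\beta_{I_n,n},R_n\beta_{I_n,n},\beta_{I_n+1,n},\dots,\beta_{n,n}).$$ Put $W_n=\sum_{j=1}^n\beta_{j,n}X_j$ and $V_t=W_{\nu_t}=\sum_{j=1}^{\nu_t}\beta_{j,\nu_t}X_j$. (The characteristic function $\phi(t;\cdot)$ of $V_t$ is the solution of $\partial_t\phi(t;\xi)+\phi(t;\xi)=\mathbb{E}[\phi(t;L\xi)\phi(t;R\xi)]$, $\phi(0;\cdot)=\phi_0$.) $M_n^{(2)}=\sum_{j=1}^n\beta_{j,n}^2$, and $M_\infty^{(2)}\ge0$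 is its almost sure limit as $n\to\infty$ (which exists when $\mathbb{E}[L^2+R^2]=1$). Non-degenerate means not almost surely constant; a Gaussian random variable is allowed to have zero variance (this happens when $\sigma^2=0$). *)

(* Defs.v *)
From HB Require Import structures.
From mathcomp Require Import all_boot all_order all_algebra finmap.
From mathcomp Require Import all_classical all_reals all_analysis.
From mathcomp Require Import measurable_realfun complex.

Set Implicit Arguments.
Unset Strict Implicit.
Unset Printing Implicit Defensive.

Import Order.TTheory GRing.Theory Num.Theory.
Import numFieldNormedType.Exports.

Local Open Scope classical_set_scope.
Local Open Scope ring_scope.

Section laws_and_independence.
Context {d : measure_display} {T : measurableType d} {R : realType}
  (P : probability T R).

Definition eq_in_law {d1 d' : measure_display} {T1 : measurableType d1}
    {T' : measurableType d'} (P1 : probability T1 R)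
    (Y : {mfun T >-> T'}) (Y1 : {mfun T1 >-> T'}) :=
  forall A : set T', measurable A -> distribution P Y A = distribution P1 Y1 A.

Definition sigma_of {d' : measure_display} {T' : measurableType d'}
    (Y : {mfun T >-> T'}) : set (set T) :=
  preimage_set_system setT Y measurable.

Definition sigma_of_family {I : Type} {d' : measure_display}
    {T' : measurableType d'} (D : set I) (Y : I -> {mfun T >-> T'}) :
    set (set T) :=
  <<s \bigcup_(i in D) sigma_of (Y i) >>.

Definition mutually_independent {I : choiceType} (D : set I)
    (F : I -> set (set T)) :=
  forall (J : {fset I}) (A : I -> set T),
    [set` J] `<=` D ->
    (forall i, i \in J -> F i (A i)) ->
    P (\bigcap_(i in [set` J]) A i) = (\prod_(i <- J) P (A i))%E.

Definition degenerate (Y : T -> R) :=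
  exists c : R, {ae P, forall w, Y w = c}.

(* [normal_prob m s] is the normal law only for [s != 0]; a Gaussian variable
   of zero variance has a Dirac law. *)
Definition is_gaussian (Y : {RV P >-> R}) :=
  exists m s : R, forall A : set R, measurable A ->
    distribution P Y A = if s == 0 then \d_m A else normal_prob m s A.

(* E[Z] = E[Re Z] + i E[Im Z] for an integrable complex random variable Z *)
Definition cexpectation (Z : T -> R[i]) : R[i] :=
  (fine 'E_P[(fun w => complex.Re (Z w))]%E +i* fine 'E_P[(fun w => complex.Im (Z w))]%E)%C.

(* exp(i x) *)
Definition expi (x : R) : R[i] := (cos x +i* sin x)%C.

Definition charfun (Y : T -> R) (xi : R) : R[i] :=
  cexpectation (fun w => expi (xi * Y w)).

End laws_and_independence.

Definition cvg_in_distribution {R : realType} {d d' : measure_display}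
    {T : measurableType d} {T' : measurableType d'}
    (P : probability T R) (P' : probability T' R)
    (V : R -> {RV P >-> R}) (Vinf : {RV P' >-> R}) :=
  forall x : R, {for x, continuous (cdf Vinf)} ->
    cdf (V t) x @[t --> +oo%R] --> cdf Vinf x.

(* x^s with the convention 0^0 = 0, whereas 0 `^ 0 = 1 *)
Definition pow0 {R : realType} (x s : R) : R := if x == 0 then 0 else x `^ s.

Definition calS {R : realType} {d : measure_display} {T : measurableType d}
    (P : probability T R) (LR : {RV P >-> (R * R)%type}) (s : R) : \bar R :=
  ('E_P[(fun w => (pow0 (LR w).1 s + pow0 (LR w).2 s)%R)] - 1)%E.

(* [beta l r i n j] is beta_{j,n} for 1 <= j <= n; l, r and i list the values
   of (L_n), (R_n) and (I_n). All these indices start at 1: index 0 is junk. *)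
Fixpoint beta {R : realType} (l r : nat -> R) (i : nat -> nat) (n : nat) :
    nat -> R :=
  match n with
  | 0 | 1 => fun=> 1
  | 2 => fun j => if j == 1%N then l 1%N else r 1%N
  | m.+1 => fun j =>
      if (j < i m)%N then beta l r i m j
      else if j == i m then l m * beta l r i m (i m)
      else if j == (i m).+1 then r m * beta l r i m (i m)
      else beta l r i m j.-1
  end.

Section process.
Context {d : measure_display} {T : measurableType d} {R : realType}
  (P : probability T R).
Variables (X : nat -> {RV P >-> R}) (LR : nat -> {RV P >-> (R * R)%type}).
Variables (I : nat -> {RV P >-> nat}) (nu : R -> {RV P >-> nat}).

Definition beta_rv (n j : nat) (w : T) : R :=
  beta (fun k => (LR k w).1) (fun k => (LR k w).2) (fun k => I k w) n j.

Definition M2 (n : nat) (w : T) : R :=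
  \sum_(1 <= j < n.+1) beta_rv n j w ^+ 2.

Definition W (n : nat) (w : T) : R :=
  \sum_(1 <= j < n.+1) beta_rv n j w * X j w.

Definition V (t : R) (w : T) : R := W (nu t w) w.

Lemma measurable_random_index (f : nat -> T -> R) (N : {RV P >-> nat}) :
  (forall n, measurable_fun setT (f n)) ->
  measurable_fun setT (fun w => f (N w) w).
Proof.
move=> mf _ B mB; rewrite setTI.
rewrite (_ : _ @^-1` B = \bigcup_n (N @^-1` [set n] `&` f n @^-1` B)).
  apply: bigcup_measurable => n _; apply: measurableI.
    by rewrite -[_ @^-1` _]setTI; exact: measurable_funP.
  by rewrite -[_ @^-1` _]setTI; exact: mf.
apply/seteqP; split => [w /= Bw|w [n _ [/= <-]]//].
by exists (N w).
Qed.

Lemma measurable_beta_rv n j : measurable_fun setT (beta_rv n j).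
Proof.
have mL k : measurable_fun setT (fun w => (LR k w).1).
  exact: (measurableT_comp (@measurable_fst _ _ _ _) (measurable_funP (LR k))).
have mR k : measurable_fun setT (fun w => (LR k w).2).
  exact: (measurableT_comp (@measurable_snd _ _ _ _) (measurable_funP (LR k))).
have mI k (p : pred nat) : measurable_fun setT (fun w => p (I k w)).
  by apply: (@measurableT_comp _ _ _ _ _ _ p) => //; exact: measurable_funP.
elim: n j => [|[|[|n]] IH] j; rewrite /beta_rv /=.
- exact: measurable_cst.
- exact: measurable_cst.
- by case: (j == 1%N); [exact: mL|exact: mR].
have mk := measurable_random_index (I n.+2) IH.
apply: measurable_fun_ifT; [exact: (mI _ (fun k => j < k)%N)|exact: IH|].
apply: measurable_fun_ifT; first exact: (mI _ (fun k => j == k)).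
  by apply: measurable_funM; [exact: mL|exact: mk].
apply: measurable_fun_ifT; [exact: (mI _ (fun k => j == k.+1))| |exact: IH].
by apply: measurable_funM; [exact: mR|exact: mk].
Qed.

Lemma measurable_W n : measurable_fun setT (W n).
Proof.
apply: measurable_sum => j.
by apply: measurable_funM => //; exact: measurable_beta_rv.
Qed.

Lemma measurable_V t : measurable_fun setT (V t).
Proof. by apply: measurable_random_index => n; exact: measurable_W. Qed.

HB.instance Definition _ (t : R) :=
  isMeasurableFun.Build _ _ _ _ (V t) (measurable_V t).

Definition V_rv (t : R) : {RV P >-> R} := V t.

End process.

(* Main.v *)
Require Import Defs.
From HB Require Import structures.
From mathcomp Require Import all_boot all_order all_algebra finmap.
From mathcomp Require Import all_classical all_reals all_analysis.
From mathcomp Require Import measurable_realfun complex.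
From mathcomp Require Import ring lra zify.

Set Implicit Arguments.
Unset Strict Implicit.
Unset Printing Implicit Defensive.

Import Order.TTheory GRing.Theory Num.Theory.
Import numFieldNormedType.Exports.

Local Open Scope classical_set_scope.
Local Open Scope ring_scope.

(** The weights [beta_(j,n)] are the leaves of a random binary tree that grows
by replacing a uniformly chosen leaf [b] by the two leaves [L b] and [R b].
Conditionally on the tree, [W_n] is a sum of independent centred variables, so
it should be close to a centred Gaussian of variance [sigma^2 M_n^(2)]; since
[M_n^(2)] converges, the limit is a Gaussian mixture, realised on the product of
the given space with a Gaussian line as [sqrt(M_oo) Z].

The central limit theorem ([central_limit]) is Lindeberg's replacement: the
[X_j] are exchanged one at a time for a Gaussian damping factor, the
environment and the other [X_i] being frozen ([Rintegral_freeze],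
[hybrid_step]). One exchange costs [e (xi b)^2 + K |xi b|^gamma], because the
two transforms agree to second order for small [b] and are bounded for large
[b].
The total is controlled by the mean power sums: these satisfy
[E M_(n+1)^(s) = (1 + S(s) / n) E M_n^(s)], hence are constant for [s = 2] and
tend to [0] for [s = gamma] ([mean_powsumS], [cvg_decay]). The random index
[nu_t] is independent of everything else and tends to infinity in probability
([cvg_random_index]). Everything is expressed through the real functions
[cos (theta + xi x)]; two phases [theta] give the real and imaginary parts of
the characteristic function. Their convergence implies convergence in
distribution because a Gaussian smoothing of a law has a density that is a
Gaussian average of such cosines ([smoothed_density], [continuity_theorem]).

Non-degeneracy is a question about [M_oo]. If [gamma < 2], subadditivity of
[t^(gamma/2)] bounds [(M_n^(2))^(gamma/2)] by [M_n^(gamma)], whose mean tends to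
[0] ([limit_zero]). If [S(p) < 0] with [p > 2], the first-order effect of a
split on the [p/2]-moment of the mass cancels and the remaining increments are summable, so
this moment stays bounded ([moment_bounded]); hence [M_oo] has a finite
[p/2]-moment, and no mass is lost in the limit, so that [M_oo] does not vanish
([limit_nonzero]).

Conversely, let [M_oo] be non-zero with a finite [p/2]-moment. Decomposing the
tree at its first split shows that [M_oo] has the law of
[L^2 M' + R^2 M''] with independent copies [M'], [M''] of itself; this is proved
for Laplace transforms ([psi_fixpoint], [laplace_fixpoint]) and carried over to
moments of real order, which are Mellin averages of Laplace transforms
([laplace_determines_moments]). Superadditivity of [t^(p/2)] then gives
[E[L^p + R^p] <= 1], and equality would force [L R = 0], hence
[E (L^2 + R^2)^(p/2) = 1 = E (L^2 + R^2)], hence [L^2 + R^2 = 1] almost surely by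
strict convexity, hence [S(gamma) = 0], a contradiction ([branching_lt1]). *)

(** * Independence of groups of variables *)

Section grouping.
Context {d : measure_display} {T : measurableType d} {R : realType}
  (P : probability T R).
Local Open Scope ereal_scope.

(** The sets independent of [B] form a lambda-system, so independence extends
from a pi-system to the sigma-algebra that it generates. *)
Lemma pi_system_independent (G : set (set T)) (B : set T) :
  setI_closed G -> G setT -> G `<=` measurable -> measurable B ->
  (forall A, G A -> P (A `&` B) = P A * P B) ->
  forall A, <<s G >> A -> P (A `&` B) = P A * P B.
Proof.
move=> GI GT Gm mB GB A sA.
have [r PBE] : exists r : {nonneg R}, P B = (r%:num)%:E.
  have PB0 : (0 <= fine (P B))%R by exact: fine_ge0.
  by exists (NngNum PB0); rewrite /= fineK// fin_num_measure.
rewrite PBE muleC.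
have := @g_sigma_algebra_measure_unique _ _ _ G Gm (fun=> setT) (fun=> GT) _
  (mrestr P mB) (mscale r P) GI.
apply=> //.
- by apply/seteqP; split => // x _; exists 0%N.
- move=> C GC; transitivity (P B * P C); last by rewrite PBE.
  by rewrite muleC; exact: GB.
- move=> _; apply: (@le_lt_trans _ _ 1); last exact: ltry.
  by apply: probability_le1; exact: measurableI.
Qed.

(** Finite intersections of events of distinct members of the family form a
pi-system that generates the joint sigma-algebra; one member outside of the
group is independent of each of them. *)
Lemma mutually_independent_grouping (I : choiceType) (D' D : set I)
    (F : I -> set (set T)) (i0 : I) :
  mutually_independent P D' F -> D `<=` D' -> D' i0 -> ~ D i0 ->
  (forall i, F i `<=` measurable) -> (forall i, setI_closed (F i)) ->
  (forall i, F i setT) ->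
  forall A B, <<s \bigcup_(i in D) F i >> A -> F i0 B ->
  P (A `&` B) = P A * P B.
Proof.
move=> indF DD' D'i0 nDi0 Fm FI FT A B sA FB.
pose G := [set C | exists (J : {fset I}) (E : I -> set T),
  [/\ [set` J] `<=` D, forall i, F i (E i)
   & C = \bigcap_(i in [set` J]) E i]].
apply: (@pi_system_independent G) => //.
- move=> _ _ [J [E [JD FE ->]]] [K [H [KD FH ->]]].
  exists (J `|` K)%fset.
  exists (fun i => (if i \in J then E i else setT) `&`
                   (if i \in K then H i else setT)); split.
  + by move=> i /=; rewrite in_fsetE => /orP[/JD|/KD].
  + by move=> i; apply: FI; case: ifP.
  + apply/seteqP; split=> [x [Ex Hx] i /= _|x EHx].
      by split; case: ifPn => // iJ; [exact: Ex|exact: Hx].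
    by split=> i /= iJ; have [|] := EHx i; rewrite /= ?in_fsetE iJ ?orbT.
- exists fset0, (fun=> setT); split => //.
  by rewrite set_fset0 bigcap_set0.
- move=> _ [J [E [JD FE ->]]]; apply: fin_bigcap_measurable => // i _.
  exact: Fm.
- exact: Fm FB.
- move=> _ [J [E [JD FE ->]]].
  have i0J : i0 \notin J by apply/negP => /JD.
  pose H i := if i == i0 then B else E i.
  have HE i : i \in J -> H i = E i.
    by rewrite /H; case: eqP => // ->; rewrite (negbTE i0J).
  have Hi0 : H i0 = B by rewrite /H eqxx.
  have := indF (i0 |` J)%fset H.
  rewrite bigcap_fsetU1 big_fsetU1//= Hi0 setIC.
  rewrite (_ : \bigcap_(i in [set` J]) H i = \bigcap_(i in [set` J]) E i); last first.
    by apply: eq_bigcapr => i /= /HE.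
  move=> ->.
  + rewrite muleC; congr (_ * _).
    rewrite indF//; last by move=> i /JD/DD'.
    by rewrite big_seq [RHS]big_seq; apply: eq_bigr => i /HE ->.
  + by move=> i /=; rewrite !inE => /predU1P[->//|/JD/DD'].
  + by move=> i; rewrite !inE => /predU1P[->|/HE ->//]; rewrite Hi0.
- apply: (sub_smallest2r _ _ sA); first exact: smallest_sigma_algebra.
  move=> C [i Di FC]; exists [fset i]%fset, (fun j => if j == i then C else setT).
  split.
  + by move=> j /=; rewrite in_fset1 => /eqP ->.
  + by move=> j; case: eqP => [->|].
  + by rewrite set_fset1 bigcap_set1 eqxx.
Qed.

End grouping.

Section hierarchical_independence.
Context {d : measure_display} {T : measurableType d} {R : realType}
  (P : probability T R).
Local Open Scope ereal_scope.

(** The product rule is applied first across the families, to the finite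
intersections of their members, and then inside each of them. *)
Lemma hierarchical_independence (K : finType) (S : K -> set (set T))
    (D : K -> set nat) (F : K -> nat -> set (set T)) :
  mutually_independent P [set: K] S ->
  (forall k, setI_closed (S k)) -> (forall k, S k setT) ->
  (forall k n, D k n -> F k n `<=` S k) ->
  (forall k, mutually_independent P (D k) (F k)) ->
  mutually_independent P [set i : K * nat | D i.1 i.2] (fun i => F i.1 i.2).
Proof.
move=> indS SI ST FS indF J E JD FE.
pose Jk k : {fset nat} := [fset i.2 | i in J & i.1 == k]%fset.
have JkP k n : n \in Jk k -> (k, n) \in J.
  by case/imfsetP => -[k' n'] /=; rewrite inE /= => /andP[iJ /eqP <-] ->.
have JkD k : [set` Jk k] `<=` D k.
  by move=> n /= /JkP /JD.
pose B k := \bigcap_(n in [set` Jk k]) E (k, n).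
have JB : \bigcap_(i in [set` J]) E i =
    \bigcap_(k in [set` [fset k | k in K]%fset]) B k.
  apply/seteqP; split=> [x Ex k /= _ n /= /JkP kn|x Bx [k n] /= kn].
    exact: (Ex (k, n)).
  apply: (Bx k) => /=; first by rewrite in_fset.
  by apply/imfsetP; exists (k, n) => //=; rewrite inE kn eqxx.
rewrite JB indS//; last first.
  move=> k _; rewrite /B bigcap_fset big_seq.
  apply: (big_ind (S k)) => // [X Y|n /JkP kn]; first exact: SI.
  by apply: (FS k n); [exact: (JD (k, n))|exact: (FE (k, n))].
rewrite big_imfset//= [RHS](partition_big fst xpredT)//= [LHS]big_enum/=.
apply: eq_bigr => k _.
rewrite /B (indF k)//; last by move=> n /JkP kn; exact: (FE (k, n)).
rewrite /Jk big_imfset/=; last first.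
  by move=> [a n] [b m] /andP[_ /= /eqP ->] /andP[_ /= /eqP ->] /= ->.
rewrite big_filter.
by apply: eq_bigr => -[a n] /= /eqP ->.
Qed.

End hierarchical_independence.

(** * Integrating out an independent variable *)

Section freezing.
Context {d d' d2 : measure_display} {T : measurableType d}
  {S : measurableType d'} {T2 : measurableType d2} {R : realType}
  (P : probability T R) (P2 : probability T2 R).
Local Open Scope ereal_scope.

(** Both sides are integrals of [h], one against the joint law of the identity
and [Z], the other against a product measure; independence says that these two
measures agree on rectangles, hence on the product sigma-algebra. *)
Lemma integral_freeze (G : set (set T)) (Z : {mfun T >-> S})
    (Z0 : {mfun T2 >-> S}) (h : g_sigma_algebraType G * S -> \bar R) :
  G `<=` measurable ->
  (forall A B, <<s G >> A -> measurable B ->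
     P (A `&` Z @^-1` B) = P A * P (Z @^-1` B)) ->
  eq_in_law P P2 Z Z0 ->
  measurable_fun setT h -> (forall x, 0 <= h x) ->
  \int[P]_w h (w, Z w) = \int[P]_w \int[P2]_v h (w, Z0 v).
Proof.
move=> Gm indZ lawZ mh h0.
have sG A : <<s G >> A -> measurable A.
  by apply: smallest_sub => //; exact: sigma_algebra_measurable.
pose idG : T -> g_sigma_algebraType G := fun w => w.
have midG : measurable_fun setT idG.
  by move=> _ A mA; rewrite setTI; exact: sG.
pose idG' : {mfun T >-> g_sigma_algebraType G} :=
  HB.pack idG (isMeasurableFun.Build _ _ _ _ idG midG).
pose phi (w : T) := (idG w, Z w).
have mphi : measurable_fun setT phi.
  by apply: measurable_fun_pair => //; exact: measurable_funP.
pose phi' : {mfun T >-> (g_sigma_algebraType G * S)%type} :=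
  HB.pack phi (isMeasurableFun.Build _ _ _ _ phi mphi).
pose m1 : probability _ R := distribution P idG'.
pose m2 : probability _ R := distribution P2 Z0.
have mE : forall C, measurable C -> (m1 \x m2) C = distribution P phi' C.
  apply: product_measure_unique => A B mA mB.
  transitivity (P (A `&` Z @^-1` B)) => //.
  by rewrite indZ//; congr (_ * _); exact: lawZ.
transitivity (\int[distribution P phi']_x h x).
  by rewrite ge0_integral_distribution.
transitivity (\int[m1 \x m2]_x h x).
  by apply: eq_measure_integral => C mC _; exact/esym/mE.
rewrite fubini_tonelli1//.
rewrite ge0_integral_distribution//; last 2 first.
- exact: measurable_fun_fubini_tonelli_F.
- by move=> x; apply: integral_ge0.
apply: eq_integral => w _ /=; rewrite /fubini_F.
rewrite ge0_integral_distribution//.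
exact: (measurableT_comp mh (pair1_measurable (idG w))).
Qed.

End freezing.

(** * The leaves of the random binary splitting *)

Section splitting.
Context {R : realType}.
Implicit Types (s : seq R) (l r : nat -> R) (i : nat -> nat).

Definition split_leaf k s (x : R * R) : seq R :=
  take k s ++ [:: x.1 * s`_k, x.2 * s`_k & drop k.+1 s].

Definition leaves l r i n : seq R := [seq beta l r i n j | j <- iota 1 n].

Lemma size_leaves l r i n : size (leaves l r i n) = n.
Proof. by rewrite size_map size_iota. Qed.

Lemma nth_leaves l r i n k : (k < n)%N -> (leaves l r i n)`_k = beta l r i n k.+1.
Proof. by move=> kn; rewrite (nth_map 0%N) ?size_iota// nth_iota. Qed.

Lemma leaves1 l r i : leaves l r i 1 = [:: 1].
Proof. by []. Qed.

Lemma size_split_leaf k s x : (k < size s)%N ->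
  size (split_leaf k s x) = (size s).+1.
Proof.
move=> ks; rewrite size_cat/= size_takel ?size_drop ?(ltnW ks)//.
lia.
Qed.

Lemma leavesS l r i n k : (k < n)%N -> i n = k.+1 ->
  leaves l r i n.+1 = split_leaf k (leaves l r i n) (l n, r n).
Proof.
case: n => // -[|n] kn ik.
  by case: k kn ik => // _ _; rewrite /leaves /split_leaf /= !mulr1.
apply: (@eq_from_nth _ 0); first by rewrite size_split_leaf !size_leaves.
move=> j; rewrite size_leaves => jn.
rewrite nth_leaves// nth_cat size_takel ?size_leaves ?(ltnW kn)//.
pose b := beta l r i n.+2; have nthb := nth_leaves l r i.
have -> : beta l r i n.+3 j.+1 = if (j.+1 < i n.+2)%N then b j.+1
    else if j.+1 == i n.+2 then l n.+2 * b (i n.+2)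
    else if j.+1 == (i n.+2).+1 then r n.+2 * b (i n.+2) else b j by [].
rewrite ik ltnS !eqSS nthb// -/(b k.+1).
case: ltngtP => jk.
- by rewrite nth_take// nthb// (ltn_trans jk).
- case: eqVneq => [->|jk1]; first by rewrite subSnn.
  rewrite (_ : (j - k = (j - k.+2).+2)%N); last by lia.
  rewrite -[RHS]/((drop k.+1 (leaves l r i n.+2))`_(j - k.+2)).
  by rewrite nth_drop nthb; [congr b; lia|lia].
- by rewrite jk subnn.
Qed.

End splitting.

Section measurable_leaves.
Context {d : measure_display} {T : measurableType d} {R : realType}.

Lemma measurable_nat_index (f : nat -> T -> R) (N : T -> nat) :
  measurable_fun setT N -> (forall n, measurable_fun setT (f n)) ->
  measurable_fun setT (fun w => f (N w) w).
Proof.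
move=> mN mf _ B mB; rewrite setTI.
rewrite (_ : _ @^-1` B = \bigcup_n (N @^-1` [set n] `&` f n @^-1` B)).
  apply: bigcup_measurable => n _; apply: measurableI.
    by rewrite -[_ @^-1` _]setTI; exact: mN.
  by rewrite -[_ @^-1` _]setTI; exact: mf.
apply/seteqP; split => [w /= Bw|w [n _ [/= <-]]//].
by exists (N w).
Qed.

Lemma measurable_beta (l r : nat -> T -> R) (i : nat -> T -> nat) n :
  (forall k, (0 < k < n)%N -> [/\ measurable_fun setT (l k),
     measurable_fun setT (r k) & measurable_fun setT (i k)]) ->
  forall j, measurable_fun setT (fun w => beta (l^~ w) (r^~ w) (i^~ w) n j).
Proof.
elim: n => [|[|[|n]] IH] mlri j.
- exact: measurable_cst.
- exact: measurable_cst.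
- by have [ml mr _] := mlri 1%N isT; rewrite /=; case: (j == 1%N).
have {}IH : forall j, measurable_fun setT
    (fun w => beta (l^~ w) (r^~ w) (i^~ w) n.+2 j).
  by apply: IH => k /andP[k0 kn]; apply: mlri; rewrite k0 ltnS ltnW.
have [ml mr mi] := mlri n.+2 (ltnSn _).
have mI (p : pred nat) : measurable_fun setT (fun w => p (i n.+2 w)).
  by apply: (@measurableT_comp _ _ _ _ _ _ p) => //.
have mk := measurable_nat_index mi IH.
apply: measurable_fun_ifT; [exact: (mI (fun k => j < k)%N)|exact: IH|].
apply: measurable_fun_ifT; first exact: (mI (fun k => j == k)).
  exact: measurable_funM.
apply: measurable_fun_ifT; [exact: (mI (fun k => j == k.+1))| |exact: IH].
exact: measurable_funM.
Qed.

End measurable_leaves.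

Section leaf_functionals.
Context {R : realType}.

(** Measurability of a functional of sequences, tested along measurable
entries; this avoids putting a sigma-algebra on the type of sequences of
varying length. *)
Definition measurable_seqfun {d' : measure_display} {S' : measurableType d'}
    (Phi : seq R -> S') :=
  forall (d : measure_display) (S : measurableType d) (f : nat -> S -> R) m,
    (forall k, measurable_fun setT (f k)) ->
    measurable_fun setT (fun w => Phi [seq f k w | k <- iota 0 m]).

Lemma split_leafE (f : nat -> R) k m x : (k < m)%N ->
  split_leaf k [seq f j | j <- iota 0 m] x =
  [seq (if (j < k)%N then f j else if j == k then x.1 * f k
        else if j == k.+1 then x.2 * f k else f j.-1) | j <- iota 0 m.+1].
Proof.
move=> km; apply: (@eq_from_nth _ 0).
  by rewrite size_split_leaf size_map size_iota// size_map size_iota.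
rewrite size_split_leaf ?size_map ?size_iota// => j jm.
rewrite (nth_map 0%N) ?size_iota// nth_iota// add0n.
rewrite nth_cat size_takel ?size_map ?size_iota ?(ltnW km)//.
rewrite (nth_map 0%N) ?size_iota// nth_iota// add0n.
case: ltngtP => jk.
- by rewrite nth_take// (nth_map 0%N) ?size_iota ?nth_iota// (ltn_trans jk).
- case: eqVneq => [->|jk1]; first by rewrite subSnn.
  rewrite (_ : (j - k = (j - k.+2).+2)%N); last by lia.
  rewrite -[LHS]/((drop k.+1 [seq f j | j <- iota 0 m])`_(j - k.+2)).
  rewrite nth_drop (nth_map 0%N) ?size_iota ?nth_iota; [|lia..].
  by congr f; lia.
- by rewrite jk subnn.
Qed.

Lemma measurable_split_leaf {d d' : measure_display} {S : measurableType d}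
    {S' : measurableType d'} (Phi : seq R -> S') (f : nat -> S -> R)
    (x y : S -> R) k m : (k < m)%N ->
  measurable_seqfun Phi -> (forall j, measurable_fun setT (f j)) ->
  measurable_fun setT x -> measurable_fun setT y ->
  measurable_fun setT
    (fun w => Phi (split_leaf k [seq f j w | j <- iota 0 m] (x w, y w))).
Proof.
move=> km mPhi mf mx my; under eq_fun do rewrite split_leafE//=.
apply: (mPhi _ _ (fun j w => if (j < k)%N then f j w else
  if j == k then x w * f k w else if j == k.+1 then y w * f k w
  else f j.-1 w) m.+1) => j.
case: (j < k)%N => //; case: (j == k); first exact: measurable_funM.
by case: (j == k.+1) => //; exact: measurable_funM.
Qed.

End leaf_functionals.

Section one_step.
Context {d d1 : measure_display} {T : measurableType d} {T1 : measurableType d1}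
  {R : realType} (P : probability T R) (P1 : probability T1 R).
Variables (LR : nat -> {RV P >-> (R * R)%type}) (I : nat -> {RV P >-> nat})
  (LR0 : {RV P1 >-> (R * R)%type}).

(** What has been drawn strictly before step [n]; the leaves at stage [n] are
measurable for it. *)
Definition past n : set (set T) :=
  \bigcup_(k in [set k | (0 < k < n)%N]) (sigma_of (LR k) `|` sigma_of (I k)).

Definition leaves_rv n w : seq R :=
  leaves (fun k => (LR k w).1) (fun k => (LR k w).2) (fun k => I k w) n.

Hypothesis LR_law : forall n, (0 < n)%N -> eq_in_law P P1 (LR n) LR0.
Hypothesis I_law : forall n k, (1 <= k <= n)%N ->
  P (I n @^-1` [set k]) = (n%:R^-1)%:E.
Hypothesis LR_past : forall n A B, (0 < n)%N -> <<s past n >> A ->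
  measurable B -> (P (A `&` LR n @^-1` B) = P A * P (LR n @^-1` B))%E.
Hypothesis I_past : forall n A B, (0 < n)%N ->
  <<s past n `|` sigma_of (LR n) >> A ->
  measurable B -> (P (A `&` I n @^-1` B) = P A * P (I n @^-1` B))%E.

Lemma measurable_sigma_of {d' : measure_display} {S : measurableType d'}
    (Y : {mfun T >-> S}) : sigma_of Y `<=` measurable.
Proof. by move=> _ [B mB <-]; exact: measurable_funP. Qed.

Lemma measurable_past n : past n `<=` measurable.
Proof. by move=> A [k _ [|]]; exact: measurable_sigma_of. Qed.

Lemma measurable_wrt {d' : measure_display} {S : measurableType d'}
    (G : set (set T)) (Y : {mfun T >-> S}) :
  sigma_of Y `<=` <<s G >> ->
  measurable_fun setT (Y : g_sigma_algebraType G -> S).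
Proof. by move=> YG _ B mB; apply: YG; exists B. Qed.

Lemma measurable_beta_wrt (G : set (set T)) n j : past n `<=` <<s G >> ->
  measurable_fun setT
    (fun w : g_sigma_algebraType G => beta_rv LR I n j w).
Proof.
move=> nG.
pose l k (w : g_sigma_algebraType G) := (LR k w).1.
pose r k (w : g_sigma_algebraType G) := (LR k w).2.
pose i k (w : g_sigma_algebraType G) := I k w.
apply: (@measurable_beta _ _ _ l r i) => k kn.
have mLR : measurable_fun setT (LR k : g_sigma_algebraType G -> (R * R)%type).
  by apply: measurable_wrt => A sA; apply: nG; exists k => //; left.
split.
- exact: (measurableT_comp (@measurable_fst _ _ _ _) mLR).
- exact: (measurableT_comp (@measurable_snd _ _ _ _) mLR).
- by apply: measurable_wrt => A sA; apply: nG; exists k => //; right.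
Qed.

Lemma leaves_rvE n w :
  leaves_rv n w = [seq beta_rv LR I n k.+1 w | k <- iota 0 n].
Proof.
rewrite /leaves_rv /leaves -[X in iota X _]addn0 iotaDl -map_comp.
exact: eq_map.
Qed.

Lemma measurable_leaves_rv {d' : measure_display} {S' : measurableType d'}
    (Phi : seq R -> S') n : measurable_seqfun Phi ->
  measurable_fun setT (fun w => Phi (leaves_rv n w)).
Proof.
move=> mPhi; under eq_fun do rewrite leaves_rvE.
by apply: (mPhi _ _ (fun k w => beta_rv LR I n k.+1 w)) => k;
  exact: measurable_beta_rv.
Qed.

Lemma I_range n : (0 < n)%N ->
  {ae P, forall w, exists2 k, (k < n)%N & I n w = k.+1}.
Proof.
move=> n0.
pose A := \big[setU/set0]_(k < n) (I n @^-1` [set k.+1]).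
have mI k : measurable (I n @^-1` [set k]) by exact: measurable_funPTI.
have PA : P A = 1%E.
  rewrite /A measure_semi_additive_ord//.
  - rewrite (eq_bigr (fun=> (n%:R^-1)%:E)); last first.
      by move=> k _; apply: I_law; rewrite ltn_ord.
    rewrite sumEFin sumr_const card_ord -[X in X%:E]mulr_natr mulVf//.
    by rewrite pnatr_eq0 -lt0n.
  - by move=> i j _ _ [w [/= -> [/ord_inj]]].
  - exact: bigsetU_measurable.
exists (~` A); split.
- by apply: measurableC; exact: bigsetU_measurable.
- rewrite probability_setC ?PA ?subee//; exact: bigsetU_measurable.
- move=> w /=; apply: contra_not.
  by rewrite /A -(bigcup_mkord n (fun k => I n @^-1` [set k.+1])) => -[k /= kn ->]; exists k.
Qed.

Local Open Scope ereal_scope.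

(** Condition on [I_n], which is uniform and independent of the leaves and of
[(L_n, R_n)], then integrate out [(L_n, R_n)], which is independent of the
leaves. *)
Lemma one_step n (Phi : seq R -> \bar R) : (0 < n)%N ->
  measurable_seqfun Phi -> (forall s, 0 <= Phi s) ->
  \int[P]_w Phi (leaves_rv n.+1 w) =
  \sum_(k < n) (n%:R^-1)%:E *
    \int[P]_w \int[P1]_v Phi (split_leaf k (leaves_rv n w) (LR0 v)).
Proof.
move=> n0 mPhi Phi0.
pose G := past n `|` sigma_of (LR n).
pose h k (w : g_sigma_algebraType G) := Phi (split_leaf k (leaves_rv n w) (LR n w)).
have mLR : measurable_fun setT (LR n : g_sigma_algebraType G -> (R * R)%type).
  by apply: measurable_wrt => A sA; apply: sub_sigma_algebra; right.
have mh k : (k < n)%N -> measurable_fun setT (h k).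
  move=> kn; rewrite /h; under eq_fun do rewrite leaves_rvE.
  under eq_fun do rewrite [LR _ _]surjective_pairing.
  apply: (measurable_split_leaf
    (f := fun j (w : g_sigma_algebraType G) => beta_rv LR I n j.+1 w)) => //.
  - move=> j; apply: measurable_beta_wrt => A sA.
    by apply: sub_sigma_algebra; left.
  - exact: (measurableT_comp (@measurable_fst _ _ _ _) mLR).
  - exact: (measurableT_comp (@measurable_snd _ _ _ _) mLR).
have GT : G `<=` measurable.
  move=> A [|]; first exact: measurable_past.
  exact: measurable_sigma_of.
have mhT k : (k < n)%N -> measurable_fun setT (h k : T -> \bar R).
  move=> kn _ B mB; have /(_ measurableT _ mB) := mh _ kn.
  by apply: smallest_sub => //; exact: sigma_algebra_measurable.
pose g (x : g_sigma_algebraType G * nat) :=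
  \sum_(k < n) (if x.2 == k.+1 then h k x.1 else 0).
have g0 x : 0 <= g x by apply: sume_ge0 => k _; case: ifP => // _; exact: Phi0.
have mg : measurable_fun setT g.
  apply: emeasurable_sum => k; apply: measurable_fun_ifT => //.
    exact: (measurableT_comp (f := fun m => m == k.+1) _ (@measurable_snd _ _ _ _)).
  exact: (measurableT_comp (mh _ (ltn_ord k)) (@measurable_fst _ _ _ _)).
transitivity (\int[P]_w g (w, I n w)).
  apply: ge0_ae_eq_integral => //.
  - exact: measurable_leaves_rv.
  - apply: emeasurable_sum => k; apply: measurable_fun_ifT => //; last exact: mhT.
    exact: (measurableT_comp (f := fun m => m == k.+1)).
  - apply: filterS (I_range n0) => w /= [k kn Ik] _.
    rewrite /g (bigD1 (Ordinal kn))//= Ik eqxx big1 ?adde0//.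
      rewrite /h /leaves_rv (leavesS _ _ kn Ik).
      by rewrite -surjective_pairing.
    by move=> j jk; rewrite eqSS eq_sym ifN.
rewrite (@integral_freeze _ _ _ _ _ _ _ P P G (I n) (I n))//; last first.
  by move=> A B sA mB; exact: I_past.
transitivity (\int[P]_w \sum_(k < n) (n%:R^-1)%:E * h k w).
  apply: eq_integral => w _.
  rewrite /g ge0_integral_sum//=; last 2 first.
  - move=> k; apply: measurable_fun_ifT => //.
    exact: (measurableT_comp (f := fun m => m == k.+1)).
  - by move=> k v _; case: ifP => // _; exact: Phi0.
  apply: eq_bigr => k _.
  have mIk : measurable (I n @^-1` [set k.+1]) by exact: measurable_funPTI.
  rewrite (eq_integral (fun v => h k w * (\1_(I n @^-1` [set k.+1]) v)%:E)).
  + rewrite ge0_integralZl//.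
    * rewrite integral_indic// setIT muleC; congr (_ * _).
      by apply: I_law; rewrite ltn_ord.
    * exact/measurable_EFinP/measurable_indic.
    * exact: Phi0.
  + move=> v _; rewrite indicE; case: eqP => Iv.
      by rewrite mem_set// mule1.
    by rewrite memNset// mule0.
rewrite ge0_integral_sum//; last 2 first.
- by move=> k; apply: emeasurable_funM => //; exact: mhT.
- by move=> k w _; rewrite mule_ge0//; exact: Phi0.
apply: eq_bigr => k _; rewrite ge0_integralZl//; last 2 first.
- exact: mhT.
- by move=> w _; exact: Phi0.
congr (_ * _).
pose f (x : g_sigma_algebraType (past n) * (R * R)) :=
  Phi (split_leaf k (leaves_rv n x.1) x.2).
apply: (@integral_freeze _ _ _ _ _ _ _ P P1 (past n) (LR n) LR0 f) => //.
- exact: measurable_past.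
- by move=> A B sA mB; exact: LR_past.
- exact: LR_law.
- rewrite /f; under eq_fun do rewrite leaves_rvE.
  under eq_fun do rewrite [_.2]surjective_pairing.
  apply: (measurable_split_leaf
    (f := fun j (x : g_sigma_algebraType (past n) * (R * R)) =>
       beta_rv LR I n j.+1 x.1)) => //.
  + move=> j; apply: (measurableT_comp (f := beta_rv LR I n j.+1 : g_sigma_algebraType (past n) -> R)) => //.
    by apply: measurable_beta_wrt; exact: sub_sigma_algebra.
  + by apply: measurableT_comp => //; exact: measurable_snd.
  + by apply: measurableT_comp => //; exact: measurable_snd.
- by move=> x; exact: Phi0.
Qed.

End one_step.

(** * One splitting step and mean power sums *)

(** All that the analysis of the tree uses: at each step the position is
uniform, the factors have the prescribed law, and both are independent of the
past. *)
Record splitting_process {d d1 : measure_display} {T : measurableType d}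
    {T1 : measurableType d1} {R : realType} (P : probability T R)
    (P1 : probability T1 R) (LR : nat -> {RV P >-> (R * R)%type})
    (I : nat -> {RV P >-> nat}) (LR0 : {RV P1 >-> (R * R)%type}) : Prop := {
  LR_law : forall n, (0 < n)%N -> eq_in_law P P1 (LR n) LR0;
  I_law : forall n k, (1 <= k <= n)%N ->
    P (I n @^-1` [set k]) = (n%:R^-1)%:E;
  LR_past : forall n A B, (0 < n)%N -> <<s past LR I n >> A ->
    measurable B -> (P (A `&` LR n @^-1` B) = P A * P (LR n @^-1` B))%E;
  I_past : forall n A B, (0 < n)%N ->
    <<s past LR I n `|` sigma_of (LR n) >> A ->
    measurable B -> (P (A `&` I n @^-1` B) = P A * P (I n @^-1` B))%E
}.

Section one_step_sum.
Context {d d1 : measure_display} {T : measurableType d} {T1 : measurableType d1}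
  {R : realType} (P : probability T R) (P1 : probability T1 R).
Variables (LR : nat -> {RV P >-> (R * R)%type}) (I : nat -> {RV P >-> nat})
  (LR0 : {RV P1 >-> (R * R)%type}).
Hypothesis SP : splitting_process LR I LR0.
Local Open Scope ereal_scope.
Local Notation leaves_rv := (leaves_rv LR I).

Lemma measurable_fst_RV {d' : measure_display} {S : measurableType d'}
    (Y : {mfun S >-> (R * R)%type}) : measurable_fun setT (fun w => (Y w).1).
Proof. exact: (measurableT_comp (@measurable_fst _ _ _ _) (measurable_funP Y)). Qed.

Lemma measurable_snd_RV {d' : measure_display} {S : measurableType d'}
    (Y : {mfun S >-> (R * R)%type}) : measurable_fun setT (fun w => (Y w).2).
Proof. exact: (measurableT_comp (@measurable_snd _ _ _ _) (measurable_funP Y)). Qed.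

Lemma measurable_split_expectation n k (Phi : seq R -> \bar R) : (k < n)%N ->
  measurable_seqfun Phi -> (forall s, 0 <= Phi s) ->
  measurable_fun setT
    (fun w => \int[P1]_v Phi (split_leaf k (leaves_rv n w) (LR0 v))).
Proof.
move=> kn mPhi Phi0.
pose f (x : T * T1) := Phi (split_leaf k (leaves_rv n x.1) (LR0 x.2)).
apply: (measurable_fun_fubini_tonelli_F (m2 := P1) f) => //=;
  last by move=> x; exact: Phi0.
rewrite /f; under eq_fun do rewrite leaves_rvE [LR0 _]surjective_pairing.
apply: (measurable_split_leaf
  (f := fun j (x : T * T1) => beta_rv LR I n j.+1 x.1)) => //.
- move=> j; apply: (measurableT_comp (f := beta_rv LR I n j.+1)) => //.
  exact: measurable_beta_rv.
- exact: (measurableT_comp (measurable_fst_RV LR0) (@measurable_snd _ _ _ _)).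
- exact: (measurableT_comp (measurable_snd_RV LR0) (@measurable_snd _ _ _ _)).
Qed.

Lemma one_step_sum n (Phi : seq R -> \bar R) : (0 < n)%N ->
  measurable_seqfun Phi -> (forall s, 0 <= Phi s) ->
  \int[P]_w Phi (leaves_rv n.+1 w) =
  \int[P]_w \sum_(k < n) (n%:R^-1)%:E *
    \int[P1]_v Phi (split_leaf k (leaves_rv n w) (LR0 v)).
Proof.
move=> n0 mPhi Phi0.
rewrite (one_step (LR_law SP) (I_law SP) (LR_past SP) (I_past SP))//.
have i0 k w : 0 <= \int[P1]_v Phi (split_leaf k (leaves_rv n w) (LR0 v)).
  by apply: integral_ge0.
rewrite ge0_integral_sum//; last 2 first.
- by move=> k; apply: emeasurable_funM => //; exact: measurable_split_expectation.
- by move=> k w _; rewrite mule_ge0.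
apply: eq_bigr => k _; rewrite ge0_integralZl//.
exact: measurable_split_expectation.
Qed.

End one_step_sum.

Section power_sums.
Context {R : realType}.

Definition powsum (s : R) (l : seq R) : R := \sum_(b <- l) `|b| `^ s.

Lemma powsum_ge0 s l : 0 <= powsum s l.
Proof. by apply: sumr_ge0 => b _; exact: powR_ge0. Qed.

Lemma measurable_seqfun_sum (f : R -> R) : measurable_fun setT f ->
  measurable_seqfun (fun l => \sum_(b <- l) f b).
Proof.
move=> mf d S g m mg; under eq_fun do rewrite big_map.
by apply: measurable_sum => k; apply: measurableT_comp.
Qed.

Lemma measurable_seqfun_comp {d1 d2 : measure_display} {S1 : measurableType d1}
    {S2 : measurableType d2} (h : S1 -> S2) (Phi : seq R -> S1) :
  measurable_fun setT h -> measurable_seqfun Phi -> measurable_seqfun (h \o Phi).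
Proof. by move=> mh mPhi d S f m mf; apply: measurableT_comp => //; exact: mPhi. Qed.

Lemma measurable_abs_powR (s : R) : measurable_fun setT (fun x : R => `|x| `^ s).
Proof. by apply: (measurableT_comp (measurable_powR s)); exact: normr_measurable. Qed.

Lemma measurable_powsum s : measurable_seqfun (powsum s).
Proof. by apply: measurable_seqfun_sum; exact: measurable_abs_powR. Qed.

Lemma sum_split_leaf (f : R -> R) k (l : seq R) x : (k < size l)%N ->
  \sum_(b <- split_leaf k l x) f b =
  \sum_(b <- l) f b - f l`_k + (f (x.1 * l`_k) + f (x.2 * l`_k)).
Proof.
move=> kl; rewrite big_cat/= !big_cons.
have -> : \sum_(b <- l) f b =
    \sum_(b <- take k l) f b + (f l`_k + \sum_(b <- drop k.+1 l) f b).
  by rewrite -{1}(cat_take_drop k l) big_cat/= (drop_nth 0 kl) big_cons.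
by lra.
Qed.

Lemma sum_nth (f : R -> R) (l : seq R) n : size l = n ->
  \sum_(k < n) f l`_k = \sum_(b <- l) f b.
Proof. by move=> <-; rewrite (big_nth 0) big_mkord. Qed.

Lemma le_sum_nth (f : R -> R) k (l : seq R) : (k < size l)%N ->
  (forall x, 0 <= f x) -> f l`_k <= \sum_(b <- l) f b.
Proof.
move=> kl f0; rewrite -(sum_nth f erefl) (bigD1 (Ordinal kl))//= lerDl.
exact: sumr_ge0.
Qed.

End power_sums.

Section mean_power_sums.
Context {d d1 : measure_display} {T : measurableType d} {T1 : measurableType d1}
  {R : realType} (P : probability T R) (P1 : probability T1 R).
Variables (LR : nat -> {RV P >-> (R * R)%type}) (I : nat -> {RV P >-> nat})
  (LR0 : {RV P1 >-> (R * R)%type}).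
Hypothesis SP : splitting_process LR I LR0.
Local Open Scope ereal_scope.
Local Notation leaves_rv := (leaves_rv LR I).

(** This is [S(s) + 1]; absolute values make it meaningful pointwise, while
the vector is non-negative only almost surely. *)
Definition branching (s : R) : \bar R :=
  \int[P1]_v (`|(LR0 v).1| `^ s + `|(LR0 v).2| `^ s)%:E.

Lemma measurable_branching s :
  measurable_fun setT (fun v => `|(LR0 v).1| `^ s + `|(LR0 v).2| `^ s)%R.
Proof.
apply: measurable_funD.
- exact: (measurableT_comp (measurable_abs_powR s) (measurable_fst_RV LR0)).
- exact: (measurableT_comp (measurable_abs_powR s) (measurable_snd_RV LR0)).
Qed.

Lemma branching_ge0 s : 0 <= branching s.
Proof. by apply: integral_ge0 => v _; rewrite lee_fin addr_ge0// powR_ge0. Qed.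

(** Splitting the leaf [b] turns [|b|^s] into [(|L|^s + |R|^s) |b|^s] and
leaves the other terms alone. *)
Lemma expectation_powsum_split s a k (l : seq R) : (k < size l)%N ->
  branching s = a%:E ->
  \int[P1]_v (powsum s (split_leaf k l (LR0 v)))%:E =
  (powsum s l + (a - 1) * `|l`_k| `^ s)%:E.
Proof.
move=> kl sa.
have lk : (0 <= powsum s l - `|l`_k| `^ s)%R.
  by rewrite subr_ge0; apply: (le_sum_nth (f := fun b => `|b| `^ s)%R) => // x;
    exact: powR_ge0.
under eq_integral => v _.
  rewrite /powsum (sum_split_leaf (fun b => `|b| `^ s)%R)// -/(powsum s l).
  rewrite !normrM !powRM// -mulrDl mulrC EFinD EFinM.
  over.
rewrite ge0_integralD//; last first.
  by apply: emeasurable_funM => //; apply/measurable_EFinP; exact: measurable_branching.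
rewrite ge0_integralZl//;
  last by apply/measurable_EFinP; exact: measurable_branching.
rewrite -/(branching s) sa integral_cst//= probability_setT mule1 -EFinM -EFinD.
by congr EFin; ring.
Qed.

(** Averaging the previous identity over the [n] leaves turns the single term
[|b|^s] into [1/n] of the whole power sum. *)
Lemma mean_powsum_step s a n : branching s = a%:E -> (0 < n)%N ->
  \int[P]_w (powsum s (leaves_rv n.+1 w))%:E =
  (1 + (a - 1) / n%:R)%:E * \int[P]_w (powsum s (leaves_rv n w))%:E.
Proof.
move=> sa n0.
have mps : measurable_seqfun (EFin \o powsum s : seq R -> \bar R).
  by apply: measurable_seqfun_comp; [exact: EFin_measurable|exact: measurable_powsum].
rewrite (one_step_sum SP n0 (Phi := EFin \o powsum s))//; last first.
  by move=> l; rewrite lee_fin powsum_ge0.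
rewrite -ge0_integralZl//; last 3 first.
- exact: (measurable_leaves_rv LR I n mps).
- by move=> w _; rewrite lee_fin powsum_ge0.
- have : 0 <= branching s by exact: branching_ge0.
  rewrite sa !lee_fin => a0; rewrite mulrBl addrA mul1r.
  by rewrite addrAC addr_ge0 ?divr_ge0// subr_ge0 invf_le1 ?ler1n ?ltr0n.
apply: eq_integral => w _.
have n0' : (n%:R : R) != 0%R by rewrite pnatr_eq0 -lt0n.
rewrite (eq_bigr (fun k : 'I_n => (n%:R^-1 *
    (powsum s (leaves_rv n w) + (a - 1) * `|(leaves_rv n w)`_k| `^ s))%:E)).
  rewrite sumEFin -big_distrr/= big_split/= -big_distrr/=.
  rewrite (sum_nth (fun b => `|b| `^ s)%R) ?size_leaves//.
  rewrite sumr_const card_ord -EFinM -/(powsum s _); congr EFin.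
  by rewrite -[X in (X + _)%R]mulr_natr; field.
move=> k _; rewrite (expectation_powsum_split _ sa) ?EFinM//.
by rewrite size_leaves.
Qed.

Definition mean_powsum s n : R := fine (\int[P]_w (powsum s (leaves_rv n w))%:E).

Lemma mean_powsum1 s : \int[P]_w (powsum s (leaves_rv 1 w))%:E = 1.
Proof.
under eq_integral do rewrite /leaves_rv leaves1 /powsum big_seq1 normr1 powR1.
by rewrite integral_cst//= mul1e probability_setT.
Qed.

Lemma mean_powsumE s a n : branching s = a%:E -> (0 < n)%N ->
  \int[P]_w (powsum s (leaves_rv n w))%:E = (mean_powsum s n)%:E.
Proof.
move=> sa; elim: n => // n IH _; rewrite /mean_powsum fineK//.
have [->|n0] := posnP n; first by rewrite mean_powsum1.
by rewrite (mean_powsum_step sa n0) IH.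
Qed.

Lemma mean_powsum_ge0 s n : (0 <= mean_powsum s n)%R.
Proof.
apply: fine_ge0; apply: integral_ge0 => w _; rewrite lee_fin; exact: powsum_ge0.
Qed.

Lemma mean_powsumS s a n : branching s = a%:E -> (0 < n)%N ->
  mean_powsum s n.+1 = ((1 + (a - 1) / n%:R) * mean_powsum s n)%R.
Proof.
move=> sa n0; apply: EFin_inj.
by rewrite -(mean_powsumE sa)// (mean_powsum_step sa n0) EFinM -(mean_powsumE sa).
Qed.

Lemma mean_powsum_const s n : branching s = 1 -> (0 < n)%N ->
  mean_powsum s n = 1%R.
Proof.
move=> s1; elim: n => // n IH _; have [->|n0] := posnP n.
  by rewrite /mean_powsum mean_powsum1.
by rewrite (mean_powsumS s1 n0) IH// subrr mul0r addr0 mulr1.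
Qed.

End mean_power_sums.

(** * Bernoulli inequalities and decay of the mean power sums *)

Section bernoulli.
Context {R : realType}.
Implicit Types (p t x y z : R).

Let expR_bernoulli p y : 1 <= p -> 1 + p * (expR y - 1) <= expR (p * y) ?= iff
  ((p == 1) || (y == 0)).
Proof.
move=> p1.
have E : expR (p * y) = expR y * expR ((p - 1) * y).
  by rewrite -expRD; congr expR; ring.
have [->|p1'] := eqVneq p 1.
  by rewrite !mul1r addrC subrK; apply/leif_refl.
have [->|y0] := eqVneq y 0.
  by rewrite mulr0 !expR0 subrr mulr0 addr0; apply/leif_refl; rewrite orbT.
have {}p1 : 1 < p by rewrite lt_neqAle eq_sym p1'.
suff H : 1 + p * (expR y - 1) < expR (p * y).
  by split; [exact: ltW|rewrite lt_eqF].
rewrite E.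
have A : 1 + (p - 1) * y < expR ((p - 1) * y).
  by apply: expR_gt1Dx; rewrite mulf_neq0// subr_eq0.
have B : 1 - y < expR (- y) by apply: expR_gt1Dx; rewrite oppr_eq0.
have e0 : 0 < expR y := expR_gt0 y.
have C : expR y * (1 - y) < 1.
  by rewrite -ltr_pdivlMl// mulr1 -expRN.
have D : expR y * (1 + (p - 1) * y) < expR y * expR ((p - 1) * y).
  by rewrite ltr_pM2l.
apply: lt_trans D; nra.
Qed.

Lemma bernoulli_powR p z : 1 <= p -> 0 <= z -> 1 + p * (z - 1) <= z `^ p.
Proof.
move=> p1; rewrite le_eqVlt => /predU1P[<-|z0].
  by rewrite powR0 ?gt_eqF//; lra.
have [+ _] := expR_bernoulli (ln z) p1.
by rewrite lnK// /powR gt_eqF.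
Qed.

(** The equality case of Bernoulli, that is, strict convexity of the power
function. *)
Lemma bernoulli_powR_eq p z : 1 < p -> 0 <= z -> z `^ p = 1 + p * (z - 1) ->
  z = 1.
Proof.
move=> p1; rewrite le_eqVlt => /predU1P[<-|z0].
  by rewrite powR0 ?gt_eqF//; lra.
have [_ +] := expR_bernoulli (ln z) (ltW p1).
rewrite lnK// /powR (gt_eqF z0) => + E; rewrite E eqxx (gt_eqF p1)/= => /esym/eqP.
by move=> l0; rewrite -[z]lnK// l0 expR0.
Qed.

Lemma bernoulli_powR_concave t x : 0 <= t <= 1 -> 0 <= x <= 1 ->
  (1 - x) `^ t <= 1 - t * x.
Proof.
move=> /andP[]; rewrite le_eqVlt => /predU1P[<- _ _|t0 t1 /andP[x0 x1]].
  by rewrite powRr0 mul0r subr0.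
have := @bernoulli_powR t^-1 ((1 - x) `^ t) _ (powR_ge0 _ _).
rewrite -powRrM mulfV ?gt_eqF// powRr1 ?subr_ge0// => /(_ _)/wrap[].
  by rewrite invf_ge1.
set z := _ `^ _ => H.
have : t * (1 + t^-1 * (z - 1)) <= t * (1 - x) by rewrite ler_pM2l.
by rewrite mulrDr mulrA mulfV ?gt_eqF//; lra.
Qed.

End bernoulli.

Section decay.
Context {R : realType} (u : nat -> R) (c : R).
Hypothesis c01 : 0 < c <= 1.
Hypothesis u1 : u 1%N = 1.
Hypothesis uS : forall n, (0 < n)%N -> u n.+1 = (1 - c / n%:R) * u n.

Let cn n : (0 < n)%N -> 0 <= c / n%:R <= 1.
Proof.
move=> n0; have /andP[c0 c1] := c01.
rewrite divr_ge0 ?(ltW c0)//= ler_pdivrMr ?ltr0n// mul1r.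
by rewrite (le_trans c1)// ler1n.
Qed.

Lemma decay_ge0 n : (0 < n)%N -> 0 <= u n.
Proof.
elim: n => // n IH _; have [->|n0] := posnP n; first by rewrite u1.
by rewrite uS// mulr_ge0 ?IH// subr_ge0; have /andP[] := cn n0.
Qed.

Lemma decay_nonincreasing n : (0 < n)%N -> u n.+1 <= u n.
Proof.
move=> n0; rewrite uS// ler_piMl ?decay_ge0//.
by rewrite gerBl; have /andP[] := cn n0.
Qed.

(** Concavity of the power function makes the terms [u_n^t / n] telescope,
hence summable. *)
Lemma decay_telescope t n : 0 <= t <= 1 -> (0 < n)%N ->
  t * c / n%:R * u n `^ t <= u n `^ t - u n.+1 `^ t.
Proof.
move=> t01 n0; have cn1 := cn n0.
rewrite uS// powRM ?decay_ge0//; last by rewrite subr_ge0; have /andP[] := cn1.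
have H := bernoulli_powR_concave t01 cn1.
have := powR_ge0 (u n) t.
set a := u n `^ t => a0; set b := (1 - _) `^ _ in H *.
have : b * a <= (1 - t * (c / n%:R)) * a by rewrite ler_wpM2r.
by rewrite -!mulrA; lra.
Qed.

(** A monotone limit [l > 0] is impossible: each decrement [u_n - u_(n+1) = c
u_n / n] is at least [c l / n], and the harmonic series diverges. *)
Lemma cvg_decay : u n @[n --> \oo] --> 0.
Proof.
have /andP[c0 c1] := c01.
pose v n := u n.+1.
have v0 n : 0 <= v n by exact: decay_ge0.
have nv : {homo v : n m / (n <= m)%N >-> m <= n}.
  by apply/nonincreasing_seqP => n; exact: decay_nonincreasing.
have lv : has_lbound (range v) by exists 0 => _ [n _ <-].
have cv := nonincreasing_cvgn nv lv.
rewrite -cvg_shiftS.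
suff l0 : inf (range v) = 0 by rewrite l0 in cv.
apply/eqP; rewrite eq_le lb_le_inf ?andbT; last 2 first.
- by exists (v 0%N), 0%N.
- by move=> _ [n _ <-].
rewrite leNgt; apply/negP => l0.
apply: (@dvg_harmonic R); apply: nondecreasing_is_cvgn.
  by apply/nondecreasing_series => n _ _; rewrite harmonic_ge0.
exists (c * inf (range v))^-1 => _ [n _ <-].
rewrite -[leRHS]mul1r ler_pdivlMr ?mulr_gt0//.
have : series harmonic n * (c * inf (range v)) <= 1 - v n.
  elim: n => [|n IH]; first by rewrite /series/= big_geq// mul0r /v u1 subrr.
  rewrite /series/= big_nat_recr//= mulrDl.
  have H : c / n.+1%:R * v n <= v n - v n.+1.
    have := decay_telescope (t := 1) (n := n.+1).
    by rewrite !powRr1 ?decay_ge0// mul1r; apply; rewrite ?ler01 ?lexx.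
  have ivn : inf (range v) <= v n by apply: ge_inf => //; exists n.
  have : n.+1%:R^-1 * (c * inf (range v)) <= c / n.+1%:R * v n.
    by rewrite mulrA [_ * c]mulrC ler_wpM2l// divr_ge0// ltW.
  move=> K; apply: le_trans (lerD IH (le_trans K H)) _.
  by rewrite addrA subrK.
by have := v0 n; lra.
Qed.

End decay.

(** * Moments of the mass above order one *)

Section second_order_bound.
Context {R : realType}.
Implicit Types (q r t u z A : R).

Lemma bernoulli_powR_le t z : 0 <= t <= 1 -> 0 <= z -> z `^ t <= 1 + t * (z - 1).
Proof.
move=> /andP[]; rewrite le_eqVlt => /predU1P[<- _ _|t0 t1 z0].
  by rewrite powRr0 mul0r addr0.
have := @bernoulli_powR R t^-1 (z `^ t) _ (powR_ge0 _ _).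
rewrite -powRrM mulfV ?gt_eqF// powRr1// => /(_ _)/wrap[].
  by rewrite invf_ge1.
set y := _ `^ _ => H.
have : t * (1 + t^-1 * (y - 1)) <= t * z by rewrite ler_pM2l.
by rewrite mulrDr mulrA mulfV ?gt_eqF//; lra.
Qed.

Let powR_ge1 z t : 1 <= z -> 0 <= t -> 1 <= z `^ t.
Proof. by move=> z1 t0; rewrite -{1}(powRr0 z) ler_powR. Qed.

Let tangent q u : 1 <= q -> -1 < u -> (1 + u) `^ q <= 1 + q * u * (1 + u) `^ (q - 1).
Proof.
move=> q1 u1; have z0 : 0 < 1 + u by lra.
have := bernoulli_powR q1 (ltW (_ : 0 < (1 + u)^-1)); rewrite invr_gt0 => /(_ z0).
rewrite -(ler_pM2r (powR_gt0 q z0)) -[leRHS]powRM ?invr_ge0 ?(ltW z0)//.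
rewrite mulVf ?(gt_eqF z0)// powR1.
have -> : (1 + u) `^ q = (1 + u) * (1 + u) `^ (q - 1).
  by rewrite mulr_powRB1// ?ltW//; lra.
set e := _ `^ (q - 1); set z := 1 + u in z0 *.
have zV : z^-1 * z = 1 by rewrite mulVf// gt_eqF.
have -> : (1 + q * (z^-1 - 1)) * (z * e) = z * e + q * (z^-1 * z) * e - q * z * e.
  by ring.
by rewrite zV /z; nra.
Qed.

Let remainder q u : 1 < q -> -1 <= u -> (1 + u) `^ q <=
  1 + q * u + q * (q + 1) * u ^+ 2 * (1 + `|u|) `^ (Num.max q 2 - 2).
Proof.
move=> q1; rewrite le_eqVlt => /predU1P[<-|u1].
  rewrite subrr powR0 ?gt_eqF//; last by lra.
  have := powR_ge1 (_ : 1 <= 1 + `|-1 : R|) (_ : 0 <= Num.max q 2 - 2).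
  rewrite lerDl normr_ge0 subr_ge0 le_max lexx orbT => /(_ isT isT).
  by set e := _ `^ _ => e1; rewrite sqrrN expr1n; nra.
have [qe ue] : q - 1 >= 0 /\ 0 < 1 + u by split; lra.
apply: le_trans (tangent (ltW q1) u1) _.
suff : u * ((1 + u) `^ (q - 1) - 1) <=
    (q + 1) * u ^+ 2 * (1 + `|u|) `^ (Num.max q 2 - 2).
  set x := _ `^ (q - 1); set y := _ `^ (_ - 2) => H.
  have : q * (u * (x - 1)) <= q * ((q + 1) * u ^+ 2 * y) by rewrite ler_pM2l//; lra.
  by rewrite !mulrA; lra.
have [q2|q2] := leP q 2.
  rewrite subrr powRr0 mulr1.
  have [u0|u0] := leP 0 u.
    have : (1 + u) `^ (q - 1) <= 1 + (q - 1) * (1 + u - 1).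
      by apply: bernoulli_powR_le; lra.
    by nra.
  have : (1 + u) `^ 1 <= (1 + u) `^ (q - 1) by apply: ger_powR; lra.
  rewrite powRr1 ?(ltW ue)//; set x := _ `^ _ => H.
  have : u * (x - 1) <= u * u by rewrite ler_wnM2l//; lra.
  have : 0 <= q * u ^+ 2 by rewrite mulr_ge0 ?sqr_ge0//; lra.
  rewrite expr2; lra.
have [u0|u0] := leP 0 u.
  have : (1 + u) `^ (q - 1) <= 1 + (q - 1) * u * (1 + u) `^ (q - 1 - 1).
    by apply: tangent => //; lra.
  rewrite (_ : q - 1 - 1 = q - 2) ?(ger0_norm u0); last by ring.
  set x := _ `^ (q - 1); set y := _ `^ (q - 2) => H.
  have y0 : 0 <= y by exact: powR_ge0.
  have : u * (x - 1) <= u * ((q - 1) * u * y) by rewrite ler_wpM2l//; lra.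
  have : (q - 1) * (u ^+ 2 * y) <= (q + 1) * (u ^+ 2 * y).
    by rewrite ler_wpM2r ?mulr_ge0 ?sqr_ge0//; lra.
  rewrite expr2; lra.
have : 1 + (q - 1) * (1 + u - 1) <= (1 + u) `^ (q - 1).
  by apply: bernoulli_powR; lra.
have E1 : 1 <= (1 + `|u|) `^ (q - 2).
  by apply: powR_ge1; [rewrite lerDl|lra].
set x := _ `^ (q - 1); move: E1; set y := _ `^ (q - 2) => y1 H.
have : (q + 1) * u ^+ 2 * 1 <= (q + 1) * u ^+ 2 * y.
  by rewrite ler_wpM2l// mulr_ge0 ?sqr_ge0//; lra.
have : - u * (1 - x) <= - u * ((q + 1) * - u) by rewrite ler_wpM2l//; nra.
by rewrite mulr1 expr2; lra.
Qed.

(** A Taylor bound that is uniform in [t]. When [1 < q < 2] the second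
derivative is unbounded at [0], so the remainder is only of order [t^q]; this
explains the exponent [min(q, 2)]. *)
Lemma powR_second_order q : 1 < q -> exists2 C : R, 0 <= C &
  forall t A, 0 <= t <= 1 -> 0 <= A -> (1 + t * (A - 1)) `^ q <=
    1 + q * (t * (A - 1)) + C * (t `^ Num.min q 2 * (1 + A) `^ q).
Proof.
move=> q1; have C0 : 0 <= q * (q + 1) * 2 `^ q + 2 `^ q.
  by rewrite addr_ge0 ?powR_ge0// !mulr_ge0 ?powR_ge0//; lra.
exists (q * (q + 1) * 2 `^ q + 2 `^ q) => // t A /andP[t0 t1] A0.
set u := t * (A - 1).
have u1 : -1 <= u by rewrite /u; nra.
have uA : `|u| <= t * (1 + A).
  by rewrite normrM (ger0_norm t0) ler_wpM2l// ler_norml; lra.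
clearbody u; have A1 : 1 <= 1 + A by rewrite lerDl.
have tA0 : 0 <= t * (1 + A) by rewrite mulr_ge0//; lra.
have pA r : 0 <= r -> `|u| `^ r <= t `^ r * (1 + A) `^ r.
  move=> r0; rewrite -powRM//; last by lra.
  by apply: ge0_ler_powR => //; rewrite ?nnegrE.
have [q2|q2] := leP q 2.
  have [ule|ugt] := leP `|u| 1.
    have := remainder q1 u1; rewrite (max_idPr q2) subrr powRr0 mulr1.
    move=> H; apply: (le_trans H); rewrite lerD2l.
    have E : u ^+ 2 <= `|u| `^ q.
      rewrite -real_normK ?num_real// -powR_mulrn//.
      have [->|un0] := eqVneq `|u| 0; first by rewrite !powR0//; lra.
      by apply: ger_powR => //; rewrite lt0r un0 normr_ge0.
    apply: (@le_trans _ _ (q * (q + 1) * (t `^ q * (1 + A) `^ q))).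
      apply: ler_wpM2l; first by rewrite mulr_ge0//; lra.
      by apply: le_trans E (pA _ _); lra.
    apply: ler_wpM2r; first by rewrite mulr_ge0 ?powR_ge0.
    rewrite ler_wpDr ?powR_ge0// ler_peMr//; first by rewrite mulr_ge0//; lra.
    by apply: powR_ge1; [rewrite ler1n|lra].
  have up : 1 < u.
    by move: ugt; rewrite ltr_normr => /orP[//|]; lra.
  apply: (@le_trans _ _ (2 `^ q * `|u| `^ q)).
    rewrite -powRM// (ger0_norm (ltW _)); last by lra.
    by apply: ge0_ler_powR; rewrite ?nnegrE; lra.
  rewrite -[leLHS]add0r; apply: lerD.
    by rewrite addr_ge0// mulr_ge0//; lra.
  have B : 2 `^ q * `|u| `^ q <= 2 `^ q * (t `^ q * (1 + A) `^ q).
    by rewrite ler_wpM2l ?powR_ge0// pA//; lra.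
  apply: (le_trans B); apply: ler_wpM2r; first by rewrite mulr_ge0 ?powR_ge0.
  by rewrite lerDr !mulr_ge0 ?powR_ge0//; lra.
have := remainder q1 u1; rewrite (max_idPl (ltW q2)).
move=> H; apply: (le_trans H); rewrite lerD2l.
have E2 : u ^+ 2 <= t `^ 2 * (1 + A) `^ 2.
  by rewrite -real_normK ?num_real// -powR_mulrn// pA.
have E3 : (1 + `|u|) `^ (q - 2) <= 2 `^ q * (1 + A) `^ (q - 2).
  apply: (@le_trans _ _ (2 `^ (q - 2) * (1 + A) `^ (q - 2))).
    rewrite -powRM//; last by lra.
    have : t * (1 + A) <= 1 * (1 + A) by rewrite ler_wpM2r//; lra.
    by move: (normr_ge0 u) => un0 tA; apply: ge0_ler_powR; rewrite ?nnegrE; lra.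
  by rewrite ler_wpM2r ?powR_ge0// ler_powR ?ler1n//; lra.
have E4 : (1 + A) `^ 2 * (1 + A) `^ (q - 2) = (1 + A) `^ q.
  rewrite -powRD; first by congr powR; rewrite addrC subrK.
  by rewrite gt_eqF ?implybT//; lra.
have E5 : u ^+ 2 * (1 + `|u|) `^ (q - 2) <= 2 `^ q * (t `^ 2 * (1 + A) `^ q).
  apply: le_trans (ler_pM _ _ E2 E3) _; rewrite ?sqr_ge0 ?powR_ge0// -E4.
  move: (t `^ 2) ((1 + A) `^ 2) (2 `^ q) (_ `^ (q - 2)) => a b c e.
  by rewrite (_ : a * b * (c * e) = c * (a * (b * e))) //; ring.
apply: (@le_trans _ _ (q * (q + 1) * (2 `^ q * (t `^ 2 * (1 + A) `^ q)))).
  by rewrite -mulrA ler_wpM2l// mulr_ge0//; lra.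
by rewrite mulrA ler_wpM2r ?mulr_ge0 ?powR_ge0// lerDl powR_ge0.
Qed.

End second_order_bound.

Lemma ge0_integral_lincomb {d : measure_display} {T : measurableType d}
    {R : realType} (mu : {measure set T -> \bar R}) (c1 c2 : R)
    (f1 f2 : T -> \bar R) : (0 <= c1)%R -> (0 <= c2)%R ->
  measurable_fun setT f1 -> measurable_fun setT f2 ->
  (forall w, 0 <= f1 w)%E -> (forall w, 0 <= f2 w)%E ->
  (\int[mu]_w (c1%:E * f1 w + c2%:E * f2 w) =
   c1%:E * \int[mu]_w f1 w + c2%:E * \int[mu]_w f2 w)%E.
Proof.
move=> c10 c20 mf1 mf2 f10 f20; rewrite ge0_integralD//; last 4 first.
- by move=> w _; rewrite mule_ge0.
- exact: emeasurable_funM.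
- by move=> w _; rewrite mule_ge0.
- exact: emeasurable_funM.
by rewrite !ge0_integralZl.
Qed.

Section interpolation.
Context {R : realType}.
Implicit Types (p q r t x y z : R).

(** A power of order between [1] and [q] is split at a threshold that depends
on [dl]: the coefficient of the first-order term may be made as small as
wanted. *)
Lemma powR_interpolate dl r q t : 0 < dl -> 1 < r <= q -> 0 <= t ->
  t `^ r <= dl * t + dl `^ (- ((q - r) / (r - 1))) * t `^ q.
Proof.
move=> d0 /andP[r1 rq]; set N := (q - r) / (r - 1).
have N0 : 0 <= N by rewrite divr_ge0//; lra.
rewrite le_eqVlt => /predU1P[<-|t0].
  by rewrite !powR0 ?mulr0 ?addr0//; apply/eqP; lra.
have [trd|dtr] := leP (t `^ (r - 1)) dl.
  rewrite ler_wpDr ?mulr_ge0 ?powR_ge0//.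
  rewrite -(mulr_powRB1 (ltW t0) (p := r)); last by lra.
  by rewrite mulrC ler_wpM2r// ltW.
rewrite ler_wpDl ?mulr_ge0 ?(ltW d0) ?(ltW t0)//.
rewrite powRN mulrC ler_pdivlMr ?powR_gt0//.
have -> : t `^ q = t `^ r * t `^ (q - r).
  by rewrite -powRD ?(gt_eqF t0) ?implybT//; congr powR; ring.
rewrite ler_wpM2l ?powR_ge0//.
have -> : t `^ (q - r) = (t `^ (r - 1)) `^ N.
  by rewrite -powRrM /N; congr powR; rewrite mulrC divfK//; lra.
by apply: ge0_ler_powR; rewrite ?nnegrE ?powR_ge0// ltW.
Qed.

Lemma powR_half_le p x y : 0 <= p -> 0 <= x -> 0 <= y ->
  (1 + (x `^ 2 + y `^ 2)) `^ (p / 2) <= 3 `^ (p / 2) * (1 + (x `^ p + y `^ p)).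
Proof.
move=> p0 x0 y0; have q0 : 0 <= p / 2 by lra.
have pE z : z `^ p = (z `^ 2) `^ (p / 2) by rewrite -powRrM mulrC divfK.
rewrite (pE x) (pE y); move: (powR_ge0 x 2) (powR_ge0 y 2).
move: (x `^ 2) (y `^ 2) => X Y X0 Y0.
have [z [z0 Hz zq]] : exists z, [/\ 0 <= z, 1 + (X + Y) <= 3 * z &
    z `^ (p / 2) <= 1 + (X `^ (p / 2) + Y `^ (p / 2))].
  have Xq := powR_ge0 X (p / 2); have Yq := powR_ge0 Y (p / 2).
  have [X1|X1] := leP X 1; first have [Y1|Y1] := leP Y 1.
  - by exists 1; rewrite powR1; split; lra.
  - by exists Y; split; lra.
  - by have [XY|XY] := leP X Y; [exists Y|exists X]; split; lra.
apply: (@le_trans _ _ (3 `^ (p / 2) * z `^ (p / 2))); last first.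
  by rewrite ler_wpM2l ?powR_ge0.
by rewrite -powRM//; apply: ge0_ler_powR; rewrite ?nnegrE//; lra.
Qed.

End interpolation.

Section moments.
Context {d d1 : measure_display} {T : measurableType d} {T1 : measurableType d1}
  {R : realType} (P : probability T R) (P1 : probability T1 R).
Variables (LR : nat -> {RV P >-> (R * R)%type}) (I : nat -> {RV P >-> nat})
  (LR0 : {RV P1 >-> (R * R)%type}).
Hypothesis SP : splitting_process LR I LR0.
Variables (p a : R).
Hypothesis p2 : 2 < p.
Hypothesis branching2 : branching LR0 2 = 1%E.
Hypothesis branchingp : branching LR0 p = a%:E.
Hypothesis a1 : a < 1.
Local Open Scope ereal_scope.
Local Notation leaves_rv := (leaves_rv LR I).
Local Notation q := (p / 2)%R.

Let p0 : (0 <= p)%R. Proof. by move: p2 => ?; lra. Qed.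

Let q0 : (0 < q)%R. Proof. by move: p2 => ?; lra. Qed.

Let q1 : (1 < q)%R. Proof. by move: p2 => ?; lra. Qed.

Let A (v : T1) : R := (`|(LR0 v).1| `^ 2 + `|(LR0 v).2| `^ 2)%R.

Let A0 v : (0 <= A v)%R. Proof. by rewrite addr_ge0// powR_ge0. Qed.

Let mA : measurable_fun setT A. Proof. exact: measurable_branching. Qed.

Let mAq : measurable_fun setT (fun v => ((1 + A v) `^ q)%R).
Proof.
by apply: (measurableT_comp (measurable_powR q)); exact: measurable_funD.
Qed.

Let intAq : exists kappa : R, \int[P1]_v ((1 + A v) `^ q)%:E = kappa%:E.
Proof.
exists (fine (\int[P1]_v ((1 + A v) `^ q)%:E)); rewrite fineK//.
rewrite ge0_fin_numE; last first.
  by apply: integral_ge0 => v _; rewrite lee_fin powR_ge0.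
pose g v := ((3 `^ q)%:E * (1 + (`|(LR0 v).1| `^ p + `|(LR0 v).2| `^ p)%:E)).
have mg : measurable_fun setT (fun v => (`|(LR0 v).1| `^ p + `|(LR0 v).2| `^ p)%:E).
  by apply/measurable_EFinP; exact: measurable_branching.
apply: (@le_lt_trans _ _ (\int[P1]_v g v)).
  apply: ge0_le_integral => //.
  - by move=> v _; rewrite lee_fin powR_ge0.
  - by apply/measurable_EFinP.
  - by apply: emeasurable_funM => //; exact: emeasurable_funD.
  move=> v _; rewrite /g -EFinD -EFinM lee_fin /A.
  exact: powR_half_le.
rewrite /g ge0_integralZl//; last 2 first.
- exact: emeasurable_funD.
- by move=> v _; rewrite -EFinD lee_fin !addr_ge0 ?powR_ge0.
rewrite ge0_integralD//.
rewrite -/(branching LR0 p) branchingp integral_cst//= probability_setT mule1.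
by rewrite -EFinD -EFinM ltry.
Qed.

(** The first-order term of the expansion of the mass after a split has mean
zero, because [E[L^2 + R^2] = 1]; only the remainder survives. Here [t] is the
share of the mass carried by the split leaf. *)
Lemma split_moment_bound : exists2 K : R, (0 <= K)%R &
  forall (l : seq R) k, (k < size l)%N ->
    \int[P1]_v (powsum 2 (split_leaf k l (LR0 v)) `^ q)%:E <=
    (powsum 2 l `^ q +
      K * (powsum 2 l `^ q * (`|l`_k| `^ 2 / powsum 2 l) `^ Num.min q 2))%:E.
Proof.
have [kappa kE] := intAq.
have k0 : (0 <= kappa)%R.
  by rewrite -lee_fin -kE; apply: integral_ge0 => v _; rewrite lee_fin powR_ge0.
have [C C0 HC] := powR_second_order q1.
exists (C * kappa)%R; first exact: mulr_ge0.
move=> l k kl; set m := powsum 2 l; set b := (`|l`_k| `^ 2)%R.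
have bm : (b <= m)%R.
  by apply: (le_sum_nth (f := fun b => `|b| `^ 2)%R) => // x; exact: powR_ge0.
have b0 : (0 <= b)%R by exact: powR_ge0.
have splitE v : powsum 2 (split_leaf k l (LR0 v)) = (m + b * (A v - 1))%R.
  rewrite /powsum (sum_split_leaf (fun b => `|b| `^ 2)%R)// -/m -/(powsum 2 l).
  by rewrite !normrM !powRM// -/b -mulrDl -/(A v); rewrite -/m; move: (A v) => z; ring.
under eq_integral do rewrite splitE.
have [m0|m0] := leP m 0%R.
  have {}m0 : m = 0%R by apply/eqP; rewrite eq_le m0 (le_trans b0).
  have {}b0 : b = 0%R by apply/eqP; rewrite eq_le b0 -{1}m0 bm.
  under eq_integral do rewrite b0 m0 mul0r addr0 powR0 ?(gt_eqF q0)//.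
  by rewrite integral0 m0 powR0 ?(gt_eqF q0)// mul0r mulr0 addr0.
set t := (b / m)%R.
have t01 : (0 <= t <= 1)%R by rewrite divr_ge0 ?(ltW m0)//= ler_pdivrMr// mul1r.
have [t0 t1] := andP t01.
have tA v : (0 <= 1 + t * (A v - 1))%R.
  by rewrite mulrBr mulr1 addrCA; rewrite addr_ge0 ?subr_ge0// mulr_ge0 ?A0.
have mE v : ((m + b * (A v - 1)) `^ q = m `^ q * (1 + t * (A v - 1)) `^ q)%R.
  rewrite -powRM ?(ltW m0)//; congr (_ `^ _)%R.
  by rewrite /t; field; rewrite gt_eqF.
under eq_integral do rewrite mE EFinM.
have mpow : measurable_fun setT (fun v => (1 + t * (A v - 1)) `^ q)%R.
  apply: (measurableT_comp (measurable_powR q)).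
  by apply: measurable_funD => //; apply: measurable_funM => //; exact: measurable_funB.
rewrite ge0_integralZl//; last 3 first.
- by apply/measurable_EFinP.
- by move=> v _; rewrite lee_fin powR_ge0.
- by rewrite lee_fin powR_ge0.
rewrite mulrCA -[X in (X + _)%R]mulr1 -mulrDr EFinM lee_wpmul2l//.
  by rewrite lee_fin powR_ge0.
set Y := \int[P1]_v _.
suff : Y + (q * t)%:E <=
    (1 + C * t `^ Num.min q 2 * kappa)%:E + (q * t)%:E.
  rewrite leeD2rE// => /le_trans; apply; rewrite lee_fin lerD2l.
  by rewrite mulrAC.
have -> : Y + (q * t)%:E = \int[P1]_v (((1 + t * (A v - 1)) `^ q)%:E + (q * t)%:E).
  rewrite ge0_integralD//; last 3 first.
  - by move=> v _; rewrite lee_fin powR_ge0.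
  - by apply/measurable_EFinP.
  - by move=> v _; rewrite lee_fin mulr_ge0// ltW.
  by rewrite integral_cst//= probability_setT mule1.
have -> : (1 + C * t `^ Num.min q 2 * kappa)%:E + (q * t)%:E =
   \int[P1]_v (1 + ((q * t)%:E * (A v)%:E +
      (C * t `^ Num.min q 2)%:E * ((1 + A v) `^ q)%:E)).
  have n1 : (0 <= q * t)%R by rewrite mulr_ge0// ltW.
  have n2 : (0 <= C * t `^ Num.min q 2)%R by rewrite mulr_ge0// powR_ge0.
  have mA' : measurable_fun setT (EFin \o A) by exact/measurable_EFinP.
  have mAq' : measurable_fun setT (EFin \o (fun v => ((1 + A v) `^ q)%R)).
    exact/measurable_EFinP.
  rewrite ge0_integralD//; last 2 first.
  - by move=> v _; rewrite adde_ge0// -EFinM lee_fin mulr_ge0// powR_ge0.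
  - by apply: emeasurable_funD; apply: emeasurable_funM.
  rewrite ge0_integralD//; last 4 first.
  - by move=> v _; rewrite -EFinM lee_fin mulr_ge0.
  - by apply: emeasurable_funM.
  - by move=> v _; rewrite -EFinM lee_fin mulr_ge0// powR_ge0.
  - by apply: emeasurable_funM.
  rewrite !ge0_integralZl//; last 2 first.
  - by move=> v _; rewrite lee_fin powR_ge0.
  - by move=> v _; rewrite lee_fin A0.
  rewrite -/(branching LR0 2) branching2 kE integral_cst//= probability_setT.
  by rewrite !mule1 -!EFinM -!EFinD; congr EFin; ring.
apply: ge0_le_integral => //.
- by move=> v _; rewrite -EFinD lee_fin addr_ge0 ?powR_ge0// mulr_ge0// ltW.
- by apply: emeasurable_funD => //; apply/measurable_EFinP.
- apply: emeasurable_funD => //; apply: emeasurable_funD; apply: emeasurable_funM => //;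
    exact/measurable_EFinP.
move=> v _; rewrite -!EFinM -!EFinD lee_fin.
by have := HC t (A v) t01 (A0 v); rewrite mulrA; lra.
Qed.

Local Notation r := (Num.min q 2)%R.

Let r1q : (1 < r <= q)%R.
Proof. by rewrite lt_min q1 ltr1n/= ge_min lexx. Qed.

(** Averaging over the leaf, the remainder becomes the sum of the powers of
order [min(q, 2)] of the shares; by interpolation this is a small multiple of
the total share, which is one, plus the power sum of order [p] relative to the
[q]-th power of the mass. *)
Lemma average_moment_bound : exists2 K : R, (0 <= K)%R &
  forall (l : seq R) (dl : R), (0 < size l)%N -> (0 < dl)%R ->
    \sum_(k < size l) ((size l)%:R^-1)%:E *
      \int[P1]_v (powsum 2 (split_leaf k l (LR0 v)) `^ q)%:E <=
    (powsum 2 l `^ q + K / (size l)%:R *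
      (dl * powsum 2 l `^ q + dl `^ (- ((q - r) / (r - 1))) * powsum p l))%:E.
Proof.
have [K K0 HK] := split_moment_bound; exists K => // l dl l0 dl0.
set n := size l; set m := powsum 2 l; set D := (dl `^ _)%R.
have n0 : (n%:R : R) != 0%R by rewrite pnatr_eq0 -lt0n.
have m0 : (0 <= m)%R by exact: powsum_ge0.
have D0 : (0 <= D)%R by exact: powR_ge0.
pose b k : R := (`|l`_k| `^ 2)%R.
have term (k : 'I_n) : (m `^ q * (b k / m) `^ r <=
    dl * (m `^ q * (b k / m)) + D * `|l`_k| `^ p)%R.
  have bm : (b k <= m)%R.
    apply: (le_sum_nth (f := fun b => `|b| `^ 2)%R) => // x; exact: powR_ge0.
  have [->|mn0] := eqVneq m 0%R.
    rewrite powR0 ?(gt_eqF q0)// !mul0r mulr0 add0r.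
    by rewrite mulr_ge0// powR_ge0.
  have t0 : (0 <= b k / m)%R by rewrite divr_ge0 ?powR_ge0.
  have := powR_interpolate dl0 r1q t0; rewrite -/D => H.
  have : (m `^ q * (b k / m) `^ r <=
      m `^ q * (dl * (b k / m) + D * (b k / m) `^ q))%R.
    by rewrite ler_wpM2l ?powR_ge0.
  move/le_trans; apply; rewrite mulrDr mulrCA lerD2l mulrCA -powRM//.
  have -> : (m * (b k / m) = b k)%R by rewrite mulrC divfK.
  by rewrite /b -powRrM [(2 * _)%R]mulrC divfK.
have sum_b : (\sum_(k < n) m `^ q * (b k / m) = m `^ q)%R.
  rewrite -big_distrr/= -big_distrl/= (sum_nth (fun b => `|b| `^ 2)%R erefl).
  rewrite -/(powsum 2 l) -/m; have [->|mn0] := eqVneq m 0%R.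
    by rewrite powR0 ?(gt_eqF q0)// mul0r.
  by rewrite mulfV// mulr1.
apply: (@le_trans _ _ (\sum_(k < n) (n%:R^-1 * (m `^ q +
    K * (dl * (m `^ q * (b k / m)) + D * `|l`_k| `^ p)))%:E)).
  apply: lee_sum => k _; rewrite EFinM lee_wpmul2l ?lee_fin ?invr_ge0//.
  apply: le_trans (HK l k (ltn_ord k)) _.
  by rewrite lee_fin lerD2l; apply: ler_wpM2l => //; exact: term.
rewrite sumEFin lee_fin -big_distrr/= big_split/= -big_distrr/= big_split/=.
have -> : (\sum_(k < n) dl * (m `^ q * (b k / m)) = dl * m `^ q)%R.
  by rewrite -big_distrr/= sum_b.
have -> : (\sum_(k < n) D * `|l`_k| `^ p = D * powsum p l)%R.
  by rewrite -big_distrr/= (sum_nth (fun b => `|b| `^ p)%R erefl).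
rewrite sumr_const card_ord -[X in (X + _)%R]mulr_natr.
by rewrite le_eqVlt; apply/orP; left; apply/eqP; field.
Qed.

(** The power sum of order [p] has a mean dominated by the product [v n] of
the factors [1 - c / k]. With [dl] a suitable power of [v n], both error terms
become [v n ^ s / n], and these are summable since [v n ^ s] telescopes. The
induction therefore carries the bound [2 exp (K (1 - v n ^ s)) - 1]. *)
Lemma moment_bounded : exists B : R, forall n, (0 < n)%N ->
  \int[P]_w (powsum 2 (leaves_rv n w) `^ q)%:E <= B%:E.
Proof.
have [K K0 HK] := average_moment_bound.
set N := ((q - r) / (r - 1))%R in HK.
have N0 : (0 <= N)%R.
  by have /andP[r1 rq] := r1q; rewrite /N divr_ge0// subr_ge0// ltW.
(* s balances the two errors: with dl = v n ^ s one has
   dl ^ (- N) * v n = v n ^ (1 - N s) = v n ^ s *)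
pose s := ((1 + N)^-1)%R.
have s0 : (0 < s)%R by rewrite invr_gt0 ltr_wpDr.
have s1 : (s <= 1)%R by rewrite invf_le1 ?lerDl// ltr_wpDr.
(* the maximum with 1/2 keeps every factor 1 - c / k positive *)
pose c := (1 - Num.max a 2^-1)%R.
have c0 : (0 < c)%R by rewrite subr_gt0 gt_max a1/= invf_lt1// ltr1n.
have c1 : (c < 1)%R by rewrite gtrBl lt_max invr_gt0 ltr0n orbT.
have c01 : (0 < c <= 1)%R by rewrite c0 ltW.
pose v n : R := (\prod_(1 <= k < n) (1 - c / k%:R))%R.
have v1 : v 1%N = 1%R by rewrite /v big_geq.
have vS n : (0 < n)%N -> v n.+1 = ((1 - c / n%:R) * v n)%R.
  by move=> n0; rewrite /v big_nat_recr//= mulrC.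
have v0 n : (0 < n)%N -> (0 < v n)%R.
  elim: n => // n IH _; have [->|n0] := posnP n; first by rewrite v1.
  rewrite vS// mulr_gt0 ?IH// subr_gt0 ltr_pdivrMr ?ltr0n// mul1r.
  by rewrite (lt_le_trans c1)// ler1n.
have a0 : (0 <= a)%R by rewrite -lee_fin -branchingp; exact: branching_ge0.
have uv n : (0 < n)%N -> (mean_powsum LR I p n <= v n)%R.
  elim: n => // n IH _; have [->|n0] := posnP n.
    by rewrite v1 /mean_powsum mean_powsum1.
  rewrite (mean_powsumS SP branchingp n0) vS//.
  have H : (1 + (a - 1) / n%:R <= 1 - c / n%:R)%R.
    rewrite lerD2l -mulNr ler_wpM2r// /c opprB lerD2r.
    by rewrite le_max lexx.
  apply: le_trans (ler_wpM2r (mean_powsum_ge0 _ _ _ _) H) _.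
  rewrite ler_wpM2l ?IH// subr_ge0 ler_pdivrMr ?ltr0n// mul1r.
  by rewrite ltW// (lt_le_trans c1)// ler1n.
pose K' := (K / (s * c))%R.
have K'0 : (0 <= K')%R by rewrite divr_ge0// ltW// mulr_gt0.
pose B n := (2 * expR (K' * (1 - v n `^ s)) - 1)%R.
exists (2 * expR K')%R => n n0.
apply: (@le_trans _ _ (B n)%:E); last first.
  rewrite lee_fin /B lerBlDr ler_wpDr// ler_wpM2l// ler_expR ler_piMr//.
  by rewrite gerBl powR_ge0.
elim: n n0 => // n IH _; have [->|n0] := posnP n.
  rewrite /leaves_rv; under eq_integral do
    rewrite leaves1 /powsum big_seq1 normr1 !powR1.
  rewrite integral_cst//= probability_setT mul1e lee_fin /B v1 powR1 subrr.
  by rewrite mulr0 expR0 mulr1 lerBrDr.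
have {}IH := IH n0.
have mq : measurable_seqfun (fun l : seq R => (powsum 2 l `^ q)%:E : \bar R).
  apply: (@measurable_seqfun_comp _ _ _ _ _ (fun x : R => (x `^ q)%:E) (powsum 2)).
    by apply/measurable_EFinP; exact: measurable_powR.
  exact: measurable_powsum.
rewrite (one_step_sum SP n0 mq); last by move=> l; rewrite lee_fin powR_ge0.
pose dl := (v n `^ s)%R.
have dl0 : (0 < dl)%R by rewrite powR_gt0// v0.
have mint := measurable_leaves_rv LR I n mq.
have mps : measurable_seqfun (fun l : seq R => (powsum p l)%:E : \bar R).
  apply: (@measurable_seqfun_comp _ _ _ _ _ EFin (powsum p)).
    exact: EFin_measurable.
  exact: measurable_powsum.
have mint2 := measurable_leaves_rv LR I n mps.
have D0 : (0 <= dl `^ (- N))%R by exact: powR_ge0.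
have Kn : (0 <= K / n%:R)%R by rewrite divr_ge0.
apply: (@le_trans _ _ (\int[P]_w ((1 + K / n%:R * dl)%:E *
    (powsum 2 (leaves_rv n w) `^ q)%:E +
    (K / n%:R * dl `^ (- N))%:E * (powsum p (leaves_rv n w))%:E))).
  apply: ge0_le_integral => //.
  - move=> w _; apply: sume_ge0 => k _; rewrite mule_ge0//.
    by apply: integral_ge0 => x _; rewrite lee_fin powR_ge0.
  - apply: emeasurable_sum => k; apply: emeasurable_funM => //.
    apply: (measurable_split_expectation LR I LR0 (ltn_ord k) mq) => l.
    by rewrite lee_fin powR_ge0.
  - by apply: emeasurable_funD; apply: emeasurable_funM.
  move=> w _; have := HK (leaves_rv n w) dl.
  rewrite size_leaves => /(_ n0 dl0) /le_trans; apply.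
  rewrite -!EFinM -EFinD lee_fin le_eqVlt; apply/orP; left; apply/eqP; ring.
rewrite ge0_integral_lincomb; first last.
- by move=> w; rewrite lee_fin powsum_ge0.
- by move=> w; rewrite lee_fin powR_ge0.
- exact: mint2.
- exact: mint.
- exact: mulr_ge0.
- by apply: addr_ge0 => //; apply: mulr_ge0 => //; exact: ltW.
rewrite (mean_powsumE SP branchingp n0).
have Dv : (dl `^ (- N) * v n = dl)%R.
  rewrite /dl -powRrM -[X in (_ * X)%R](powRr1 (ltW (v0 _ n0))) -powRD.
    by congr powR; rewrite /s; field; rewrite gt_eqF// ltr_wpDr.
  by rewrite (gt_eqF (v0 _ n0)) implybT.
apply: (@le_trans _ _ ((1 + K / n%:R * dl) * B n + K / n%:R * dl)%:E).
  rewrite [leRHS]EFinD; apply: leeD.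
    by rewrite EFinM lee_wpmul2l// lee_fin addr_ge0// mulr_ge0// ltW.
  rewrite -EFinM lee_fin -[leLHS]mulrA ler_wpM2l// -[leRHS]Dv ler_wpM2l//.
  exact: uv.
rewrite lee_fin /B.
have s01 : (0 <= s <= 1)%R by rewrite s1 ltW.
have tel := decay_telescope c01 v1 vS s01 n0.
rewrite -/dl in tel *.
have x1 : (1 + K / n%:R * dl <= expR (K' * (dl - v n.+1 `^ s)))%R.
  apply: le_trans (expR_ge1Dx _); rewrite lerD2l.
  apply: le_trans (ler_wpM2l K'0 tel).
  rewrite /K' le_eqVlt; apply/orP; left; apply/eqP; field.
  by rewrite pnatr_eq0 -lt0n n0 !gt_eqF.
have e0 := expR_ge0 (K' * (1 - dl)).
have -> : (expR (K' * (1 - v n.+1 `^ s)) =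
    expR (K' * (1 - dl)) * expR (K' * (dl - v n.+1 `^ s)))%R.
  by rewrite -expRD; congr expR; ring.
have := ler_wpM2l e0 x1.
by move: (K / n%:R * dl)%R (expR _) (expR _) => x E F; lra.
Qed.

End moments.

(** * The limit mass *)

Section convergence_tools.
Context {R : realType}.

Lemma cvg_powR (u : nat -> R) (l q : R) : 0 < q -> (forall n, 0 <= u n) ->
  u n @[n --> \oo] --> l -> u n `^ q @[n --> \oo] --> l `^ q.
Proof.
move=> q0 u0 ul.
have l0 : 0 <= l.
  by rewrite -(cvg_lim _ ul)//; apply: limr_ge; [exact: cvgP ul|exact: nearW].
move: l0 ul; rewrite le_eqVlt => /predU1P[<- ul|l0 ul].
  rewrite powR0 ?gt_eqF//; apply/cvgrPdist_lt => e e0.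
  have e'0 : 0 < e `^ q^-1 by rewrite powR_gt0.
  move/cvgrPdist_lt : ul => /(_ _ e'0); apply: filterS => n.
  rewrite !sub0r !normrN (ger0_norm (u0 n)) (ger0_norm (powR_ge0 _ _)) => une.
  have -> : e = (e `^ q^-1) `^ q by rewrite -powRrM mulVf ?gt_eqF// powRr1 ?ltW.
  by apply: gt0_ltr_powR; rewrite ?nnegrE// ltW.
suff : {for l, continuous (fun x : R => x `^ q)} by apply: cvg_comp.
apply/differentiable_continuous/derivable1_diffP.
by apply: derivable_powR; rewrite in_itv/= l0.
Qed.

Lemma fatou_le {d : measure_display} {T : measurableType d}
    (mu : {measure set T -> \bar R}) (f : nat -> T -> \bar R) (g : T -> \bar R)
    (b : \bar R) :
  (forall n, measurable_fun setT (f n)) -> (forall n x, 0 <= f n x)%E ->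
  measurable_fun setT g -> (forall x, 0 <= g x)%E ->
  {ae mu, forall x, f n x @[n --> \oo] --> g x} ->
  (forall n, \int[mu]_x f n x <= b)%E -> (\int[mu]_x g x <= b)%E.
Proof.
move=> mf f0 mg g0 fg fb.
have -> : (\int[mu]_x g x = \int[mu]_x limn_einf (f^~ x))%E.
  apply: ge0_ae_eq_integral => //.
  - have -> : (fun x => limn_einf (f^~ x)) = (fun x => - limn_esup (fun n => - f n x))%E.
      apply/funext => x; rewrite -limn_einfN; congr limn_einf.
      by apply/funext => n /=; rewrite oppeK.
    apply: measurableT_comp => //; apply: measurable_fun_limn_esup => n.
    exact: measurableT_comp.
  - move=> x _; rewrite limn_einf_lim; apply: lime_ge; first exact: is_cvg_einfs.
    by apply: nearW => n; apply: le_ereal_inf_tmp => _ [m _ <-]; exact: f0.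
  - by apply: filterS fg => x /cvg_limn_einf_sup[-> _].
apply: le_trans (fatou _ _ _ _) _ => //.
rewrite limn_einf_lim; apply: lime_le; first exact: is_cvg_einfs.
apply: nearW => n; apply: le_trans (fb n); apply: ereal_inf_lbound.
by exists n => /=.
Qed.

End convergence_tools.

Section powR_additivity.
Context {R : realType}.
Implicit Types (q x y : R) (l : seq R).

Lemma powR_subadditive q x y : 0 < q <= 1 -> 0 <= x -> 0 <= y ->
  (x + y) `^ q <= x `^ q + y `^ q.
Proof.
move=> /andP[q0 q1] x0 y0.
have [s0|s0] := leP (x + y) 0.
  have -> : x + y = 0 by apply/eqP; rewrite eq_le s0 addr_ge0.
  by rewrite powR0 ?gt_eqF// addr_ge0// powR_ge0.
have sV z : 0 <= z <= x + y -> z / (x + y) * (x + y) `^ q <= z `^ q.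
  move=> /andP[]; rewrite le_eqVlt => /predU1P[<- _|z0 zs].
    by rewrite !mul0r powR_ge0.
  have -> : z `^ q = (z / (x + y)) `^ q * (x + y) `^ q.
    by rewrite -powRM ?divr_ge0 ?ltW// divfK ?gt_eqF.
  rewrite ler_wpM2r ?powR_ge0//; apply: ger1_powR => //.
  by rewrite divr_gt0//= ler_pdivrMr// mul1r.
have := lerD (sV x _) (sV y _); rewrite -!mulrDl mulfV ?gt_eqF// mul1r; apply.
  by rewrite x0 lerDl.
by rewrite y0 lerDr.
Qed.

Lemma powR_superadditive q x y : 1 < q -> 0 <= x -> 0 <= y ->
  x `^ q + y `^ q <= (x + y) `^ q.
Proof.
move=> q1 x0 y0; have q0 : 0 < q by rewrite (lt_trans _ q1).
rewrite -!(mulr_powRB1 _ q0) ?addr_ge0// mulrDl.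
by apply: lerD; rewrite ler_wpM2l//; apply: ge0_ler_powR; rewrite ?nnegrE; lra.
Qed.

(** For [q > 1] the power function is strictly superadditive, so equality
leaves no room for two non-zero terms. *)
Lemma powR_superadditive_eq q x y : 1 < q -> 0 <= x -> 0 <= y ->
  (x + y) `^ q = x `^ q + y `^ q -> x * y = 0.
Proof.
move=> q1; rewrite le_eqVlt => /predU1P[<-|x0]; first by rewrite mul0r.
rewrite le_eqVlt => /predU1P[<-|y0]; first by rewrite mulr0.
have q0 : 0 < q by rewrite (lt_trans _ q1).
move=> /eqP; rewrite gt_eqF//.
rewrite -!(mulr_powRB1 _ q0) ?addr_ge0 ?(ltW x0) ?(ltW y0)// mulrDl.
by apply: ltrD; rewrite ltr_pM2l//; apply: gt0_ltr_powR; rewrite ?nnegrE; lra.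
Qed.

Lemma powsum_half_le q l : 0 < q < 2 -> powsum 2 l `^ (q / 2) <= powsum q l.
Proof.
move=> /andP[q0 q2]; have h0 : 0 < q / 2 by lra.
elim: l => [|b l IH]; first by rewrite /powsum !big_nil powR0// gt_eqF.
rewrite /powsum !big_cons -!/(powsum _ _); apply: le_trans (powR_subadditive _ _ _) _.
- by rewrite h0; lra.
- exact: powR_ge0.
- exact: powsum_ge0.
- by rewrite lerD// -powRrM mulrC divfK.
Qed.

Lemma powsum2E l : powsum 2 l = \sum_(b <- l) b ^+ 2.
Proof. by apply: eq_bigr => b _; rewrite powR_mulrn// real_normK ?num_real. Qed.

End powR_additivity.

Section limit_mass.
Context {d d1 : measure_display} {T : measurableType d} {T1 : measurableType d1}
  {R : realType} (P : probability T R) (P1 : probability T1 R).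
Variables (LR : nat -> {RV P >-> (R * R)%type}) (I : nat -> {RV P >-> nat})
  (LR0 : {RV P1 >-> (R * R)%type}) (Minf : {RV P >-> R}).
Hypothesis SP : splitting_process LR I LR0.
Hypothesis branching2 : branching LR0 2 = 1%E.
Local Notation leaves_rv := (leaves_rv LR I).
Hypothesis Minf_cvg :
  {ae P, forall w, powsum 2 (leaves_rv n w) @[n --> \oo] --> Minf w}.
Local Open Scope ereal_scope.

Lemma Minf_ge0 : {ae P, forall w, (0 <= Minf w)%R}.
Proof.
apply: filterS Minf_cvg => w Mw; rewrite -(cvg_lim _ Mw)//.
by apply: limr_ge; [exact: cvgP Mw|apply: nearW => n; exact: powsum_ge0].
Qed.

Let mM n : measurable_fun setT (fun w => powsum 2 (leaves_rv n w)).
Proof. by apply: measurable_leaves_rv; exact: measurable_powsum. Qed.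

Let mpM n (q : R) : measurable_fun setT (fun w => (powsum 2 (leaves_rv n w) `^ q)%:E).
Proof.
apply/measurable_EFinP; apply: (measurableT_comp (measurable_powR q)); exact: mM.
Qed.

Let mpMinf (q : R) : measurable_fun setT (fun w => (`|Minf w| `^ q)%:E).
Proof.
apply/measurable_EFinP; apply: (measurableT_comp (measurable_abs_powR q)).
exact: measurable_funP.
Qed.

Lemma limit_moment_le (q b : R) N : (0 < q)%R ->
  (forall n, (N <= n)%N -> \int[P]_w (powsum 2 (leaves_rv n w) `^ q)%:E <= b%:E) ->
  \int[P]_w (`|Minf w| `^ q)%:E <= b%:E.
Proof.
move=> q0 Hb.
apply: (fatou_le (f := fun n w => (powsum 2 (leaves_rv (n + N) w) `^ q)%:E)) => //.
- by move=> n w; rewrite lee_fin powR_ge0.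
- apply: filterS2 Minf_cvg Minf_ge0 => w Mw M0.
  apply: cvg_EFin; first exact: nearW.
  rewrite /comp/= ger0_norm//.
  apply: (cvg_powR q0) => [n|]; first exact: powsum_ge0.
  by rewrite (cvg_shiftn N (fun n => powsum 2 (leaves_rv n w))).
- by move=> n; apply: Hb; rewrite leq_addl.
Qed.

(** Fatou's lemma applied to the uniformly bounded moments. *)
Lemma limit_moment_finite (p a : R) : (2 < p)%R -> branching LR0 p = a%:E ->
  (a < 1)%R -> \int[P]_w (`|Minf w| `^ (p / 2))%:E < +oo.
Proof.
move=> p2 pa a1; have [B HB] := moment_bounded SP p2 branching2 pa a1.
apply: (le_lt_trans (limit_moment_le (b := B) (N := 1) _ _)); last exact: ltry.
  by rewrite divr_gt0// (lt_trans _ p2).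
by move=> n n0; exact: HB.
Qed.

Lemma ae_eq0_powR (f : T -> R) (q : R) : (0 < q)%R -> measurable_fun setT f ->
  \int[P]_w (`|f w| `^ q)%:E <= 0 -> {ae P, forall w, f w = 0%R}.
Proof.
move=> q0 mf f0.
have mfq : measurable_fun setT (fun w => (`|f w| `^ q)%:E).
  by apply/measurable_EFinP; apply: (measurableT_comp (measurable_abs_powR q)).
have : \int[P]_w `|(`|f w| `^ q)%:E| = 0.
  apply/eqP; rewrite eq_le integral_ge0// andbT.
  by under eq_integral do rewrite gee0_abs ?lee_fin ?powR_ge0//.
move/(ae_eq_integral_abs _ measurableT mfq); apply: filterS => w /(_ Logic.I)/= [].
move=> /eqP; rewrite powR_eq0 normr_eq0 => /andP[/eqP//].
Qed.

Lemma cvg_mean_powsum (s a : R) : branching LR0 s = a%:E -> (a < 1)%R ->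
  mean_powsum LR I s n @[n --> \oo] --> 0%R.
Proof.
move=> sa a1; apply: (@cvg_decay _ _ (1 - a)%R).
- have : 0 <= branching LR0 s by exact: branching_ge0.
  by rewrite sa lee_fin subr_gt0 a1 gerBl.
- by rewrite /mean_powsum mean_powsum1.
- by move=> n n0; rewrite (mean_powsumS SP sa n0) -mulNr opprB.
Qed.

(** By subadditivity [(M_n^(2))^(g/2) <= M_n^(g)], and the mean of the
right-hand side tends to [0]. *)
Lemma limit_zero (g a : R) : (0 < g < 2)%R -> branching LR0 g = a%:E ->
  (a < 1)%R -> {ae P, forall w, Minf w = 0%R}.
Proof.
move=> g02 ga a1; have /andP[g0 g2] := g02.
apply: (@ae_eq0_powR _ (g / 2)%R); rewrite ?divr_gt0//.
apply/lee_addgt0Pr => e e0; rewrite add0e.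
have /cvgrPdist_le/(_ _ e0)[N _ HN] := cvg_mean_powsum ga a1.
apply: (limit_moment_le (N := N.+1)) => [|n Nn]; first by rewrite divr_gt0.
apply: (@le_trans _ _ (\int[P]_w (powsum g (leaves_rv n w))%:E)).
  apply: ge0_le_integral => //.
  - by move=> w _; rewrite lee_fin powR_ge0.
  - apply/measurable_EFinP; apply: measurable_leaves_rv; exact: measurable_powsum.
  - by move=> w _; rewrite lee_fin powsum_half_le.
have n0 : (0 < n)%N by exact: leq_trans Nn.
rewrite (mean_powsumE SP ga n0) lee_fin.
have := HN n (ltnW Nn); rewrite sub0r normrN ger0_norm//.
exact: mean_powsum_ge0.
Qed.

(** The masses have mean one and a bounded moment of an order above one, so no
mass is lost in the limit; a vanishing limit would have mean zero. *)
Lemma limit_nonzero (p a : R) : (2 < p)%R -> branching LR0 p = a%:E ->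
  (a < 1)%R -> ~ {ae P, forall w, Minf w = 0%R}.
Proof.
move=> p2 pa a1 M0; have [B HB] := moment_bounded SP p2 branching2 pa a1.
have q1 : (1 < p / 2)%R by rewrite ltr_pdivlMr// mul1r.
set q := (p / 2)%R in q1 HB.
have B0 : (0 <= B)%R.
  rewrite -lee_fin; apply: le_trans (HB 1%N isT).
  by apply: integral_ge0 => w _; rewrite lee_fin powR_ge0.
pose c := ((2 * B + 1) `^ (q - 1)^-1)%R.
have B1 : (0 < 2 * B + 1)%R by rewrite ltr_wpDl// mulr_ge0.
have c0 : (0 < c)%R by rewrite powR_gt0.
have cq : (c `^ (q - 1) = 2 * B + 1)%R.
  by rewrite -powRrM mulVf ?powRr1 ?(ltW B1)// subr_eq0 gt_eqF.
pose f n w := Num.min (powsum 2 (leaves_rv n.+1 w)) c.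
have f0 n w : (0 <= f n w)%R by rewrite le_min powsum_ge0 ltW.
have mf n : measurable_fun setT (f n) by apply: measurable_minr.
have fl n : (1 - (2 * B + 1)^-1 * B)%:E <= \int[P]_w (f n w)%:E.
  rewrite EFinB leeBlDr//.
  rewrite -[leLHS](_ : (mean_powsum LR I 2 n.+1)%:E = 1); last first.
    by rewrite (mean_powsum_const SP branching2).
  rewrite -(mean_powsumE SP branching2)//.
  apply: (@le_trans _ _ (\int[P]_w (1%:E * (f n w)%:E +
     ((2 * B + 1)^-1)%:E * (powsum 2 (leaves_rv n.+1 w) `^ q)%:E))).
    apply: ge0_le_integral => //.
    - by move=> w _; rewrite lee_fin powsum_ge0.
    - exact/measurable_EFinP.
    - apply: emeasurable_funD; apply: emeasurable_funM => //; exact/measurable_EFinP.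
    - move=> w _; rewrite mul1e -EFinM -EFinD lee_fin /f.
      have := powsum_ge0 2 (leaves_rv n.+1 w); set x := powsum _ _ => x0.
      have [xc|cx] := leP x c.
        by rewrite lerDl mulr_ge0 ?powR_ge0// invr_ge0 ltW.
      rewrite ler_wpDl ?(ltW c0)// ler_pdivlMl// -cq mulrC.
      rewrite -(mulr_powRB1 x0 (p := q)) ?(lt_trans _ q1)// ler_wpM2l//.
      by apply: ge0_ler_powR; rewrite ?nnegrE ?(ltW c0) ?(ltW cx)// subr_ge0 ltW.
  rewrite ge0_integral_lincomb//; last 4 first.
  - by rewrite invr_ge0 ltW.
  - exact/measurable_EFinP.
  - by move=> w; rewrite lee_fin f0.
  - by move=> w; rewrite lee_fin powR_ge0.
  rewrite mul1e leeD2l// EFinM lee_wpmul2l ?HB//.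
  by rewrite lee_fin invr_ge0 ltW.
have [] := @dominated_convergence _ _ _ P setT measurableT
  (fun n w => (f n w)%:E) (cst 0) (cst c%:E).
- by move=> n; exact/measurable_EFinP.
- exact: measurable_cst.
- apply: filterS2 Minf_cvg M0 => w + Mw0 _; rewrite Mw0 => Mw.
  apply: cvg_EFin; first exact: nearW.
  apply: (@squeeze_cvgr _ _ _ _ (fun=> 0%R)
    (fun n => powsum 2 (leaves_rv n.+1 w))); last 2 first.
  + exact: cvg_cst.
  + by rewrite (cvg_shiftS (fun n => powsum 2 (leaves_rv n w))).
  by apply: nearW => n /=; rewrite f0/= /f ge_min lexx.
- exact: finite_measure_integrable_cst.
- apply: aeW => w n _; rewrite gee0_abs ?lee_fin ?f0// /f /=.
  by rewrite ge_min lexx orbT.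
move=> _ _; rewrite integral0 => If0.
have : (1 - (2 * B + 1)^-1 * B)%:E <= 0 :> \bar R.
  rewrite -(cvg_lim _ If0)//; apply: lime_ge; first exact: cvgP If0.
  exact: nearW.
rewrite lee_fin subr_le0 mulrC ler_pdivlMr// mul1r.
by apply/negP; rewrite -ltNge; lra.
Qed.

End limit_mass.

(** * Splitting read from the root *)

Section merging.
Context {d1 : measure_display} {T1 : measurableType d1} {R : realType}
  (P1 : probability T1 R) (LR0 : {RV P1 >-> (R * R)%type}).
Implicit Types (f g : R -> R) (fs : seq (R -> R)).

Definition contraction f :=
  measurable_fun setT f /\ forall x, 0 <= f x <= 1.

Definition smooth f g x : R :=
  \int[P1]_v (f ((LR0 v).1 * x) * g ((LR0 v).2 * x)).

Local Notation nthf fs i := (nth (cst (1 : R)) fs i).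

(** The adjoint of splitting: instead of replacing one leaf by two, it
replaces two neighbouring test functions by the mean effect that they have on
the two children. *)
Definition merge k fs :=
  take k fs ++ smooth (nthf fs k) (nthf fs k.+1) :: drop k.+2 fs.

(** The Wild sums: the mean over all growth histories of an [n]-leaf tree of
the product of the test functions along the leaves, the test functions being
merged backwards in time. *)
Fixpoint wild n fs : R -> R :=
  match n with
  | 0 | 1 => nthf fs 0
  | m.+1 => fun x => m%:R^-1 * \sum_(k < m) wild m (merge k fs) x
  end.

Lemma wildS n fs x : (0 < n)%N ->
  wild n.+1 fs x = n%:R^-1 * \sum_(k < n) wild n (merge k fs) x.
Proof. by case: n. Qed.

Definition contractions fs := forall i, contraction (nthf fs i).

Lemma contraction_cst1 : contraction (cst 1).
Proof. by split => [|x]; [exact: measurable_cst|rewrite ler01 lexx]. Qed.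

Let mint f g x : contraction f -> contraction g ->
  measurable_fun setT (fun v => f ((LR0 v).1 * x) * g ((LR0 v).2 * x)).
Proof.
move=> [mf _] [mg _]; apply: measurable_funM.
- apply: (measurableT_comp mf); apply: measurable_funM => //.
  exact: measurable_fst_RV.
- apply: (measurableT_comp mg); apply: measurable_funM => //.
  exact: measurable_snd_RV.
Qed.

Let int01 f g x v : contraction f -> contraction g ->
  0 <= f ((LR0 v).1 * x) * g ((LR0 v).2 * x) <= 1.
Proof.
move=> [_ /(_ ((LR0 v).1 * x))/andP[f0 f1]] [_ /(_ ((LR0 v).2 * x))/andP[g0 g1]].
by rewrite mulr_ge0//= mulr_ile1.
Qed.

Lemma integrable_smooth f g x : contraction f -> contraction g ->
  P1.-integrable setT (EFin \o (fun v => f ((LR0 v).1 * x) * g ((LR0 v).2 * x))).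
Proof.
move=> cf cg; apply: measurable_bounded_integrable => //.
- by rewrite (le_lt_trans (probability_le1 _ _))// ltry.
- exact: mint.
- exists 1; split => // M M1 v _ /=; have /andP[h0 h1] := int01 x v cf cg.
  by rewrite ger0_norm// (le_trans h1)// ltW.
Qed.

Lemma smoothE f g x : contraction f -> contraction g ->
  (\int[P1]_v (f ((LR0 v).1 * x) * g ((LR0 v).2 * x))%:E = (smooth f g x)%:E)%E.
Proof.
move=> cf cg; rewrite /smooth /Rintegral fineK//.
exact/integrable_fin_num/integrable_smooth.
Qed.

Lemma contraction_smooth f g : contraction f -> contraction g ->
  contraction (smooth f g).
Proof.
move=> cf cg; split.
- apply: measurableT_comp => //.
  pose h (y : R * T1) := (f ((LR0 y.2).1 * y.1) * g ((LR0 y.2).2 * y.1))%:E.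
  apply: (measurable_fun_fubini_tonelli_F (m2 := P1) h) => /=; last first.
    by move=> y; rewrite lee_fin; have /andP[] := int01 y.1 y.2 cf cg.
  have [mf _] := cf; have [mg _] := cg.
  apply/measurable_EFinP; apply: measurable_funM.
  + apply: (measurableT_comp mf); apply: measurable_funM => //.
    exact: (measurableT_comp (measurable_fst_RV LR0) (@measurable_snd _ _ _ _)).
  + apply: (measurableT_comp mg); apply: measurable_funM => //.
    exact: (measurableT_comp (measurable_snd_RV LR0) (@measurable_snd _ _ _ _)).
- move=> x; rewrite -!lee_fin -smoothE//; apply/andP; split.
    by apply: integral_ge0 => v _; rewrite lee_fin; have /andP[] := int01 x v cf cg.
  rewrite -[leRHS](@probability_setT _ _ _ P1) -[leRHS]mul1e.
  rewrite -[leRHS](integral_cst _ measurableT 1%E)//.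
  apply: ge0_le_integral => //.
  + by move=> v _; rewrite lee_fin; have /andP[] := int01 x v cf cg.
  + by apply/measurable_EFinP; exact: mint.
  + by move=> v _; rewrite lee_fin; have /andP[] := int01 x v cf cg.
Qed.

Lemma contractions_merge k fs : (k < size fs)%N -> contractions fs ->
  contractions (merge k fs).
Proof.
move=> kn cfs i; rewrite nth_cat size_takel ?(ltnW kn)//.
case: ltnP => ik; first by rewrite nth_take//.
case: (i - k)%N => [|m] /=; first exact: contraction_smooth.
by rewrite nth_drop.
Qed.

Lemma size_merge k fs n : size fs = n.+1 -> (k < n)%N -> size (merge k fs) = n.
Proof.
move=> sz kn; rewrite size_cat/= size_takel ?sz ?(ltnW (leqW kn))//.
by rewrite size_drop sz; lia.
Qed.

Lemma contraction_mean n (h : nat -> R -> R) : (0 < n)%N ->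
  (forall k, (k < n)%N -> contraction (h k)) ->
  contraction (fun x => n%:R^-1 * \sum_(k < n) h k x).
Proof.
move=> n0 ch; split.
- apply: measurable_funM => //; apply: measurable_sum => k.
  by have [] := ch k (ltn_ord k).
- move=> x; apply/andP; split.
    rewrite mulr_ge0// sumr_ge0// => k _.
    by have [_ /(_ x)/andP[]] := ch k (ltn_ord k).
  rewrite ler_pdivrMl ?ltr0n// mulr1.
  rewrite -[X in _ <= X%:R]card_ord -sumr_const; apply: ler_sum => k _.
  by have [_ /(_ x)/andP[]] := ch k (ltn_ord k).
Qed.

Lemma contraction_wild n fs : (0 < n)%N -> size fs = n -> contractions fs ->
  contraction (wild n fs).
Proof.
elim: n fs => // -[|n] IH fs _ sz cfs; first exact: cfs.
apply: (@contraction_mean n.+1 (fun k => wild n.+1 (merge k fs))) => // k kn.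
apply: IH => //; first exact: size_merge.
by apply: contractions_merge => //; rewrite sz ltnW.
Qed.

Lemma smooth_meanl n (h : nat -> R -> R) g x : (0 < n)%N ->
  (forall k, (k < n)%N -> contraction (h k)) -> contraction g ->
  \sum_(k < n) smooth (h k) g x =
  n%:R * smooth (fun y => n%:R^-1 * \sum_(k < n) h k y) g x.
Proof.
move=> n0 ch cg; apply: EFin_inj.
rewrite EFinM -smoothE//; last exact: contraction_mean.
rewrite -sumEFin (eq_bigr (fun k : 'I_n =>
  \int[P1]_v (h k ((LR0 v).1 * x) * g ((LR0 v).2 * x))%:E)%E); last first.
  by move=> k _; rewrite smoothE//; exact: ch.
rewrite -ge0_integral_sum//; last 2 first.
- by move=> k; apply/measurable_EFinP/mint => //; exact: ch.
- by move=> k v _; rewrite lee_fin; have /andP[] := int01 x v (ch k (ltn_ord k)) cg.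
have cm := contraction_mean n0 ch.
rewrite -ge0_integralZl//; last 2 first.
- by apply/measurable_EFinP/(mint x cm cg).
- by move=> v _; rewrite lee_fin; have /andP[] := int01 x v cm cg.
apply: eq_integral => v _; rewrite sumEFin -EFinM -big_distrl/=.
by rewrite !mulrA mulfV ?mul1r// pnatr_eq0 -lt0n.
Qed.

Lemma smooth_meanr n f (h : nat -> R -> R) x : (0 < n)%N ->
  (forall k, (k < n)%N -> contraction (h k)) -> contraction f ->
  \sum_(k < n) smooth f (h k) x =
  n%:R * smooth f (fun y => n%:R^-1 * \sum_(k < n) h k y) x.
Proof.
move=> n0 ch cf; apply: EFin_inj.
rewrite EFinM -smoothE//; last exact: contraction_mean.
rewrite -sumEFin (eq_bigr (fun k : 'I_n =>
  \int[P1]_v (f ((LR0 v).1 * x) * h k ((LR0 v).2 * x))%:E)%E); last first.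
  by move=> k _; rewrite smoothE//; exact: ch.
rewrite -ge0_integral_sum//; last 2 first.
- by move=> k; apply/measurable_EFinP/mint => //; exact: ch.
- by move=> k v _; rewrite lee_fin; have /andP[] := int01 x v cf (ch k (ltn_ord k)).
have cm := contraction_mean n0 ch.
rewrite -ge0_integralZl//; last 2 first.
- by apply/measurable_EFinP/(mint x cf cm).
- by move=> v _; rewrite lee_fin; have /andP[] := int01 x v cf cm.
apply: eq_integral => v _; rewrite sumEFin -EFinM -big_distrr/=.
by congr EFin; rewrite mulrCA [_%:R * (_ * _)]mulrA mulfV ?mul1r// pnatr_eq0 -lt0n.
Qed.

Lemma take_merge_le j k fs : (k <= j)%N -> (j.+1 < size fs)%N ->
  take j.+1 (merge k fs) = merge k (take j.+2 fs).
Proof.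
move=> kj js; rewrite /merge take_cat size_takel; last by lia.
rewrite ltnNge (leqW kj)/= subSn//= !nth_take//; last by lia.
rewrite take_takel//; last by lia.
congr (_ ++ _ :: _); rewrite take_drop; congr (drop _ (take _ _)); lia.
Qed.

Lemma drop_merge_le j k fs : (k <= j)%N -> (j.+1 < size fs)%N ->
  drop j.+1 (merge k fs) = drop j.+2 fs.
Proof.
move=> kj js; rewrite /merge drop_cat size_takel; last by lia.
rewrite ltnNge (leqW kj)/= subSn//= drop_drop; congr drop; lia.
Qed.

Lemma take_merge_gt j k fs : (j < k)%N -> (k < size fs)%N ->
  take j.+1 (merge k fs) = take j.+1 fs.
Proof.
move=> jk ks; rewrite /merge take_cat size_takel; last by lia.
case: ltnP => [jk1|jk1]; first by rewrite take_takel// ltnW.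
have -> : k = j.+1 by lia.
by rewrite subnn take0 cats0.
Qed.

Lemma drop_merge_gt j k fs : (j < k)%N -> (k.+1 < size fs)%N ->
  drop j.+1 (merge k fs) = merge (k - j.+1) (drop j.+1 fs).
Proof.
move=> jk ks; rewrite /merge drop_cat size_takel; last by lia.
rewrite !nth_drop drop_drop.
have -> : (j.+1 + (k - j.+1) = k)%N by lia.
have -> : (j.+1 + (k - j.+1).+1 = k.+1)%N by lia.
have -> : ((k - j.+1).+2 + j.+1 = k.+2)%N by lia.
case: ltnP => [jk1|jk1].
  rewrite take_drop; congr (drop _ (take _ _) ++ _); lia.
have -> : k = j.+1 by lia.
by rewrite subnn take0.
Qed.

(** The recursion by the last split becomes a recursion by the first split:
the first split separates the test functions into two consecutive blocks,
whose sizes are uniformly distributed, as in a Polya urn. *)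
Lemma wild_backward n fs x : (0 < n)%N -> size fs = n.+1 -> contractions fs ->
  wild n.+1 fs x = n%:R^-1 * \sum_(j < n)
    smooth (wild j.+1 (take j.+1 fs)) (wild (n - j) (drop j.+1 fs)) x.
Proof.
elim: n fs => // -[|n] IH fs _ sz cfs.
  rewrite /= !big_ord_recl !big_ord0 !addr0 /merge !take0 /=.
  by rewrite nth_take// nth_drop.
rewrite wildS//; congr (_ * _).
pose t i := smooth (wild i.+1 (take i.+1 fs)) (wild (n.+2 - i) (drop i.+1 fs)) x.
have cft i : contractions (take i fs).
  move=> k; case: (ltnP k i) => ki; first by rewrite nth_take.
  rewrite nth_default; first exact: contraction_cst1.
  by rewrite size_take; case: ifP; lia.
have cfd i : contractions (drop i fs) by move=> k; rewrite nth_drop.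
have H (k : 'I_n.+2) : wild n.+2 (merge k fs) x = n.+1%:R^-1 * \sum_(j < n.+1)
    smooth (wild j.+1 (take j.+1 (merge k fs)))
      (wild (n.+1 - j) (drop j.+1 (merge k fs))) x.
  apply: IH => //; first exact: size_merge.
  by apply: contractions_merge => //; rewrite sz; have := ltn_ord k; lia.
rewrite (eq_bigr _ (fun k _ => H k)) -big_distrr/= exchange_big/=.
have tE (j : 'I_n.+1) : \sum_(k < n.+2)
    smooth (wild j.+1 (take j.+1 (merge k fs)))
      (wild (n.+1 - j) (drop j.+1 (merge k fs))) x =
    j.+1%:R * t j.+1 + (n.+1 - j)%:R * t j.
  have jn : (j < n.+1)%N by [].
  have c1 : contraction (wild j.+1 (take j.+1 fs)).
    by apply: contraction_wild => //; rewrite size_takel// sz; lia.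
  have c2 : contraction (wild (n.+1 - j) (drop j.+2 fs)).
    by apply: contraction_wild; rewrite ?size_drop ?sz//; lia.
  pose F k := smooth (wild j.+1 (take j.+1 (merge k fs)))
      (wild (n.+1 - j) (drop j.+1 (merge k fs))) x.
  rewrite -(big_mkord xpredT F) (big_cat_nat (n := j.+1))//=; last by lia.
  congr (_ + _).
    rewrite big_mkord (eq_bigr (fun k : 'I_j.+1 => smooth
      (wild j.+1 (merge k (take j.+2 fs))) (wild (n.+1 - j) (drop j.+2 fs)) x)).
      rewrite (@smooth_meanl j.+1 (fun k => wild j.+1 (merge k (take j.+2 fs))))//.
      move=> k kj; apply: contraction_wild => //.
        by apply: size_merge => //; rewrite size_takel// sz; lia.
      by apply: contractions_merge => //; rewrite size_takel ?sz; lia.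
    move=> k _; rewrite /F take_merge_le ?drop_merge_le ?sz//; have := ltn_ord k; lia.
  rewrite -{1}[j.+1]add0n big_addn (_ : (n.+2 - j.+1 = n.+1 - j)%N)//.
  rewrite big_mkord (eq_bigr (fun k : 'I_(n.+1 - j) => smooth
    (wild j.+1 (take j.+1 fs)) (wild (n.+1 - j) (merge k (drop j.+1 fs))) x)).
    rewrite (@smooth_meanr _ _ (fun k => wild (n.+1 - j) (merge k (drop j.+1 fs))))//.
    - rewrite /t (_ : n.+2 - j = (n.+1 - j).+1)%N; last by lia.
      congr (_ * smooth _ _ _); apply/funext => y; rewrite wildS//; lia.
    - lia.
    - move=> k kj; apply: contraction_wild => //; first by lia.
        by apply: size_merge => //; rewrite size_drop sz; lia.
      by apply: contractions_merge => //; rewrite size_drop sz; lia.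
  move=> k _; have := ltn_ord k => kj.
  by rewrite /F take_merge_gt ?drop_merge_gt ?sz ?addnK//; lia.
rewrite (eq_bigr _ (fun j _ => tE j)) big_split/=.
have E1 : \sum_(j < n.+1) j.+1%:R * t j.+1 = \sum_(j < n.+2) (j : nat)%:R * t j.
  by rewrite [RHS]big_ord_recl mul0r add0r.
have E2 : \sum_(j < n.+1) (n.+1 - j)%:R * t j =
    \sum_(j < n.+2) (n.+1 - j)%:R * t j.
  by rewrite [RHS]big_ord_recr/= subnn mul0r addr0.
rewrite E1 E2 -big_split/= (eq_bigr (fun j : 'I_n.+2 => n.+1%:R * t j)).
  by rewrite -big_distrr/= mulrA mulVf ?mul1r// pnatr_eq0.
move=> j _; rewrite -mulrDl -natrD subnKC//; have := ltn_ord j; lia.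
Qed.

End merging.

(** * The Laplace transform of the limit mass is a fixed point *)

Section bounded_integrals.
Context {d : measure_display} {T : measurableType d} {R : realType}
  (P : probability T R).

Lemma bounded_integrable (f : T -> R) (C : R) : measurable_fun setT f ->
  (forall w, `|f w| <= C) -> P.-integrable setT (EFin \o f).
Proof.
move=> mf fC; apply: measurable_bounded_integrable => //.
  by rewrite (le_lt_trans (probability_le1 _ _))// ltry.
exists C; split; first exact: num_real.
by move=> M CM w _; rewrite /= (le_trans (fC w))// ltW.
Qed.

Lemma bounded_RintegralE (f : T -> R) (C : R) : measurable_fun setT f ->
  (forall w, `|f w| <= C) -> (\int[P]_w (f w)%:E = (\int[P]_w f w)%R%:E)%E.
Proof.
move=> mf fC; rewrite /Rintegral fineK//.
exact/integrable_fin_num/(bounded_integrable mf fC).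
Qed.

Lemma bounded_cvg_Rintegral (f_ : nat -> T -> R) (f : T -> R) (C : R) :
  (forall n, measurable_fun setT (f_ n)) -> measurable_fun setT f ->
  (forall n w, `|f_ n w| <= C) ->
  {ae P, forall w, f_ n w @[n --> \oo] --> f w} ->
  (\int[P]_w f_ n w)%R @[n --> \oo] --> (\int[P]_w f w)%R.
Proof.
move=> mf_ mf fC fcv.
have [] := @dominated_convergence _ _ _ P setT measurableT
  (fun n w => (f_ n w)%:E) (EFin \o f) (cst C%:E).
- by move=> n; exact/measurable_EFinP.
- exact/measurable_EFinP.
- by apply: filterS fcv => w fw _; apply: cvg_EFin => //; exact: nearW.
- exact: finite_measure_integrable_cst.
- by apply: aeW => w n _; rewrite /= lee_fin.
move=> intf _ cvf; apply: fine_cvg; rewrite fineK//.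
exact: integrable_fin_num.
Qed.

Lemma le_bounded_Rintegral (f g : T -> R) (C : R) :
  measurable_fun setT f -> measurable_fun setT g ->
  (forall w, `|f w| <= C) -> (forall w, `|g w| <= C) ->
  (forall w, f w <= g w) -> \int[P]_w f w <= \int[P]_w g w.
Proof.
move=> mf mg fC gC fg; apply: le_Rintegral => //.
- exact: bounded_integrable mf fC.
- exact: bounded_integrable mg gC.
Qed.

End bounded_integrals.

Section laplace.
Context {d d1 : measure_display} {T : measurableType d} {T1 : measurableType d1}
  {R : realType} (P : probability T R) (P1 : probability T1 R).
Variables (LR : nat -> {RV P >-> (R * R)%type}) (I : nat -> {RV P >-> nat})
  (LR0 : {RV P1 >-> (R * R)%type}) (Minf : {RV P >-> R}).
Hypothesis SP : splitting_process LR I LR0.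
Local Notation leaves_rv := (leaves_rv LR I).
Local Notation smooth := (smooth LR0).
Local Notation wild := (wild LR0).
Local Notation merge := (merge LR0).
Local Notation nthf fs i := (nth (cst (1 : R)) fs i).

(** The empty tail is worth [1], so that a functional of [n] leaves only
involves the first [n] test functions. *)
Fixpoint prodf (fs : seq (R -> R)) (l : seq R) (x : R) : R :=
  if fs is f :: fs' then if l is b :: l' then f (b * x) * prodf fs' l' x else 1
  else 1.

Lemma prodf_cat fs1 fs2 l1 l2 x : size fs1 = size l1 ->
  prodf (fs1 ++ fs2) (l1 ++ l2) x = prodf fs1 l1 x * prodf fs2 l2 x.
Proof.
elim: fs1 l1 => [|f fs1 IH] [|b l1]//=; first by rewrite mul1r.
by move=> [/IH ->]; rewrite mulrA.
Qed.

Lemma prodf_bounds fs l x : contractions fs -> 0 <= prodf fs l x <= 1.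
Proof.
elim: fs l => [|f fs IH] [|b l] cf /=; rewrite ?ler01 ?lexx//.
have [_ /(_ (b * x))/andP[f0 f1]] := cf 0%N.
have /andP[p0 p1] := IH l (fun i => cf i.+1).
by rewrite mulr_ge0//= mulr_ile1.
Qed.

Lemma measurable_prodf fs x : contractions fs ->
  measurable_seqfun (fun l => prodf fs l x).
Proof.
move=> cf d' S f m mf; elim: fs (iota 0 m) cf => [|g fs IH] [|k l] cf /=;
  try exact: measurable_cst.
apply: measurable_funM; last by apply: IH => i; exact: (cf i.+1).
by apply: (measurableT_comp (cf 0%N).1); apply: measurable_funM.
Qed.

Lemma prodf_split fs l k x (v : T1) : size fs = (size l).+1 -> (k < size l)%N ->
  prodf fs (split_leaf k l (LR0 v)) x =
  prodf (take k fs) (take k l) x *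
  (nthf fs k ((LR0 v).1 * (l`_k * x)) * nthf fs k.+1 ((LR0 v).2 * (l`_k * x)) *
   prodf (drop k.+2 fs) (drop k.+1 l) x).
Proof.
move=> sz kl; rewrite -{1}(cat_take_drop k fs) prodf_cat ?size_takel//; try lia.
rewrite (drop_nth (cst 1)) ?sz; last by lia.
by rewrite (drop_nth (cst 1)) ?sz//= !mulrA.
Qed.

Lemma expectation_prodf_split fs l k x : size fs = (size l).+1 ->
  (k < size l)%N -> contractions fs ->
  (\int[P1]_v (prodf fs (split_leaf k l (LR0 v)) x)%:E =
   (prodf (merge k fs) l x)%:E)%E.
Proof.
move=> sz kl cf.
have cft i : contractions (take i fs).
  move=> j; case: (ltnP j i) => ji; first by rewrite nth_take.
  rewrite nth_default; first exact: contraction_cst1.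
  by rewrite size_take; case: ifP; lia.
have cfd i : contractions (drop i fs) by move=> j; rewrite nth_drop.
pose c := prodf (take k fs) (take k l) x * prodf (drop k.+2 fs) (drop k.+1 l) x.
have c0 : 0 <= c.
  by rewrite mulr_ge0//; [have /andP[] := prodf_bounds (take k l) x (cft k)|
    have /andP[] := prodf_bounds (drop k.+1 l) x (cfd k.+2)].
have intS := integrable_smooth LR0 (l`_k * x) (cf k) (cf k.+1).
transitivity (\int[P1]_v (c%:E * (nthf fs k ((LR0 v).1 * (l`_k * x)) *
    nthf fs k.+1 ((LR0 v).2 * (l`_k * x)))%:E))%E.
  apply: eq_integral => v _; rewrite prodf_split// -EFinM; congr EFin.
  by rewrite /c; ring.
rewrite integralZl// (smoothE LR0 _ (cf k) (cf k.+1)) -EFinM; congr EFin.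
rewrite /merge -{2}(cat_take_drop k l) prodf_cat ?size_takel//; try lia.
by rewrite (drop_nth 0 kl)/= /c; ring.
Qed.

(** Induction on the number of leaves: one splitting step in the tree
corresponds to one merging of the test functions. *)
Lemma expectation_prodf n fs x : (0 < n)%N -> size fs = n -> contractions fs ->
  (\int[P]_w (prodf fs (leaves_rv n w) x)%:E = (wild n fs x)%:E)%E.
Proof.
elim: n fs => // n IH fs _ sz cf; have [n0|n0] := posnP n.
  subst n; case: fs sz cf => // f [|//] _ cf.
  under eq_integral do rewrite /leaves_rv leaves1 /= mul1r mulr1.
  by rewrite integral_cst//= probability_setT mule1.
rewrite (one_step SP.(LR_law) SP.(I_law) SP.(LR_past) SP.(I_past)
   (Phi := fun l => (prodf fs l x)%:E))//; last 2 first.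
- apply: (@measurable_seqfun_comp _ _ _ _ _ EFin (fun l => prodf fs l x)).
    exact: EFin_measurable.
  exact: measurable_prodf.
- by move=> l; rewrite lee_fin; have /andP[] := prodf_bounds l x cf.
rewrite wildS// big_distrr/= -sumEFin.
apply: eq_bigr => k _; rewrite EFinM; congr (_ * _)%E.
rewrite -IH//; last 2 first.
- exact: size_merge.
- by apply: contractions_merge => //; rewrite sz; have := ltn_ord k; lia.
by apply: eq_integral => w _; rewrite expectation_prodf_split ?size_leaves.
Qed.

Definition gaussf (x : R) : R := expR (- x ^+ 2).

Lemma contraction_gaussf : contraction gaussf.
Proof.
split; first exact: (@measurable_gauss_fun R).
by move=> x; rewrite gauss_fun_ge0 gauss_fun_le1.
Qed.

Lemma prodf_gaussf n l x : size l = n ->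
  prodf (nseq n gaussf) l x = expR (- (x ^+ 2 * powsum 2 l)).
Proof.
rewrite powsum2E => <-; elim: l => [|b l IH] /=.
  by rewrite big_nil mulr0 oppr0 expR0.
by rewrite IH big_cons /gaussf -expRD; congr expR; ring.
Qed.

(** With Gaussian test functions the product along the leaves is [exp (- x^2
M_n^(2))], so that this Wild sum is the Laplace transform of the mass. *)
Definition psi_ n x : R := wild n (nseq n gaussf) x.

Definition psi x : R := \int[P]_w expR (- (x ^+ 2 * `|Minf w|)).

Let contractions_gaussf n : contractions (nseq n gaussf).
Proof.
by move=> i; rewrite nth_nseq; case: ifP => _;
  [exact: contraction_gaussf|exact: contraction_cst1].
Qed.

Lemma contraction_psi_ n : (0 < n)%N -> contraction (psi_ n).
Proof.
by move=> n0; apply: contraction_wild; rewrite ?size_nseq//; exact: contractions_gaussf.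
Qed.

Lemma psi_E n x : (0 < n)%N ->
  psi_ n x = \int[P]_w expR (- (x ^+ 2 * powsum 2 (leaves_rv n w))).
Proof.
move=> n0; rewrite /psi_ /Rintegral -[LHS]/(fine (_)%:E).
rewrite -(expectation_prodf _ n0 (size_nseq n gaussf))//.
by congr fine; apply: eq_integral => w _; rewrite prodf_gaussf// size_leaves.
Qed.

Let expR_le1 (a b : R) : 0 <= a -> 0 <= b -> `|expR (- (a * b))| <= 1.
Proof.
by move=> a0 b0; rewrite ger0_norm ?expR_ge0// -expR0 ler_expR oppr_le0 mulr_ge0.
Qed.

Lemma measurable_expR_lin x (f : T -> R) : measurable_fun setT f ->
  measurable_fun setT (fun w => expR (- (x * f w))).
Proof.
by move=> mf; apply: measurableT_comp => //; apply: measurableT_comp => //;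
  exact: measurable_funM.
Qed.

Let mexp x : measurable_fun setT (fun w => expR (- (x * `|Minf w|))).
Proof. by apply: measurable_expR_lin; exact: measurableT_comp. Qed.

Hypothesis Minf_cvg :
  {ae P, forall w, powsum 2 (leaves_rv n w) @[n --> \oo] --> Minf w}.

Lemma cvg_expectation_exp (c : R) : 0 <= c ->
  \int[P]_w expR (- (c * powsum 2 (leaves_rv n w))) @[n --> \oo] -->
  \int[P]_w expR (- (c * `|Minf w|)).
Proof.
move=> c0; apply: (bounded_cvg_Rintegral (C := 1)).
- move=> n; apply: measurable_expR_lin; apply: measurable_leaves_rv.
  exact: measurable_powsum.
- exact: mexp.
- by move=> n w; apply: expR_le1 => //; exact: powsum_ge0.
- apply: filterS2 Minf_cvg (Minf_ge0 Minf_cvg) => w Mw Mw0; rewrite ger0_norm//.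
  have H : - (c * powsum 2 (leaves_rv n w)) @[n --> \oo] --> - (c * Minf w).
    by apply: cvgN; apply: cvgM => //; exact: cvg_cst.
  exact: (cvg_comp _ _ H (@continuous_expR R _)).
Qed.

Lemma cvg_psi x : psi_ n x @[n --> \oo] --> psi x.
Proof.
have := cvg_expectation_exp (sqr_ge0 x).
rewrite -cvg_shiftS /= => H; rewrite -cvg_shiftS.
rewrite (_ : (fun n => psi_ n.+1 x) =
  (fun n => \int[P]_w expR (- (x ^+ 2 * powsum 2 (leaves_rv n.+1 w))))) //.
by apply/funext => n; rewrite psi_E.
Qed.

Lemma contraction_psi : contraction psi.
Proof.
split.
- apply: (measurable_fun_cvg (h := fun n => psi_ n.+1)) => // [n|x _].
    by have [] := contraction_psi_ (ltn0Sn n).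
  by rewrite (cvg_shiftS (psi_^~ x)); exact: cvg_psi.
- move=> x; have [H1 H2] : 0 <= psi x /\ psi x <= 1; last by rewrite H1.
  have Hx := @cvg_psi x; rewrite -(cvg_lim _ Hx)//; split.
    apply: limr_ge; first exact: cvgP Hx.
    by near=> n; have [|_ /(_ x)/andP[]] := @contraction_psi_ n; [near: n; exists 1%N|].
  apply: limr_le; first exact: cvgP Hx.
  by near=> n; have [|_ /(_ x)/andP[]] := @contraction_psi_ n; [near: n; exists 1%N|].
Unshelve. all: by end_near. Qed.

(** All functions take values in [0, 1], so the difference of two products is
at most the sum of the differences of the factors. *)
Lemma smooth_dist f1 f2 g1 g2 x : contraction f1 -> contraction f2 ->
  contraction g1 -> contraction g2 ->
  `|smooth f1 g1 x - smooth f2 g2 x| <=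
  \int[P1]_v `|f1 ((LR0 v).1 * x) - f2 ((LR0 v).1 * x)| +
  \int[P1]_v `|g1 ((LR0 v).2 * x) - g2 ((LR0 v).2 * x)|.
Proof.
move=> cf1 cf2 cg1 cg2.
have mL f : contraction f -> measurable_fun setT (fun v => f ((LR0 v).1 * x)).
  case=> mf _; apply: (measurableT_comp mf); apply: measurable_funM => //.
  exact: measurable_fst_RV.
have mR f : contraction f -> measurable_fun setT (fun v => f ((LR0 v).2 * x)).
  case=> mf _; apply: (measurableT_comp mf); apply: measurable_funM => //.
  exact: measurable_snd_RV.
have dist1 f g (y : R) : contraction f -> contraction g -> `|f y - g y| <= 1.
  move=> [_ /(_ y)/andP[f0 ?]] [_ /(_ y)/andP[g0 ?]].
  by rewrite ler_norml; apply/andP; split; lra.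
have md1 : measurable_fun setT (fun v => `|f1 ((LR0 v).1 * x) - f2 ((LR0 v).1 * x)|).
  by apply: measurableT_comp => //; apply: measurable_funB; exact: mL.
have md2 : measurable_fun setT (fun v => `|g1 ((LR0 v).2 * x) - g2 ((LR0 v).2 * x)|).
  by apply: measurableT_comp => //; apply: measurable_funB; exact: mR.
have mabs : measurable_fun setT (fun v => `|f1 ((LR0 v).1 * x) * g1 ((LR0 v).2 * x) -
    f2 ((LR0 v).1 * x) * g2 ((LR0 v).2 * x)|).
  by apply: measurableT_comp => //; apply: measurable_funB; apply: measurable_funM;
    [exact: mL|exact: mR|exact: mL|exact: mR].
have key v : `|f1 ((LR0 v).1 * x) * g1 ((LR0 v).2 * x) -
    f2 ((LR0 v).1 * x) * g2 ((LR0 v).2 * x)| <=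
    `|f1 ((LR0 v).1 * x) - f2 ((LR0 v).1 * x)| +
    `|g1 ((LR0 v).2 * x) - g2 ((LR0 v).2 * x)|.
  move: ((LR0 v).1 * x) ((LR0 v).2 * x) => y z.
  have [_ /(_ z)/andP[h0 h1]] := cg1; have [_ /(_ y)/andP[k0 k1]] := cf2.
  rewrite (_ : _ - _ = (f1 y - f2 y) * g1 z + f2 y * (g1 z - g2 z)); last by ring.
  apply: le_trans (ler_normD _ _) _; rewrite !normrM (ger0_norm h0) (ger0_norm k0).
  by rewrite lerD// ?ler_piMr// ler_piMl.
have b2 v : `|f1 ((LR0 v).1 * x) - f2 ((LR0 v).1 * x)| +
    `|g1 ((LR0 v).2 * x) - g2 ((LR0 v).2 * x)| <= 2.
  by rewrite (_ : 2 = 1 + 1)// lerD// dist1.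
rewrite -RintegralB//; try exact: integrable_smooth.
apply: le_trans (le_normr_Rintegral _ _) _ => //.
  apply: (@bounded_integrable _ _ _ P1 _ 2) => [|v]; last exact: le_trans (key v) (b2 v).
  by apply: measurable_funB; apply: measurable_funM;
    [exact: mL|exact: mR|exact: mL|exact: mR].
rewrite -RintegralD//; last 2 first.
- apply: (@bounded_integrable _ _ _ P1 _ 1) => // v; rewrite normr_id; exact: dist1.
- apply: (@bounded_integrable _ _ _ P1 _ 1) => // v; rewrite normr_id; exact: dist1.
apply: (@le_bounded_Rintegral _ _ _ P1 _ _ 2) => //.
- exact: measurable_funD.
- by move=> v; rewrite normr_id (le_trans (key v)).
- by move=> v; rewrite ger0_norm// addr_ge0.
Qed.

(** The decomposition at the first split writes [psi_n] as an average over [j]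
of [smooth] applied to [psi_j] and [psi_(n-j)]. Both indices are large for
most [j], so by Cesaro the average has the same limit as its terms. *)
Theorem psi_fixpoint (x : R) : psi x = smooth psi psi x.
Proof.
have cp := contraction_psi.
have ex (y : T1 -> R) : exists e : nat -> R,
    forall n, e n = \int[P1]_v `|psi_ n.+1 (y v) - psi (y v)|.
  by exists (fun n => \int[P1]_v `|psi_ n.+1 (y v) - psi (y v)|).
have [e1 e1E] := ex (fun v => (LR0 v).1 * x).
have [e2 e2E] := ex (fun v => (LR0 v).2 * x).
have e0 (y : T1 -> R) : measurable_fun setT y ->
    (\int[P1]_v `|psi_ n.+1 (y v) - psi (y v)|)%R @[n --> \oo] --> (0 : R).
  move=> my; rewrite [X in _ --> X](_ : _ = \int[P1]_v (cst 0 : T1 -> R) v); last first.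
    by rewrite Rintegral_cst// mul0r.
  apply: (bounded_cvg_Rintegral (C := 1)) => //.
  - move=> n; apply: measurableT_comp => //; apply: measurable_funB.
      by apply: measurableT_comp => //; have [] := contraction_psi_ (ltn0Sn n).
    by apply: measurableT_comp => //; have [] := cp.
  - move=> n v; rewrite normr_id.
    have [_ /(_ (y v))/andP[]] := contraction_psi_ (ltn0Sn n).
    have [_ /(_ (y v))/andP[]] := cp.
    by move=> *; rewrite ler_norml; apply/andP; split; lra.
  - apply: aeW => v /=; apply/norm_cvg0P/subr_cvg0.
    by rewrite (cvg_shiftS (psi_^~ (y v))); exact: cvg_psi.
have c1 : e1 n @[n --> \oo] --> (0 : R).
  under eq_cvg do rewrite e1E.
  by apply: e0; apply: measurable_funM => //; exact: measurable_fst_RV.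
have c2 : e2 n @[n --> \oo] --> (0 : R).
  under eq_cvg do rewrite e2E.
  by apply: e0; apply: measurable_funM => //; exact: measurable_snd_RV.
(* the j-th term of the average is estimated by smooth_dist; reversing the
   second sum yields two arithmetic means *)
have bound n : `|psi_ n.+2 x - smooth psi psi x| <=
    arithmetic_mean e1 n + arithmetic_mean e2 n.
  rewrite /psi_ wild_backward ?size_nseq//.
  have -> : smooth psi psi x = n.+1%:R^-1 * \sum_(j < n.+1) smooth psi psi x.
    by rewrite sumr_const card_ord -[X in _ * X]mulr_natl mulKf// pnatr_eq0.
  rewrite -mulrBr -sumrB normrM ger0_norm ?invr_ge0//.
  rewrite /arithmetic_mean -mulrDr ler_wpM2l ?invr_ge0//.
  have -> : series e2 n.+1 = \sum_(j < n.+1) e2 (n - j)%N.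
    rewrite seriesEord (reindex_inj rev_ord_inj); apply: eq_bigr => j _.
    by congr e2; have := ltn_ord j; rewrite /=; lia.
  rewrite seriesEord -big_split; apply: le_trans (ler_norm_sum _ _ _) _.
  apply: ler_sum => j _; have jn := ltn_ord j.
  have -> : take j.+1 (nseq n.+2 gaussf) = nseq j.+1 gaussf.
    by rewrite take_nseq//; lia.
  have -> : drop j.+1 (nseq n.+2 gaussf) = nseq (n.+1 - j) gaussf.
    by rewrite drop_nseq.
  apply: le_trans (smooth_dist _ _ _ _ _) _ => //.
  - exact: contraction_psi_.
  - by apply: contraction_psi_; lia.
  by rewrite e1E e2E subSn.
have c12 : arithmetic_mean e1 n + arithmetic_mean e2 n @[n --> \oo] --> (0 : R).
  by rewrite -[X in _ --> X]addr0; apply: cvgD; exact: cesaro.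
have [u uE] : exists u : nat -> R, forall n, u n = psi_ n x by exists (psi_^~ x).
have cu : u n @[n --> \oo] --> psi x.
  by under eq_cvg do rewrite uE; exact: cvg_psi.
have cu2 : u n.+2 @[n --> \oo] --> psi x.
  by rewrite (cvg_shiftS (fun n => u n.+1)) (cvg_shiftS u).
have cs : u n.+2 @[n --> \oo] --> smooth psi psi x.
  apply/subr_cvg0/norm_cvg0P; apply: (squeeze_cvgr _ (cvg_cst 0) c12).
  by apply: nearW => n; rewrite normr_ge0/= uE bound.
by rewrite -(cvg_lim _ cu2)// (cvg_lim _ cs).
Qed.

End laplace.

(** * The Laplace transform determines the moments *)

Section mellin.
Context {R : realType}.
Local Notation mu := (@lebesgue_measure R).

(** Applied below to the variable [log l], for which the scaling of a Laplace
transform is a translation. *)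
Lemma integral_translate (G : R -> R) (u : R) : continuous G ->
  (forall x, 0 <= G x) -> (\int[mu]_x (G (x + u))%:E = \int[mu]_x (G x)%:E)%E.
Proof.
move=> cG G0.
have dF : ((fun x : R => x + u)^`())%classic = cst 1.
  apply/funext => x; rewrite derive1E deriveD//.
  by rewrite derive_id derive_cst addr0.
rewrite [RHS](@increasing_ge0_integration_by_substitutionT _ (fun x => x + u) G)//.
- by apply: eq_integral => x _; rewrite dF /= mulr1.
- by move=> x y xy; rewrite ltrD2r.
- by rewrite dF; exact: cst_continuous.
- by rewrite dF; exact: is_cvg_cst.
- by rewrite dF; exact: is_cvg_cst.
- exact: cvg_addrr_Ny.
- exact: cvg_addrr.
Qed.

(** With [l = exp s] this is the integrand [l^(-q) (1 - exp (- l y))^m dl / l]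
of a Mellin transform in logarithmic coordinates. The power [m > q] makes it
integrable at [l = 0], so that every order [q > 0] is covered without
fractional derivatives. *)
Definition mellin_kernel (q : R) (m : nat) (y s : R) : R :=
  expR (- (q * s)) * (1 - expR (- (expR s * y))) ^+ m.

Lemma mellin_kernel_ge0 q m y s : 0 <= y -> 0 <= mellin_kernel q m y s.
Proof.
move=> y0; rewrite mulr_ge0 ?expR_ge0// exprn_ge0// subr_ge0.
by rewrite -expR0 ler_expR oppr_le0 mulr_ge0 ?expR_ge0.
Qed.

Lemma continuous_mellin_kernel q m y : continuous (mellin_kernel q m y).
Proof.
move=> s; apply: cvgM.
  apply: (@continuous_comp _ _ _ (fun s => - (q * s)) expR);
    last exact: continuous_expR.
  by apply: cvgN; apply: cvgM; [exact: cvg_cst|exact: cvg_id].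
apply: (@continuous_comp _ _ _ (fun s => 1 - expR (- (expR s * y)))
  (fun x => x ^+ m)); last exact: exprn_continuous.
apply: cvgB; first exact: cvg_cst.
apply: (@continuous_comp _ _ _ (fun s => - (expR s * y)) expR);
  last exact: continuous_expR.
by apply: cvgN; apply: cvgM; [exact: continuous_expR|exact: cvg_cst].
Qed.

Definition mellin_constant q m : \bar R := (\int[mu]_s (mellin_kernel q m 1 s)%:E)%E.

Lemma measurable_mellin_kernel (q : R) m (y : R) :
  measurable_fun setT (mellin_kernel q m y).
Proof.
apply: measurable_funM.
  by apply: measurableT_comp => //; apply: measurableT_comp => //;
    exact: measurable_funM.
apply: measurable_funX; apply: measurable_funB => //.
apply: measurableT_comp => //; apply: measurableT_comp => //.
by apply: measurable_funM => //; exact: measurable_expR.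
Qed.

(** Scaling [y] translates [s]; the factor [y^q] comes out of [exp (- q s)].
*)
Lemma mellin_homogeneous (q : R) m (y : R) : 0 < q -> (0 < m)%N -> 0 <= y ->
  (\int[mu]_s (mellin_kernel q m y s)%:E = (y `^ q)%:E * mellin_constant q m)%E.
Proof.
move=> q0 m0; rewrite le_eqVlt => /predU1P[<-|y0].
  rewrite powR0 ?gt_eqF// mul0e; apply: integral0_eq => s _.
  by rewrite /mellin_kernel mulr0 oppr0 expR0 subrr expr0n gtn_eqF// mulr0.
have y1 : y `^ q * expR (- (q * ln y)) = 1.
  by rewrite /powR gt_eqF// -expRD subrr expR0.
transitivity (\int[mu]_s ((y `^ q)%:E * (mellin_kernel q m 1 (s + ln y))%:E))%E.
  apply: eq_integral => s _; rewrite -EFinM; congr EFin; rewrite /mellin_kernel.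
  rewrite mulrDr opprD !expRD lnK ?posrE// mulr1 [RHS]mulrA.
  by rewrite [_ * expR _]mulrC mulrA [in RHS]y1 mul1r.
rewrite ge0_integralZl; last 4 first.
- exact: measurableT.
- apply/measurable_EFinP; apply: (measurableT_comp (f := mellin_kernel q m 1)).
    exact: measurable_mellin_kernel.
  by apply: measurable_funD.
- by move=> s _; rewrite lee_fin mellin_kernel_ge0.
- by rewrite lee_fin powR_ge0.
rewrite (@integral_translate (mellin_kernel q m 1))//.
  exact: continuous_mellin_kernel.
by move=> s; rewrite mellin_kernel_ge0.
Qed.

Lemma integral_exp_abs (c : R) : 0 < c ->
  (\int[mu]_x (expR (- (c * `|x|)))%:E < +oo)%E.
Proof.
move=> c0.
have mf : measurable_fun setT (fun x : R => expR (- (c * `|x|))).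
  by apply: measurableT_comp => //; apply: measurableT_comp => //;
    apply: measurable_funM => //; exact: normr_measurable.
rewrite ge0_symfun_integralT; last 3 first.
- by move=> x; rewrite expR_ge0.
- move=> x; apply: (@continuous_comp _ _ _ (fun x : R => - (c * `|x|)) expR);
    last exact: continuous_expR.
  by apply: cvgN; apply: cvgM; [exact: cvg_cst|exact: norm_continuous].
- by move=> x; rewrite /= normrN.
have mD : measurable [set x : R | 0 <= x] by rewrite -set_itvcy.
rewrite lte_mul_pinfty//.
rewrite [X in (X < _)%E](_ : _ = \int[mu]_(x in [set x : R | (0 <= x)%R])
    ((c^-1)%:E * (exponential_pdf c x)%:E))%E; last first.
  apply: eq_integral => x; rewrite inE /= => x0; rewrite exponential_pdfE//.
  by rewrite -EFinM mulrA mulVf ?gt_eqF// mul1r ger0_norm// mulNr.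
have mpdf : measurable_fun setT (fun x : R => (exponential_pdf c x)%:E).
  by apply/measurable_EFinP; exact: measurable_exponential_pdf.
have pdf0 (x : R) : (0 <= (exponential_pdf c x)%:E)%E.
  by rewrite lee_fin exponential_pdf_ge0// ltW.
rewrite ge0_integralZl//; last 2 first.
- exact: measurable_funTS.
- by rewrite lee_fin invr_ge0 ltW.
rewrite lte_mul_pinfty ?lee_fin ?invr_ge0 ?(ltW c0)//.
apply: (@le_lt_trans _ _ (\int[mu]_x (exponential_pdf c x)%:E)%E).
  by apply: ge0_subset_integral.
by rewrite integral_exponential_pdf// ltry.
Qed.

(** The kernel decays like [exp ((m - q) s)] at minus infinity and like [exp
(- q s)] at plus infinity. *)
Lemma mellin_constant_fin (q : R) m : 0 < q < m%:R ->
  mellin_constant q m \is a fin_num.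
Proof.
move=> /andP[q0 qm]; rewrite ge0_fin_numE; last first.
  by apply: integral_ge0 => s _; rewrite lee_fin mellin_kernel_ge0.
pose c := Num.min q (m%:R - q).
have c0 : 0 < c by rewrite lt_min q0 subr_gt0.
apply: (le_lt_trans _ (integral_exp_abs c0)).
apply: ge0_le_integral => //.
- by move=> s _; rewrite lee_fin mellin_kernel_ge0.
- by apply/measurable_EFinP; exact: measurable_mellin_kernel.
- apply/measurable_EFinP; apply: measurableT_comp => //.
  apply: measurableT_comp => //; exact: measurable_funM.
move=> s _; rewrite lee_fin /mellin_kernel mulr1.
have u0 : 0 <= 1 - expR (- expR s).
  by rewrite subr_ge0 -[leRHS]expR0 ler_expR oppr_le0 expR_ge0.
have [s0|s0] := leP 0 s.
  rewrite ger0_norm// -[leRHS]mulr1; apply: ler_pM; rewrite ?expR_ge0 ?exprn_ge0//.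
    by rewrite ler_expR lerN2 ler_wpM2r// ge_min lexx.
have u1 : 1 - expR (- expR s) <= expR s.
  have := expR_ge1Dx (- expR s); lra.
apply: (@le_trans _ _ (expR (- (q * s)) * expR s ^+ m)).
  by rewrite ler_wpM2l ?expR_ge0// lerXn2r ?nnegrE ?expR_ge0.
rewrite -expRM_natl -expRD ler_expR ltr0_norm// mulrN opprK.
rewrite -mulNr -mulrDl ler_wnM2r ?(ltW s0)// ge_min [_ + m%:R]addrC lexx.
by rewrite orbT.
Qed.

Lemma mellin_constant_gt0 (q : R) m : (0 < mellin_constant q m)%E.
Proof.
have D01 : measurable (`[0, 1]%classic : set R) by [].
pose a := expR (- (`|q| * 1)) * (1 - expR (- 1)) ^+ m : R.
have a0 : 0 < a.
  by rewrite mulr_gt0 ?expR_gt0// exprn_gt0// subr_gt0 -[ltRHS]expR0 ltr_expR; lra.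
apply: (@lt_le_trans _ _ a%:E); first by rewrite lte_fin.
have -> : (a%:E = \int[mu]_(x in `[0%R, 1%R]) (cst a%:E x))%E.
  rewrite integral_cst//= ; rewrite (@lebesgue_measure_itv R `[0%R, 1%R])/=.
  by rewrite lte_fin ltr01 oppr0 adde0 mule1.
apply: (@le_trans _ _ (\int[mu]_(s in `[0%R, 1%R]) (mellin_kernel q m 1 s)%:E)%E).
  apply: ge0_le_integral => //.
  - by move=> s _; rewrite lee_fin ltW.
  - by apply/measurable_EFinP/measurable_funTS; exact: measurable_mellin_kernel.
  move=> s; rewrite /= in_itv/= => /andP[s0 s1]; rewrite lee_fin /mellin_kernel mulr1.
  apply: ler_pM; rewrite ?expR_ge0//.
  - rewrite ler_expR lerN2; apply: le_trans (ler_norm _) _.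
    by rewrite normrM ler_wpM2l// ger0_norm.
  - apply: lerXn2r; rewrite ?nnegrE ?subr_ge0 -?[leRHS]expR0 ?ler_expR.
    + lra.
    + by rewrite oppr_le0 expR_ge0.
    + by rewrite lerD2l lerN2 ler_expR lerN2 -expR0 ler_expR.
apply: ge0_subset_integral => //.
- by apply/measurable_EFinP; exact: measurable_mellin_kernel.
- by move=> s _; rewrite lee_fin mellin_kernel_ge0.
Qed.

End mellin.

Section laplace_determines_moments.
Context {d d' : measure_display} {T : measurableType d} {T' : measurableType d'}
  {R : realType} (P : probability T R) (P' : probability T' R).
Variables (Y : T -> R) (Y' : T' -> R).
Hypotheses (mY : measurable_fun setT Y) (mY' : measurable_fun setT Y').
Hypotheses (Y_ge0 : forall w, 0 <= Y w) (Y'_ge0 : forall w, 0 <= Y' w).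
Hypothesis laplace_eq : forall l : R, 0 <= l ->
  \int[P]_w expR (- (l * Y w)) = \int[P']_w expR (- (l * Y' w)).

(** Up to sign, the [m]-th difference of step [l] of the exponential [exp (-
mu y)]; its mean is thus a linear combination of values of the Laplace
transform. *)
Definition laplace_diff (l mu : R) (m : nat) (y : R) : R :=
  expR (- (mu * y)) * (1 - expR (- (l * y))) ^+ m.

Lemma laplace_diffS l mu m y : laplace_diff l mu m.+1 y =
  laplace_diff l mu m y - laplace_diff l (mu + l) m y.
Proof. by rewrite /laplace_diff exprS [(mu + l) * y]mulrDl opprD expRD; ring. Qed.

Lemma measurable_laplace_diff l mu m : measurable_fun setT (laplace_diff l mu m).
Proof.
have mexp (c : R) : measurable_fun setT (fun y : R => expR (- (c * y))).
  by apply: measurableT_comp => //; apply: measurableT_comp => //;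
    exact: measurable_funM.
by apply: measurable_funM => //; apply: measurable_funX; exact: measurable_funB.
Qed.

Lemma laplace_diff_bounds (l mu : R) m y : 0 <= l -> 0 <= mu -> 0 <= y ->
  0 <= laplace_diff l mu m y <= 1.
Proof.
move=> l0 mu0 y0.
have e1 (c : R) : 0 <= c -> expR (- (c * y)) <= 1.
  by move=> c0; rewrite -expR0 ler_expR oppr_le0 mulr_ge0.
have h0 : 0 <= 1 - expR (- (l * y)) by rewrite subr_ge0 e1.
apply/andP; split; first by rewrite mulr_ge0 ?expR_ge0 ?exprn_ge0.
by rewrite mulr_ile1 ?expR_ge0 ?exprn_ge0 ?e1// exprn_ile1// gerBl expR_ge0.
Qed.

Lemma laplace_diff_expectation (l mu : R) m : 0 <= l -> 0 <= mu ->
  \int[P]_w laplace_diff l mu m (Y w) = \int[P']_w laplace_diff l mu m (Y' w).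
Proof.
move=> l0; elim: m mu => [|m IH] mu mu0.
  have E0 y : laplace_diff l mu 0 y = expR (- (mu * y)).
    by rewrite /laplace_diff expr0 mulr1.
  under eq_Rintegral do rewrite E0.
  by under [RHS]eq_Rintegral do rewrite E0; exact: laplace_eq.
have norm1 c y : 0 <= c -> 0 <= y -> `|laplace_diff l c m y| <= 1.
  by move=> c0 y0; have /andP[h0 h1] := laplace_diff_bounds m l0 c0 y0; rewrite ger0_norm.
have mul0 : 0 <= mu + l by rewrite addr_ge0.
have ml c : measurable_fun setT (fun w => laplace_diff l c m (Y w)).
  exact: (measurableT_comp (measurable_laplace_diff l c m)).
have ml' c : measurable_fun setT (fun w => laplace_diff l c m (Y' w)).
  exact: (measurableT_comp (measurable_laplace_diff l c m)).
have i c : 0 <= c -> P.-integrable setT (EFin \o (fun w => laplace_diff l c m (Y w))).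
  by move=> c0; apply: (@bounded_integrable _ _ _ _ _ 1) => // w; exact: norm1.
have i' c : 0 <= c -> P'.-integrable setT (EFin \o (fun w => laplace_diff l c m (Y' w))).
  by move=> c0; apply: (@bounded_integrable _ _ _ _ _ 1) => // w; exact: norm1.
under eq_Rintegral do rewrite laplace_diffS.
under [RHS]eq_Rintegral do rewrite laplace_diffS.
by rewrite !RintegralB ?IH//; [exact: i'|exact: i'|exact: i|exact: i].
Qed.

End laplace_determines_moments.

(** Tonelli, applied to the homogeneity of the Mellin kernel. *)
Lemma expectation_mellin_kernel {d : measure_display} {T : measurableType d}
    {R : realType} (P : probability T R) (Y : T -> R) (q : R) m :
  measurable_fun setT Y -> (forall w, 0 <= Y w) -> 0 < q -> (0 < m)%N ->
  (mellin_constant q m * \int[P]_w (Y w `^ q)%:E =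
   \int[lebesgue_measure]_s ((expR (- (q * s)))%:E *
     (\int[P]_w laplace_diff (expR s) 0 m (Y w))%R%:E))%E.
Proof.
move=> mY Y0 q0 m0.
have c0 : (0 <= mellin_constant q m)%E.
  by apply: integral_ge0 => s _; rewrite lee_fin mellin_kernel_ge0.
have mYq : measurable_fun setT (fun w => (Y w `^ q)%:E).
  by apply/measurable_EFinP; apply: (measurableT_comp (measurable_powR q)).
pose k (x : R * T) := (mellin_kernel q m (Y x.2) x.1)%:E.
have mk : measurable_fun setT k.
  apply/measurable_EFinP; apply: measurable_funM.
    apply: measurableT_comp => //; apply: measurableT_comp => //.
    by apply: measurable_funM.
  apply: measurable_funX; apply: measurable_funB => //.
  apply: measurableT_comp => //; apply: measurableT_comp => //.
  by apply: measurable_funM; apply: measurableT_comp.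
have k0 x : (0 <= k x)%E by rewrite lee_fin mellin_kernel_ge0.
transitivity (\int[P]_w \int[lebesgue_measure]_s k (s, w))%E.
  rewrite -ge0_integralZl//; last 1 first.
    by move=> w _; rewrite lee_fin powR_ge0.
  apply: eq_integral => w _; rewrite muleC; apply/esym.
  exact: (mellin_homogeneous q0 m0 (Y0 w)).
transitivity (\int[lebesgue_measure]_s \int[P]_w k (s, w))%E.
  exact/esym/(@fubini_tonelli _ _ _ _ _ (@lebesgue_measure R) P k mk k0).
apply: eq_integral => s _.
have e0 : 0 <= expR s by exact: expR_ge0.
rewrite -(@bounded_RintegralE _ _ _ _ _ 1); last 2 first.
- exact: (measurableT_comp (measurable_laplace_diff _ _ _)).
- move=> w; have /andP[h0 h1] := laplace_diff_bounds m e0 (lexx 0) (Y0 w).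
  by rewrite ger0_norm.
rewrite -ge0_integralZl//; last 2 first.
- by apply/measurable_EFinP; exact: (measurableT_comp (measurable_laplace_diff _ _ _)).
- move=> w _; rewrite lee_fin.
  by have /andP[] := laplace_diff_bounds m e0 (lexx 0) (Y0 w).
apply: eq_integral => w _; rewrite -EFinM /k /mellin_kernel /laplace_diff.
by rewrite mul0r oppr0 expR0 mul1r.
Qed.

(** The moment is a Mellin average of differences of the Laplace transform,
and the constant in front is positive and finite. *)
Theorem laplace_determines_moments {d d' : measure_display}
    {T : measurableType d} {T' : measurableType d'} {R : realType}
    (P : probability T R) (P' : probability T' R) (Y : T -> R) (Y' : T' -> R) (q : R) :
  measurable_fun setT Y -> measurable_fun setT Y' ->
  (forall w, 0 <= Y w) -> (forall w, 0 <= Y' w) -> 0 < q ->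
  (forall l : R, 0 <= l ->
    \int[P]_w expR (- (l * Y w)) = \int[P']_w expR (- (l * Y' w))) ->
  (\int[P]_w (Y w `^ q)%:E = \int[P']_w (Y' w `^ q)%:E)%E.
Proof.
move=> mY mY' Y0 Y'0 q0 E.
pose m := (Num.truncn q).+1.
have qm : 0 < q < m%:R by rewrite q0 truncnS_gt.
have cE : (mellin_constant q m * \int[P]_w (Y w `^ q)%:E =
    mellin_constant q m * \int[P']_w (Y' w `^ q)%:E)%E.
  rewrite !expectation_mellin_kernel//; apply: eq_integral => s _.
  by rewrite (laplace_diff_expectation mY mY' Y0 Y'0 E)// expR_ge0.
have cfin := mellin_constant_fin qm; have cpos := mellin_constant_gt0 q m.
move: cE; rewrite -(fineK cfin); move: cpos; rewrite -(fineK cfin) lte_fin => cpos cE.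
have := congr1 (fun z => (fine (mellin_constant q m))^-1%:E * z)%E cE.
by rewrite !muleA -!EFinM mulVf ?gt_eqF// !mul1e.
Qed.

(** * Necessity of the moment condition *)

Section product_integrals.
Context {d1 d2 : measure_display} {T1 : measurableType d1}
  {T2 : measurableType d2} {R : realType}
  (P1 : probability T1 R) (P2 : probability T2 R).
Local Open Scope ereal_scope.

Lemma integral_product_mul (f : T1 -> R) (g : T2 -> R) :
  measurable_fun setT f -> measurable_fun setT g ->
  (forall x, 0 <= f x)%R -> (forall y, 0 <= g y)%R ->
  \int[P1 \x P2]_z (f z.1 * g z.2)%:E =
  \int[P1]_x (f x)%:E * \int[P2]_y (g y)%:E.
Proof.
move=> mf mg f0 g0.
pose h (z : T1 * T2) := (f z.1 * g z.2)%:E.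
have mh : measurable_fun setT h.
  apply/measurable_EFinP; apply: measurable_funM.
  - exact: (measurableT_comp mf (@measurable_fst _ _ _ _)).
  - exact: (measurableT_comp mg (@measurable_snd _ _ _ _)).
rewrite (fubini_tonelli1 h)//; last by move=> z; rewrite lee_fin mulr_ge0.
have g0' : 0 <= \int[P2]_y (g y)%:E.
  by apply: integral_ge0 => y _; rewrite lee_fin.
rewrite -ge0_integralZr//; last 2 first.
- exact/measurable_EFinP.
- by move=> x _; rewrite lee_fin.
apply: eq_integral => x _; rewrite /fubini_F /h/=.
under eq_integral do rewrite EFinM.
by rewrite ge0_integralZl// ?lee_fin//; [exact/measurable_EFinP|
  move=> y _; rewrite lee_fin].
Qed.

End product_integrals.

(** A non-negative function with a vanishing integral vanishes almost
everywhere; finiteness of the integral of [f] permits the subtraction. *)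
Lemma ae_eq_of_integral_le {d : measure_display} {T : measurableType d}
    {R : realType} (P : probability T R) (f g : T -> R) :
  measurable_fun setT f -> measurable_fun setT g ->
  (forall w, 0 <= f w) -> (forall w, f w <= g w) ->
  (\int[P]_w (f w)%:E < +oo)%E ->
  (\int[P]_w (g w)%:E <= \int[P]_w (f w)%:E)%E -> {ae P, forall w, f w = g w}.
Proof.
move=> mf mg f0 fg ffin gf.
have g0 w : 0 <= g w by exact: le_trans (f0 w) (fg w).
have fi : P.-integrable setT (EFin \o f).
  apply/integrableP; split; first exact/measurable_EFinP.
  by under eq_integral do rewrite /= ger0_norm//.
have gi : P.-integrable setT (EFin \o g).
  apply/integrableP; split; first exact/measurable_EFinP.
  by under eq_integral do rewrite /= ger0_norm//; exact: le_lt_trans gf ffin.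
have D0 : (\int[P]_w `|(g w - f w)%:E| = 0)%E.
  under eq_integral do rewrite gee0_abs ?lee_fin ?subr_ge0// EFinB.
  rewrite integralB_EFin//; apply/eqP; rewrite eq_le sube_le0 gf/=.
  by rewrite sube_ge0 ?(integrable_fin_num _ fi)//; apply: ge0_le_integral => //;
    [by move=> w _; rewrite lee_fin|exact/measurable_EFinP|exact/measurable_EFinP|
     by move=> w _; rewrite lee_fin].
have mD : measurable_fun setT (fun w => (g w - f w)%:E).
  by apply/measurable_EFinP; exact: measurable_funB.
have [+ _] := ae_eq_integral_abs P measurableT mD.
move=> /(_ D0); apply: filterS => w /(_ Logic.I)/= [/eqP].
by rewrite subr_eq0 => /eqP.
Qed.

Section product_marginals.
Context {d1 d2 : measure_display} {T1 : measurableType d1}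
  {T2 : measurableType d2} {R : realType}
  (P1 : probability T1 R) (P2 : probability T2 R).
Local Open Scope ereal_scope.

Lemma integral_product_fst (f : T1 -> R) : measurable_fun setT f ->
  (forall x, 0 <= f x)%R ->
  \int[P1 \x P2]_z (f z.1)%:E = \int[P1]_x (f x)%:E.
Proof.
move=> mf f0.
transitivity (\int[P1 \x P2]_z (f z.1 * cst 1%R z.2)%:E).
  by apply: eq_integral => z _; rewrite mulr1.
rewrite integral_product_mul//=.
by rewrite [X in _ * X]integral_cst//= probability_setT !mule1.
Qed.

Lemma integral_product_snd (g : T2 -> R) : measurable_fun setT g ->
  (forall y, 0 <= g y)%R ->
  \int[P1 \x P2]_z (g z.2)%:E = \int[P2]_y (g y)%:E.
Proof.
move=> mg g0.
transitivity (\int[P1 \x P2]_z (cst 1%R z.1 * g z.2)%:E).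
  by apply: eq_integral => z _; rewrite mul1r.
rewrite integral_product_mul//=.
by rewrite [X in X * _]integral_cst//= probability_setT !mul1e.
Qed.

End product_marginals.

Section moment_necessity.
Context {d d1 : measure_display} {T : measurableType d} {T1 : measurableType d1}
  {R : realType} (P : probability T R) (P1 : probability T1 R).
Variables (LR : nat -> {RV P >-> (R * R)%type}) (I : nat -> {RV P >-> nat})
  (LR0 : {RV P1 >-> (R * R)%type}) (Minf : {RV P >-> R}).
Hypothesis SP : splitting_process LR I LR0.
Hypothesis branching2 : branching LR0 2 = 1%E.
Hypothesis Minf_cvg :
  {ae P, forall w, powsum 2 (leaves_rv LR I n w) @[n --> \oo] --> Minf w}.
Variable p : R.
Hypothesis p_gt2 : 2 < p.
Local Notation psi := (psi Minf).
Let PP : probability (T * T)%type R := (P \x P)%E.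
Let Q : probability (T1 * (T * T))%type R := (P1 \x PP)%E.
Local Notation M := (fun w => `|Minf w|).

Let left_mass (z : T1 * (T * T)) : R := `|(LR0 z.1).1| ^+ 2 * M z.2.1.
Let right_mass (z : T1 * (T * T)) : R := `|(LR0 z.1).2| ^+ 2 * M z.2.2.

Let mM : measurable_fun setT M.
Proof. exact: measurableT_comp. Qed.

Let mL : measurable_fun setT (fun v => `|(LR0 v).1|).
Proof. by apply: measurableT_comp => //; exact: measurable_fst_RV. Qed.

Let mR : measurable_fun setT (fun v => `|(LR0 v).2|).
Proof. by apply: measurableT_comp => //; exact: measurable_snd_RV. Qed.

Let mleft : measurable_fun setT left_mass.
Proof.
apply: measurable_funM.
- apply: measurable_funX; exact: (measurableT_comp mL (@measurable_fst _ _ _ _)).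
- apply: (measurableT_comp mM).
  exact: (measurableT_comp (@measurable_fst _ _ _ _) (@measurable_snd _ _ _ _)).
Qed.

Let mright : measurable_fun setT right_mass.
Proof.
apply: measurable_funM.
- apply: measurable_funX; exact: (measurableT_comp mR (@measurable_fst _ _ _ _)).
- apply: (measurableT_comp mM).
  exact: (measurableT_comp (@measurable_snd _ _ _ _) (@measurable_snd _ _ _ _)).
Qed.

Let left0 z : 0 <= left_mass z. Proof. by rewrite mulr_ge0 ?exprn_ge0. Qed.
Let right0 z : 0 <= right_mass z. Proof. by rewrite mulr_ge0 ?exprn_ge0. Qed.

(** This is [psi = smooth psi psi] with [l = x^2], written as a Laplace
transform on a product space carrying [(L, R)] and two independent copies of
the limit mass. *)
Lemma laplace_fixpoint (l : R) : 0 <= l ->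
  \int[P]_w expR (- (l * M w)) =
  \int[Q]_z expR (- (l * (left_mass z + right_mass z))).
Proof.
move=> l0; pose x := Num.sqrt l; have xl : x ^+ 2 = l by exact: sqr_sqrtr.
have cpsi := contraction_psi SP Minf_cvg.
have e1 (c : R) w : 0 <= c -> `|expR (- (c * M w))| <= 1.
  move=> c0; rewrite ger0_norm ?expR_ge0// -expR0 ler_expR oppr_le0.
  by rewrite mulr_ge0.
have me (c : R) : measurable_fun setT (fun w => expR (- (c * M w))).
  exact: measurable_expR_lin.
have mQ : measurable_fun setT
    (fun z => expR (- (l * (left_mass z + right_mass z)))).
  by apply: measurable_expR_lin; exact: measurable_funD.
transitivity (psi x); first by rewrite /psi xl.
rewrite (psi_fixpoint SP Minf_cvg); apply: EFin_inj.
rewrite -(smoothE LR0 x cpsi cpsi).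
rewrite -(@bounded_RintegralE _ _ _ _ _ 1)//; last first.
  move=> z; rewrite ger0_norm ?expR_ge0// -expR0 ler_expR oppr_le0.
  by rewrite mulr_ge0// addr_ge0.
pose h z := (expR (- (l * (left_mass z + right_mass z))))%:E.
rewrite [RHS](fubini_tonelli1 h)//; last 2 first.
- exact/measurable_EFinP.
- by move=> z; rewrite lee_fin expR_ge0.
apply: eq_integral => v _; rewrite /fubini_F /h /left_mass /right_mass/=.
have E (y : R) : ((psi (y * x))%:E =
    \int[P]_w (expR (- (l * `|y| ^+ 2 * M w)))%:E)%E.
  rewrite (@bounded_RintegralE _ _ _ _ _ 1)//; last first.
    by move=> w; apply: e1; rewrite mulr_ge0 ?exprn_ge0.
  by rewrite /psi exprMn xl real_normK ?num_real// [_ * l]mulrC.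
rewrite EFinM !E -integral_product_mul//.
by apply: eq_integral => z _; rewrite -expRD; congr (expR _)%:E; ring.
Qed.

Let q := p / 2.
Let q_gt1 : 1 < q. Proof. by rewrite ltr_pdivlMr// mul1r. Qed.
Let q_gt0 : 0 < q. Proof. exact: lt_trans q_gt1. Qed.

Lemma moment_fixpoint : (\int[P]_w (M w `^ q)%:E =
  \int[Q]_z ((left_mass z + right_mass z) `^ q)%:E)%E.
Proof.
apply: laplace_determines_moments => //.
- exact: measurable_funD.
- by move=> z; rewrite addr_ge0.
- exact: laplace_fixpoint.
Qed.

Let sqr_powR (x y : R) : 0 <= y -> (`|x| ^+ 2 * y) `^ q = `|x| `^ p * y `^ q.
Proof.
move=> y0; rewrite powRM ?exprn_ge0// -powR_mulrn// -powRrM.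
by rewrite (_ : 2 * q = p)// /q mulrC divfK.
Qed.

(** On the product space [(L, R)] is independent of the two masses, which have
the same moment. *)
Lemma moment_split : (\int[Q]_z (left_mass z `^ q + right_mass z `^ q)%:E =
  branching LR0 p * \int[P]_w (M w `^ q)%:E)%E.
Proof.
have mMq : measurable_fun setT (fun w => M w `^ q).
  exact: (measurableT_comp (measurable_powR q)).
have mLp : measurable_fun setT (fun v => `|(LR0 v).1| `^ p).
  exact: (measurableT_comp (measurable_powR p)).
have mRp : measurable_fun setT (fun v => `|(LR0 v).2| `^ p).
  exact: (measurableT_comp (measurable_powR p)).
have mlq : measurable_fun setT (fun z => (left_mass z `^ q)%:E).
  by apply/measurable_EFinP; exact: (measurableT_comp (measurable_powR q)).
have mrq : measurable_fun setT (fun z => (right_mass z `^ q)%:E).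
  by apply/measurable_EFinP; exact: (measurableT_comp (measurable_powR q)).
under eq_integral do rewrite EFinD.
rewrite ge0_integralD//; last 2 first.
- by move=> z _; rewrite lee_fin powR_ge0.
- by move=> z _; rewrite lee_fin powR_ge0.
rewrite /branching; under [in RHS]eq_integral do rewrite EFinD.
rewrite [X in (X * _)%E]ge0_integralD//; last 2 first.
- exact/measurable_EFinP.
- exact/measurable_EFinP.
rewrite ge0_muleDl; last 2 first.
- by apply: integral_ge0 => v _; rewrite lee_fin powR_ge0.
- by apply: integral_ge0 => v _; rewrite lee_fin powR_ge0.
have E (i : T * T -> T) : measurable_fun setT i ->
    (\int[P \x P]_z (M (i z) `^ q)%:E = \int[P]_w (M w `^ q)%:E)%E ->
    forall f : T1 -> R, measurable_fun setT f ->
    (\int[Q]_z ((`|f z.1| ^+ 2 * M (i z.2)) `^ q)%:E =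
     \int[P1]_v (`|f v| `^ p)%:E * \int[P]_w (M w `^ q)%:E)%E.
  move=> mi Ei f mf; rewrite -Ei -integral_product_mul//.
  - by apply: eq_integral => z _; rewrite sqr_powR.
  - by apply: (measurableT_comp (measurable_powR p)); exact: measurableT_comp.
  - exact: (measurableT_comp mMq mi).
have E1 : (\int[P \x P]_z (M z.1 `^ q)%:E = \int[P]_w (M w `^ q)%:E)%E.
  by apply: (integral_product_fst _ _ mMq) => w; rewrite powR_ge0.
have E2 : (\int[P \x P]_z (M z.2 `^ q)%:E = \int[P]_w (M w `^ q)%:E)%E.
  by apply: (integral_product_snd _ _ mMq) => w; rewrite powR_ge0.
rewrite -(E fst (@measurable_fst _ _ _ _) E1 _ (measurable_fst_RV LR0)).
by rewrite -(E snd (@measurable_snd _ _ _ _) E2 _ (measurable_snd_RV LR0)).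
Qed.

Hypothesis moment_fin : (\int[P]_w (M w `^ q)%:E < +oo)%E.
Hypothesis Minf_neq0 : ~ {ae P, forall w, Minf w = 0}.

Let moment_gt0 : (0 < \int[P]_w (M w `^ q)%:E)%E.
Proof.
rewrite lt0e integral_ge0 ?andbT; last by move=> w _; rewrite lee_fin powR_ge0.
apply/negP => /eqP m0; apply: Minf_neq0.
by apply: (ae_eq0_powR q_gt0) => //; rewrite m0.
Qed.

Let split_le_sum : (\int[Q]_z (left_mass z `^ q + right_mass z `^ q)%:E <=
  \int[Q]_z ((left_mass z + right_mass z) `^ q)%:E)%E.
Proof.
apply: ge0_le_integral => //.
- by move=> z _; rewrite lee_fin addr_ge0 ?powR_ge0.
- apply/measurable_EFinP; apply: measurable_funD.
  + exact: (measurableT_comp (measurable_powR q)).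
  + exact: (measurableT_comp (measurable_powR q)).
- apply/measurable_EFinP; apply: (measurableT_comp (measurable_powR q)).
  exact: measurable_funD.
- by move=> z _; rewrite lee_fin powR_superadditive.
Qed.

(** The moment of a sum dominates the sum of the moments, and a positive
finite moment may be cancelled. *)
Lemma branching_le1 : (branching LR0 p <= 1)%E.
Proof.
have := split_le_sum; rewrite -moment_fixpoint moment_split.
move: moment_gt0 moment_fin => /=; set m := (\int[P]_w _)%E => m0 mfin.
rewrite -[X in (_ <= X)%E -> _]mul1e lee_pmul2r//.
by rewrite ge0_fin_numE// ltW.
Qed.

(** Equality of the integrals makes superadditivity an equality almost
everywhere, so one of the two products vanishes; since the masses are non-zero
with positive probability and independent of [(L, R)], the zero factor is [L]
or [R]. *)
Lemma branching1_LR0 : branching LR0 p = 1%E ->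
  {ae P1, forall v, (LR0 v).1 * (LR0 v).2 = 0}.
Proof.
move=> p1.
have : {ae Q, forall z, left_mass z `^ q + right_mass z `^ q =
    (left_mass z + right_mass z) `^ q}.
  apply: ae_eq_of_integral_le.
  - apply: measurable_funD; exact: (measurableT_comp (measurable_powR q)).
  - apply: (measurableT_comp (measurable_powR q)); exact: measurable_funD.
  - by move=> z; rewrite addr_ge0 ?powR_ge0.
  - by move=> z; exact: powR_superadditive.
  - by rewrite moment_split p1 mul1e.
  - by rewrite moment_split p1 mul1e moment_fixpoint.
move=> H.
have {H} : {ae Q, forall z, left_mass z * right_mass z = 0}.
  apply: filterS H => z zE.
  by apply: (powR_superadditive_eq q_gt1) => //; rewrite zE.
move=> H; pose f v : R := (`|(LR0 v).1| * `|(LR0 v).2|) ^+ 2.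
have mf : measurable_fun setT f by apply: measurable_funX; exact: measurable_funM.
have f0 v : 0 <= f v by rewrite exprn_ge0// mulr_ge0.
have : (\int[Q]_z (f z.1 * (M z.2.1 * M z.2.2))%:E = 0)%E.
  rewrite (ge0_ae_eq_integral (g := cst 0%E))//.
  - exact: integral0.
  - apply/measurable_EFinP; apply: measurable_funM.
      exact: (measurableT_comp mf (@measurable_fst _ _ _ _)).
    by apply: measurable_funM; apply: (measurableT_comp mM);
      [exact: (measurableT_comp (@measurable_fst _ _ _ _) (@measurable_snd _ _ _ _))|
       exact: (measurableT_comp (@measurable_snd _ _ _ _) (@measurable_snd _ _ _ _))].
  - by move=> z _; rewrite lee_fin !mulr_ge0.
  - apply: filterS H => z zE _; congr EFin; rewrite /= -[RHS]zE.
    by rewrite /f /left_mass /right_mass; ring.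
rewrite (integral_product_mul P1 PP (g := fun z => M z.1 * M z.2))//; last first.
  by apply: measurable_funM; apply: (measurableT_comp mM);
    [exact: measurable_fst|exact: measurable_snd].
rewrite (integral_product_mul P P mM mM)//.
have M1 : (\int[P]_w (M w)%:E != 0)%E.
  apply/negP => /eqP m0; apply: Minf_neq0; apply: (@ae_eq0_powR _ _ _ _ _ 1) => //.
  by under eq_integral do rewrite powRr1//; rewrite m0.
move=> /eqP; rewrite !mule_eq0 (negPf M1) !orbF => /eqP fint.
have : {ae P1, forall v, f v = 0}.
  apply: (@ae_eq0_powR _ _ _ _ _ 1) => //.
  by under eq_integral do rewrite powRr1// ger0_norm//; rewrite fint.
apply: filterS => v /eqP; rewrite expf_eq0/= -normrM normr_eq0 => /eqP.
by [].
Qed.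

(** If [E[L^p + R^p] = 1] then [L R = 0], so that [L^s + R^s = (L^2 +
R^2)^(s/2)] for every [s > 0]. The variable [L^2 + R^2] thus has mean one and
a [p/2]-moment equal to one; by the equality case of Bernoulli it is one
almost surely, whence [E[L^g + R^g] = 1]. *)
Theorem branching_lt1 (g a : R) : 0 < g -> branching LR0 g = a%:E -> a < 1 ->
  (branching LR0 p < 1)%E.
Proof.
move=> g0 ga a1; rewrite lt_neqAle branching_le1 andbT; apply/negP => /eqP p1.
have LR_0 := branching1_LR0 p1.
pose A v := `|(LR0 v).1| `^ 2 + `|(LR0 v).2| `^ 2.
have A0 v : 0 <= A v by rewrite addr_ge0 ?powR_ge0.
have mA : measurable_fun setT A by exact: measurable_branching.
(* one of the two coordinates vanishes *)
have Apow (s : R) : 0 < s -> {ae P1, forall v,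
    `|(LR0 v).1| `^ s + `|(LR0 v).2| `^ s = A v `^ (s / 2)}.
  move=> s0; apply: filterS LR_0 => v /eqP; rewrite mulf_eq0 /A.
  have s20 : s / 2 != 0 by rewrite gt_eqF// divr_gt0.
  have s20' : s != 0 by rewrite gt_eqF.
  by case/orP => /eqP ->; rewrite normr0 !powR0 ?pnatr_eq0// ?add0r ?addr0 -powRrM
    [2 * _]mulrC divfK.
have mAs s : measurable_fun setT (fun v => A v `^ s).
  exact: (measurableT_comp (measurable_powR s)).
have Eb (s : R) : 0 < s -> branching LR0 s = (\int[P1]_v (A v `^ (s / 2))%:E)%E.
  move=> s0; apply: ge0_ae_eq_integral => //.
  - by apply/measurable_EFinP; exact: measurable_branching.
  - exact/measurable_EFinP.
  - by move=> v _; rewrite lee_fin powR_ge0.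
  - by apply: filterS (Apow _ s0) => v -> _.
have A1 : {ae P1, forall v, A v = 1}.
  have q0 : 0 <= q by exact: ltW.
  (* Bernoulli holds with equal means, hence with equality *)
  have : {ae P1, forall v, q * A v = A v `^ q + (q - 1)}.
    have EqA : (\int[P1]_v (q * A v)%:E = q%:E)%E.
      under eq_integral do rewrite EFinM.
      rewrite ge0_integralZl//; last 2 first.
      - exact/measurable_EFinP.
      - by move=> v _; rewrite lee_fin.
      by rewrite -[X in (_ * X)%E]/(branching LR0 2) branching2 mule1.
    apply: ae_eq_of_integral_le.
    - exact: measurable_funM.
    - exact: measurable_funD.
    - by move=> v; rewrite mulr_ge0.
    - by move=> v; have := bernoulli_powR (ltW q_gt1) (A0 v); lra.
    - by rewrite EqA ltry.
    rewrite EqA; under eq_integral do rewrite EFinD.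
    rewrite ge0_integralD//; last 3 first.
    - by move=> v _; rewrite lee_fin powR_ge0.
    - exact/measurable_EFinP.
    - by move=> v _; rewrite lee_fin subr_ge0 ltW.
    rewrite -Eb ?p1 ?(lt_trans _ p_gt2)// integral_cst//= probability_setT mule1.
    by rewrite -EFinD addrC subrK.
  apply: filterS => v vE; apply: (bernoulli_powR_eq q_gt1) => //; lra.
have : branching LR0 g = 1%E.
  rewrite (Eb _ g0) (ge0_ae_eq_integral (g := cst 1%E))//.
  - by rewrite integral_cst//= probability_setT mule1.
  - exact/measurable_EFinP.
  - by move=> v _; rewrite lee_fin powR_ge0.
  - by apply: filterS A1 => v -> _; rewrite powR1.
by rewrite ga => -[] a1'; move: a1; rewrite a1' ltxx.
Qed.

End moment_necessity.

(** * Replacing one summand by a Gaussian *)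

Section trigonometric_bounds.
Context {R : realType}.
Implicit Types t u x y : R.

Lemma norm_sin_le t : `|sin t| <= `|t|.
Proof.
wlog t0 : t / 0 <= t => [H|].
  have [/H//|/ltW t0] := leP 0 t.
  by rewrite -(normrN t) -(normrN (sin t)) -sinN; apply: H; rewrite oppr_ge0.
have [c _ E] := @MVT_segment _ sin cos 0 t t0 (fun x _ => is_derive_sin x)
  (continuous_subspaceT (@continuous_sin R)).
by move: E; rewrite sin0 !subr0 => ->; rewrite normrM ler_piMl// cos_max.
Qed.

Lemma cosE_half t : cos t = 1 - 2 * sin (t / 2) ^+ 2.
Proof.
have {1}-> : t = (t / 2) *+ 2 by rewrite -mulr_natr divfK.
by rewrite cos_mulr2n cos2sin2; lra.
Qed.

Lemma cos_ge_parabola t : 1 - t ^+ 2 / 2 <= cos t.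
Proof.
have : sin (t / 2) ^+ 2 <= (t / 2) ^+ 2.
  by rewrite -[leLHS]real_normK ?num_real// -[leRHS]real_normK ?num_real//
    lerXn2r ?nnegrE// norm_sin_le.
by rewrite (cosE_half t); lra.
Qed.

Lemma norm_sin_remainder t : `|sin t - t| <= `|t| ^+ 3 / 2.
Proof.
wlog t0 : t / 0 <= t => [H|].
  have [/H//|/ltW t0] := leP 0 t.
  have := H (- t); rewrite oppr_ge0 sinN opprK normrN => /(_ t0).
  by rewrite addrC distrC.
have D x : is_derive x 1 (fun x : R => sin x - x) (cos x - 1).
  exact: is_deriveB.
have C : continuous (fun x : R => sin x - x).
  by move=> x; apply: cvgB; [exact: continuous_sin|exact: cvg_id].
have [c] := @MVT_segment _ (fun x => sin x - x) (fun x => cos x - 1) 0 t t0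
  (fun x _ => D x) (continuous_subspaceT C).
rewrite in_itv/= => /andP[c0 ct]; rewrite sin0 !subr0 => ->.
rewrite normrM exprS mulrC -mulrA ler_wpM2l// real_normK ?num_real//.
have := cos_ge_parabola c; have := cos_le1 c.
have : c ^+ 2 <= t ^+ 2 by rewrite lerXn2r.
by move=> *; rewrite ler0_norm; lra.
Qed.

Lemma cos_remainder_ge0 t : 0 <= cos t - 1 + t ^+ 2 / 2.
Proof. by have := cos_ge_parabola t; lra. Qed.

Lemma cos_remainder_le t : cos t - 1 + t ^+ 2 / 2 <= t ^+ 4.
Proof.
rewrite (cosE_half t); set u := t / 2.
have -> : t = 2 * u by rewrite mulrC divfK.
have := norm_sin_remainder u; have := norm_sin_le u.
have -> : 1 - 2 * sin u ^+ 2 - 1 + (2 * u) ^+ 2 / 2 =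
  2 * ((u - sin u) * (u + sin u)) by field.
move=> s1 s2; apply: (@le_trans _ _ (2 * (`|u - sin u| * `|u + sin u|))).
  by rewrite ler_wpM2l// -normrM ler_norm.
apply: (@le_trans _ _ (2 * ((`|u| ^+ 3 / 2) * (2 * `|u|)))).
  rewrite ler_wpM2l// ler_pM// ?(distrC u)//.
  by apply: le_trans (ler_normD _ _) _; rewrite mulr2n mulrDl mul1r lerD2l.
have -> : 2 * ((`|u| ^+ 3 / 2) * (2 * `|u|)) = 2 * `|u| ^+ 4 by field.
rewrite exprMn (_ : `|u| ^+ 4 = u ^+ 4); last first.
  by rewrite -normrX ger0_norm// (_ : 4 = 2 * 2)%N// exprM sqr_ge0.
rewrite ler_wpM2r//; last by rewrite (_ : 2 ^+ 4 = 16)//; lra.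
by rewrite (_ : 4 = 2 * 2)%N// exprM sqr_ge0.
Qed.

(** The second-order remainder of the cosine: cubic for small [t], quadratic
for large [t], which is what a finite second moment can integrate. *)
Definition taylor_gap t := t ^+ 2 * Num.min 1 `|t|.

Lemma cos_taylor y t :
  `|cos (y + t) - (cos y - t * sin y - t ^+ 2 / 2 * cos y)| <= 3 * taylor_gap t.
Proof.
have -> : cos (y + t) - (cos y - t * sin y - t ^+ 2 / 2 * cos y) =
  cos y * (cos t - 1 + t ^+ 2 / 2) - sin y * (sin t - t).
  by rewrite cosD; ring.
apply: le_trans (ler_normB _ _) _; rewrite !normrM.
apply: (@le_trans _ _ (`|cos t - 1 + t ^+ 2 / 2| + `|sin t - t|)).
  by rewrite lerD// ler_piMl// ?cos_max ?sin_max.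
rewrite (ger0_norm (cos_remainder_ge0 t)) /taylor_gap.
have s1 := norm_sin_remainder t; have c1 := cos_remainder_le t.
have s2 : `|sin t - t| <= 2 * `|t|.
  apply: le_trans (ler_normB _ _) _.
  by have := norm_sin_le t; lra.
have c2 : cos t - 1 + t ^+ 2 / 2 <= t ^+ 2 / 2 by have := cos_le1 t; lra.
have n0 : 0 <= `|t| by [].
have tn : t ^+ 2 = `|t| ^+ 2 by rewrite real_normK ?num_real.
have tn4 : t ^+ 4 = `|t| ^+ 4 by rewrite (_ : 4 = 2 * 2)%N// !exprM tn.
move: s1 s2 c1 c2 n0; rewrite tn4 tn.
move: `|t| `|sin t - t| (cos t - 1 + _) => n u v s1 s2 c1 c2 n0.
have [n1|n1] := leP 1 n.
  by rewrite mulr1; nra.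
have n3 : n ^+ 2 * n = n ^+ 3 by rewrite -exprSr.
have n4 : n ^+ 4 <= n ^+ 3 by rewrite [n ^+ 4]exprS ler_piMl// ?exprn_ge0// ltW.
by rewrite n3; nra.
Qed.

Lemma expRN_taylor u : 0 <= u -> `|expR (- u) - (1 - u)| <= u ^+ 2.
Proof.
move=> u0; have l := expR_ge1Dx (- u).
rewrite ger0_norm; last by lra.
have e : expR (- u) * (1 + u) <= 1.
  apply: (@le_trans _ _ (expR (- u) * expR u)).
    by rewrite ler_wpM2l ?expR_ge0// expR_ge1Dx.
  by rewrite -expRD addNr expR0.
have : expR (- u) <= 1 by rewrite -expR0 ler_expR oppr_le0.
by have := expR_ge0 (- u); move: (expR (- u)) l e => x; nra.
Qed.

End trigonometric_bounds.

Lemma Rintegral_prob_cst {d : measure_display} {T : measurableType d}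
    {R : realType} (P : probability T R) (c : R) : \int[P]_w c = c.
Proof. by rewrite /Rintegral integral_cst//= probability_setT mule1. Qed.

Lemma norm_Rintegral_le {d : measure_display} {T : measurableType d}
    {R : realType} (P : probability T R) (f : T -> R) (C : R) :
  measurable_fun setT f -> (forall w, `|f w| <= C) -> `|\int[P]_w f w| <= C.
Proof.
move=> mf fC; apply: le_trans (le_normr_Rintegral _ _) _ => //.
  exact: bounded_integrable mf fC.
rewrite -[leRHS](Rintegral_prob_cst P).
apply: (@le_bounded_Rintegral _ _ _ P _ _ C) => //.
- exact: measurableT_comp.
- by move=> w; rewrite normr_id.
- by move=> w; rewrite ger0_norm// (le_trans (normr_ge0 (f w))).
Qed.

Section lindeberg_error.
Context {d : measure_display} {T : measurableType d} {R : realType}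
  (P : probability T R) (X : {RV P >-> R}).
Variable s2 : R.
Hypothesis X_mean : ('E_P[X] = 0)%E.
Hypothesis X_sq : ('E_P[(fun w => X w ^+ 2)%R] = s2%:E)%E.

Let mX2 : measurable_fun setT (fun w => X w ^+ 2).
Proof. exact: measurable_funX. Qed.

Let int_sq : (\int[P]_w (X w ^+ 2)%:E = s2%:E)%E.
Proof. by rewrite -X_sq unlock. Qed.

Lemma variance_ge0 : 0 <= s2.
Proof.
by rewrite -lee_fin -int_sq; apply: integral_ge0 => w _; rewrite lee_fin sqr_ge0.
Qed.

Let X2i : P.-integrable setT (EFin \o (fun w => X w ^+ 2)).
Proof.
apply/integrableP; split; first exact/measurable_EFinP.
under eq_integral do rewrite /= ger0_norm ?sqr_ge0//.
by rewrite int_sq ltry.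
Qed.

Let Xi : P.-integrable setT (EFin \o X).
Proof.
apply: (le_integrable measurableT (g := EFin \o (fun w => 1 + X w ^+ 2))).
- exact/measurable_EFinP.
- move=> w _; rewrite lee_fin [leRHS]ger0_norm ?addr_ge0 ?sqr_ge0//.
  have := sqr_ge0 (`|X w| - 1); rewrite -real_normK ?num_real// real_normK ?num_real//.
  by rewrite sqrrB real_normK ?num_real//; have := normr_ge0 (X w); nra.
- have -> : EFin \o (fun w => 1 + X w ^+ 2) =
      (cst 1%E) \+ (EFin \o (fun w => X w ^+ 2)) by [].
  by apply: integrableD => //; exact: finite_measure_integrable_cst.
Qed.

Let gap (b : R) w : R := X w ^+ 2 * Num.min 1 (b * `|X w|).

Let mgap b : measurable_fun setT (gap b).
Proof.
apply: measurable_funM => //; apply: measurable_minr => //.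
by apply: measurable_funM => //; exact: measurableT_comp.
Qed.

Let gap_bounds (b : R) w : 0 <= b -> 0 <= gap b w <= X w ^+ 2.
Proof.
move=> b0; rewrite /gap mulr_ge0 ?sqr_ge0 ?le_min ?ler01 ?mulr_ge0//=.
by rewrite ler_piMr ?sqr_ge0// ge_min lexx.
Qed.

Let gapi (b : R) : 0 <= b -> P.-integrable setT (EFin \o gap b).
Proof.
move=> b0; apply: (le_integrable measurableT _ _ X2i).
- exact/measurable_EFinP.
- move=> w _; have /andP[g0 g1] := gap_bounds w b0.
  by rewrite lee_fin !ger0_norm// sqr_ge0.
Qed.

Lemma cvg_gap : (\int[P]_w gap (n.+1%:R^-1) w)%R @[n --> \oo] --> (0 : R).
Proof.
have [] := @dominated_convergence _ _ _ P setT measurableT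
  (fun n w => (gap (n.+1%:R^-1) w)%:E) (cst 0%E) (EFin \o (fun w => X w ^+ 2)).
- by move=> n; exact/measurable_EFinP.
- exact: measurable_cst.
- apply: aeW => w _; apply: cvg_EFin; first exact: nearW.
  rewrite /gap -[X in _ --> X](mulr0 (X w ^+ 2)).
  apply: cvgM; first exact: cvg_cst.
  have c0 : n.+1%:R^-1 * `|X w| @[n --> \oo] --> (0 : R).
    by rewrite -[X in _ --> X](mul0r `|X w|); apply: cvgM;
      [exact: cvg_harmonic|exact: cvg_cst].
  apply: (squeeze_cvgr _ (cvg_cst 0) c0); apply: nearW => n.
  by rewrite le_min ler01 mulr_ge0//= ge_min lexx orbT.
- exact: X2i.
- apply: aeW => w n _; have [|] := andP (@gap_bounds n.+1%:R^-1 w _) => // g0 g1.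
  by rewrite lee_fin ger0_norm.
move=> _ _; rewrite integral_cst// mul0e => H.
by apply: fine_cvg.
Qed.

(** The first-order term disappears since [X] is centred, and the second-order
term has mean [s2 b^2 / 2]. *)
Lemma cos_shift_error (y b : R) :
  `|\int[P]_w cos (y + b * X w) - cos y * (1 - s2 * b ^+ 2 / 2)| <=
  3 * b ^+ 2 * \int[P]_w gap `|b| w.
Proof.
have mc : measurable_fun setT (fun w => cos (y + b * X w)).
  apply: (measurableT_comp (continuous_measurable_fun (@continuous_cos R))).
  by apply: measurable_funD => //; exact: measurable_funM.
have ci : P.-integrable setT (EFin \o (fun w => cos (y + b * X w))).
  by apply: (@bounded_integrable _ _ _ P _ 1) => // w; exact: cos_max.
have Xbi : P.-integrable setT (EFin \o (fun w => - (b * sin y) * X w)).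
  exact: (integrableZl measurableT (- (b * sin y)) Xi).
have X2bi : P.-integrable setT (EFin \o (fun w => - (b ^+ 2 / 2 * cos y) * X w ^+ 2)).
  exact: (integrableZl measurableT (- (b ^+ 2 / 2 * cos y)) X2i).
have cyi : P.-integrable setT (EFin \o (fun=> cos y)).
  exact: finite_measure_integrable_cst.
have i2 : P.-integrable setT (EFin \o (fun w => cos y + - (b * sin y) * X w)).
  exact: (integrableD measurableT cyi Xbi).
have i3 : P.-integrable setT (EFin \o (fun w => cos y + - (b * sin y) * X w +
    - (b ^+ 2 / 2 * cos y) * X w ^+ 2)).
  exact: (integrableD measurableT i2 X2bi).
have E : cos y * (1 - s2 * b ^+ 2 / 2) = \int[P]_w (cos y + - (b * sin y) * X w +
    - (b ^+ 2 / 2 * cos y) * X w ^+ 2).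
  rewrite RintegralD// RintegralD// !RintegralZl// Rintegral_prob_cst.
  rewrite (_ : \int[P]_w X w = 0); last first.
    by move: X_mean; rewrite unlock /Rintegral => ->.
  by rewrite (_ : \int[P]_w (X w ^+ 2) = s2) /Rintegral ?int_sq//; ring.
rewrite E -RintegralB//.
apply: le_trans (le_normr_Rintegral _ _) _ => //.
  exact: (integrableB measurableT ci i3).
rewrite -RintegralZl//; last exact: gapi.
apply: le_Rintegral => //.
- have := integrable_norm (integrableB measurableT ci i3).
  by [].
- exact: (integrableZl measurableT (3 * b ^+ 2) (gapi (normr_ge0 b))).
move=> w _.
have -> : 3 * b ^+ 2 * gap `|b| w = 3 * taylor_gap (b * X w).
  by rewrite /gap /taylor_gap normrM exprMn; ring.
have -> : cos y + - (b * sin y) * X w + - (b ^+ 2 / 2 * cos y) * X w ^+ 2 =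
  cos y - (b * X w) * sin y - (b * X w) ^+ 2 / 2 * cos y by field.
exact: cos_taylor.
Qed.

(** For small [b] the Taylor remainder is at most [e b^2] by dominated
convergence. For [|b|] above a threshold the left-hand side is bounded by a
constant, which is a multiple of [|b|^s] there. *)
Lemma lindeberg_error (e s : R) : 0 < e -> 0 < s -> exists K : R, 0 <= K /\
  forall y b, `|\int[P]_w cos (y + b * X w) -
    cos y * expR (- (s2 * b ^+ 2 / 2))| <= e * b ^+ 2 + K * `|b| `^ s.
Proof.
move=> e0 s0; have v0 := variance_ge0.
have e40 : 0 < e / 6 by rewrite divr_gt0.
have /cvgrPdist_lt/(_ _ e40)[N1 _ HN1] := cvg_gap.
pose a := N1.+1%:R^-1 : R; have a0 : 0 < a by rewrite invr_gt0.
have ga : \int[P]_w gap a w <= e / 6.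
  have := HN1 N1 (leqnn _); rewrite sub0r normrN => /ltW.
  exact: le_trans (ler_norm _).
pose c := Num.min a (Num.min 1 (e / (s2 ^+ 2 + 1))).
have q0 : 0 < s2 ^+ 2 + 1 by rewrite ltr_wpDl// sqr_ge0.
have c0 : 0 < c by rewrite !lt_min a0 ltr01 divr_gt0.
have ca : c <= a by rewrite ge_min lexx.
have c1 : c <= 1 by rewrite !ge_min lexx orbT.
have ce : c * (s2 ^+ 2 + 1) <= e.
  by rewrite -ler_pdivlMr// !ge_min lexx !orbT.
exists (2 / c `^ s); split; first by rewrite divr_ge0// powR_ge0.
move=> y b; have [bc|bc] := leP `|b| c; last first.
  apply: (@le_trans _ _ 2).
    apply: le_trans (ler_normB _ _) _; rewrite (_ : 2 = 1 + 1)// lerD//.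
      apply: norm_Rintegral_le => [|w]; last exact: cos_max.
      apply: (measurableT_comp (continuous_measurable_fun (@continuous_cos R))).
      by apply: measurable_funD => //; exact: measurable_funM.
    rewrite normrM -[leRHS]mulr1 ler_pM ?cos_max//.
    by rewrite ger0_norm ?expR_ge0// -[leRHS]expR0 ler_expR oppr_le0 divr_ge0// mulr_ge0// sqr_ge0.
  apply: ler_wpDl; first by rewrite mulr_ge0 ?sqr_ge0// ltW.
  rewrite mulrAC ler_pdivlMr ?powR_gt0// ler_wpM2l//.
  by rewrite ge0_ler_powR ?nnegrE ?(ltW s0) ?(ltW c0) ?(ltW bc).
have b2 : b ^+ 2 = `|b| ^+ 2 by rewrite real_normK ?num_real.
have bn0 : 0 <= `|b| by [].
have h1 := cos_shift_error y b.
have h2 : \int[P]_w gap `|b| w <= e / 6.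
  apply: le_trans ga; apply: le_Rintegral => //; [exact: gapi|exact/gapi/ltW|].
  move=> w _; rewrite ler_wpM2l ?sqr_ge0// le_min ge_min lexx/= ge_min.
  by rewrite (ler_wpM2r _ (le_trans bc ca))// orbT.
have h3 : `|expR (- (s2 * b ^+ 2 / 2)) - (1 - s2 * b ^+ 2 / 2)| <= (s2 * b ^+ 2 / 2) ^+ 2.
  by apply: expRN_taylor; rewrite divr_ge0// mulr_ge0// sqr_ge0.
apply: (@le_trans _ _ (e * b ^+ 2)); last by rewrite lerDl mulr_ge0 ?divr_ge0 ?powR_ge0.
set A := \int[P]_w cos (y + b * X w) in h1 *.
set B := expR _ in h3 *; set D := 1 - _ in h1 h3.
have -> : A - cos y * B = (A - cos y * D) - cos y * (B - D) by ring.
apply: le_trans (ler_normB _ _) _.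
have h4 : `|cos y * (B - D)| <= (s2 * b ^+ 2 / 2) ^+ 2.
  by apply: le_trans h3; rewrite normrM ler_piMl// cos_max.
have h5 : 3 * b ^+ 2 * (\int[P]_w gap `|b| w) <= e / 2 * b ^+ 2.
  have : 3 * b ^+ 2 * (\int[P]_w gap `|b| w) <= 3 * b ^+ 2 * (e / 6).
    by rewrite ler_wpM2l// mulr_ge0// sqr_ge0.
  by move=> /le_trans; apply; rewrite le_eqVlt; apply/orP; left; apply/eqP; field.
have h6 : (s2 * b ^+ 2 / 2) ^+ 2 <= e / 2 * b ^+ 2.
  rewrite (_ : (s2 * b ^+ 2 / 2) ^+ 2 = (s2 ^+ 2 * b ^+ 2 / 4) * b ^+ 2); last by field.
  rewrite ler_wpM2r ?sqr_ge0//.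
  have bb : b ^+ 2 <= c.
    rewrite b2 expr2; apply: (@le_trans _ _ (1 * c)); last by rewrite mul1r.
    by rewrite ler_pM// (le_trans bc).
  have : s2 ^+ 2 * b ^+ 2 <= s2 ^+ 2 * c by rewrite ler_wpM2l// sqr_ge0.
  move: ce; rewrite mulrDr mulr1 [c * _]mulrC.
  by move: (s2 ^+ 2 * c) (s2 ^+ 2 * b ^+ 2) => u v; lra.
by move: h1 h4 h5 h6; lra.
Qed.

End lindeberg_error.

(** * The central limit theorem along the splitting *)

Section bounded_freezing.
Context {d d' d2 : measure_display} {T : measurableType d}
  {S : measurableType d'} {T2 : measurableType d2} {R : realType}
  (P : probability T R) (P2 : probability T2 R).

Lemma Rintegral_freeze (G : set (set T)) (Z : {mfun T >-> S})
    (Z0 : {mfun T2 >-> S}) (h : g_sigma_algebraType G * S -> R) (C : R) :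
  G `<=` measurable ->
  (forall A B, <<s G >> A -> measurable B ->
     P (A `&` Z @^-1` B) = P A * P (Z @^-1` B))%E ->
  eq_in_law P P2 Z Z0 ->
  measurable_fun setT h -> (forall x, `|h x| <= C) ->
  measurable_fun setT (fun w : T => \int[P2]_v h (w, Z0 v)) /\
  \int[P]_w h (w, Z w) = \int[P]_w \int[P2]_v h (w, Z0 v).
Proof.
move=> Gm indZ lawZ mh hC.
have sG A : <<s G >> A -> measurable A.
  by apply: smallest_sub => //; exact: sigma_algebra_measurable.
have mhw w : measurable_fun setT (fun v => h (w, Z0 v)).
  apply: (measurableT_comp (measurableT_comp mh (pair1_measurable w))).
  exact: measurable_funP.
have mhZ : measurable_fun setT (fun w : T => h (w, Z w)).
  move=> _ B mB; rewrite setTI.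
  have midG : measurable_fun setT (id : T -> g_sigma_algebraType G).
    by move=> _ A mA; rewrite setTI; exact: sG.
  have mp : measurable_fun setT (fun w : T => (w : g_sigma_algebraType G, Z w)).
    by apply: measurable_fun_pair => //; exact: measurable_funP.
  by have := measurableT_comp mh mp; move=> /(_ measurableT _ mB); rewrite setTI.
pose h' x := (h x + C)%:E.
have mh' : measurable_fun setT h'.
  by apply/measurable_EFinP; exact: measurable_funD.
have h'0 x : (0 <= h' x)%E.
  by rewrite lee_fin; have := hC x; rewrite ler_norml => /andP[]; lra.
have inner w : (\int[P2]_v h' (w, Z0 v) = (\int[P2]_v h (w, Z0 v) + C)%:E)%E.
  rewrite /h' (@bounded_RintegralE _ _ _ P2 _ (C + C)).
  - rewrite RintegralD// ?Rintegral_prob_cst//.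
    + exact: (@bounded_integrable _ _ _ P2 _ C).
    + exact: finite_measure_integrable_cst.
  - exact: measurable_funD.
  - move=> v; have := hC (w, Z0 v); rewrite !ler_norml => /andP[a b].
    by apply/andP; split; lra.
have m2 : measurable_fun setT (fun w : g_sigma_algebraType G => \int[P2]_v h (w, Z0 v)).
  rewrite (_ : (fun w => _) = (fun w : g_sigma_algebraType G =>
      fine (\int[P2]_v h' (w, Z0 v))%E - C)); last first.
    by apply/funext => w; rewrite inner/= addrK.
  apply: measurable_funB => //; apply: measurableT_comp => //.
  pose k (x : g_sigma_algebraType G * T2) := h' (x.1, Z0 x.2).
  apply: (measurable_fun_fubini_tonelli_F (m2 := P2) k) => /=; last first.
    by move=> x; exact: h'0.
  apply: (measurableT_comp mh'); apply: measurable_fun_pair => //.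
  by apply: measurableT_comp => //; exact: measurable_snd.
have m2T : measurable_fun setT (fun w : T => \int[P2]_v h (w, Z0 v)).
  by move=> _ B mB; apply: sG; have := m2 measurableT _ mB.
split=> //; apply: EFin_inj.
have int_le (w : T) : `|\int[P2]_v h (w, Z0 v)| <= C.
  by apply: norm_Rintegral_le => //.
have := @integral_freeze _ _ _ _ _ _ _ P P2 G Z Z0 h' Gm indZ lawZ mh' h'0.
rewrite (@bounded_RintegralE _ _ _ P _ (C + C)); last 2 first.
- exact: measurable_funD.
- move=> v; have := hC (v, Z v); rewrite !ler_norml => /andP[a b].
  by apply/andP; split; lra.
under eq_integral do rewrite inner.
rewrite (@bounded_RintegralE _ _ _ P _ (C + C)); last 2 first.
- exact: measurable_funD.
- move=> v; have := int_le v; rewrite !ler_norml => /andP[a b].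
  by apply/andP; split; lra.
rewrite !RintegralD ?Rintegral_prob_cst//; last 4 first.
- exact: (@bounded_integrable _ _ _ P _ C).
- exact: finite_measure_integrable_cst.
- exact: (@bounded_integrable _ _ _ P _ C).
- exact: finite_measure_integrable_cst.
by move=> -[/addIr ->].
Qed.

End bounded_freezing.

Lemma norm_Rintegral_le_integral {d : measure_display} {T : measurableType d}
    {R : realType} (P : probability T R) (f g : T -> R) (C : R) :
  measurable_fun setT f -> measurable_fun setT g -> (forall w, `|f w| <= C) ->
  (forall w, `|f w| <= g w) -> ((`|\int[P]_w f w|)%:E <= \int[P]_w (g w)%:E)%E.
Proof.
move=> mf mg fC fg; apply: (@le_trans _ _ (\int[P]_w `|f w|)%:E).
  by rewrite lee_fin le_normr_Rintegral//; exact: bounded_integrable mf fC.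
rewrite -(@bounded_RintegralE _ _ _ P _ C).
- apply: ge0_le_integral => //.
  + by apply/measurable_EFinP; exact: measurableT_comp.
  + exact/measurable_EFinP.
  + by move=> w _; rewrite lee_fin.
- exact: measurableT_comp.
- by move=> w; rewrite normr_id.
Qed.

Section central_limit.
Context {d d0 d1 : measure_display} {T : measurableType d}
  {T0 : measurableType d0} {T1 : measurableType d1} {R : realType}
  (P : probability T R) (P0 : probability T0 R) (P1 : probability T1 R).
Variables (X : nat -> {RV P >-> R}) (X0 : {RV P0 >-> R})
  (LR : nat -> {RV P >-> (R * R)%type}) (I : nat -> {RV P >-> nat})
  (LR0 : {RV P1 >-> (R * R)%type}).

Definition environment : set (set T) :=
  \bigcup_(k in [set k | (0 < k)%N]) (sigma_of (LR k) `|` sigma_of (I k)).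

(** The whole environment is included: the [j]-th summand is replaced while
all the weights are frozen. *)
Definition data_past m : set (set T) :=
  \bigcup_(i in [set i | (0 < i < m)%N]) sigma_of (X i) `|` environment.

Hypothesis SP : splitting_process LR I LR0.
Hypothesis X_law : forall n, (0 < n)%N -> eq_in_law P P0 (X n) X0.
Hypothesis X_past : forall m A B, (0 < m)%N -> <<s data_past m >> A ->
  measurable B -> (P (A `&` X m @^-1` B) = P A * P (X m @^-1` B))%E.
Variable s2 : R.
Hypothesis X0_mean : ('E_P0[X0] = 0)%E.
Hypothesis X0_sq : ('E_P0[(fun w => X0 w ^+ 2)%R] = s2%:E)%E.

Lemma measurable_data_past m : data_past m `<=` measurable.
Proof.
by move=> A [[k _]|[k _ []]]; exact: measurable_sigma_of.
Qed.

Lemma past_environment n : past LR I n `<=` environment.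
Proof. by move=> A [k /= /andP[k0 _] Ak]; exists k. Qed.

Local Notation b := (beta_rv LR I).

Lemma powsumE s n w :
  powsum s (leaves_rv LR I n w) = \sum_(1 <= j < n.+1) `|b n j w| `^ s.
Proof.
by rewrite leaves_rvE /powsum big_map big_add1/= /index_iota subn0.
Qed.

Section hybrid.
Variables (theta xi : R) (n : nat).

Definition partial_phase j w : R :=
  theta + xi * \sum_(1 <= i < j) b n i w * X i w.

Definition partial_damping j w : R :=
  expR (- (s2 * xi ^+ 2 / 2 * \sum_(j <= i < n.+1) b n i w ^+ 2)).

(** The interpolation between [W_n] and its Gaussian counterpart: the first [j
- 1] summands are kept, the others are replaced by the factors that a Gaussian
summand would contribute given the environment. *)
Definition hybrid j : R := \int[P]_w (cos (partial_phase j w) * partial_damping j w).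

Let c_ge0 : 0 <= s2 * xi ^+ 2 / 2.
Proof. by rewrite divr_ge0// mulr_ge0 ?sqr_ge0// (variance_ge0 X0_sq). Qed.

Lemma damping_bounds j w : 0 <= partial_damping j w <= 1.
Proof.
rewrite expR_ge0/= -expR0 ler_expR oppr_le0 mulr_ge0// sumr_ge0// => i _.
exact: sqr_ge0.
Qed.

Section step.
Variable j : nat.
Hypothesis jn : (0 < j < n.+1)%N.
Local Notation G := (data_past j).
Local Notation TG := (g_sigma_algebraType G).

Let mb i : measurable_fun setT (fun w : TG => b n i w).
Proof.
apply: measurable_beta_wrt; apply: subset_trans (@past_environment n) _.
by move=> A eA; apply: sub_sigma_algebra; right.
Qed.

Let mX i : (0 < i < j)%N -> measurable_fun setT (X i : TG -> R).
Proof.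
move=> ij; apply: measurable_wrt => A sA; apply: sub_sigma_algebra; left.
by exists i.
Qed.

Let mphase : measurable_fun setT (partial_phase j : TG -> R).
Proof.
apply: measurable_funD => //; apply: measurable_funM => //.
rewrite (_ : (fun w => _) = (fun w : TG => \sum_(1 <= i < j)
   (if (0 < i < j)%N then b n i w * X i w else 0))); last first.
  by apply/funext => w; apply: eq_big_nat => i ->.
apply: measurable_sum => i; case: (boolP (0 < i < j)%N) => // ij.
by apply: measurable_funM; [exact: mb|exact: mX].
Qed.

Let mdamping k : measurable_fun setT (partial_damping k : TG -> R).
Proof.
apply: measurable_expR_lin; apply: measurable_sum => i.
by apply: measurable_funX; exact: mb.
Qed.

Let GT (f : T -> R) : measurable_fun setT (f : TG -> R) -> measurable_fun setT f.
Proof.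
move=> mf _ B mB; have := mf measurableT _ mB.
by apply: smallest_sub; [exact: sigma_algebra_measurable|exact: measurable_data_past].
Qed.

(** Consecutive hybrids differ in the treatment of [X_j] alone, which is
independent of the environment and of the previous summands, so that it can be
integrated out with the rest frozen. *)
Lemma hybrid_step (e s K : R) :
  (forall y a, `|\int[P0]_v cos (y + a * X0 v) - cos y * expR (- (s2 * a ^+ 2 / 2))|
     <= e * a ^+ 2 + K * `|a| `^ s) ->
  ((`|hybrid j.+1 - hybrid j|)%:E <=
   \int[P]_w (e * (xi * b n j w) ^+ 2 + K * `|xi * b n j w| `^ s)%:E)%E.
Proof.
move=> He; have /andP[j0 jn1] := jn.
have mcosR : measurable_fun setT (@cos R) by exact: continuous_measurable_fun (@continuous_cos R).
(* the integrand as a function of the frozen data and of the value of X_j *)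
pose h (x : TG * R) := cos (partial_phase j x.1 + xi * b n j x.1 * x.2) *
  partial_damping j.+1 x.1.
have m1 (f : TG -> R) : measurable_fun setT f ->
    measurable_fun setT (fun x : TG * R => f x.1).
  by move=> mf; exact: (measurableT_comp mf (@measurable_fst _ _ _ _)).
have mh : measurable_fun setT h.
  apply: measurable_funM; last exact: m1.
  apply: (measurableT_comp mcosR); apply: measurable_funD; first exact: m1.
  apply: measurable_funM; last exact: measurable_snd.
  by apply: (m1 (fun w => xi * b n j w)); exact: measurable_funM.
have h1 x : `|h x| <= 1.
  rewrite normrM mulr_ile1 ?cos_max//.
  by have /andP[d0' d1'] := damping_bounds j.+1 x.1; rewrite ger0_norm.
have [mI EI] := @Rintegral_freeze _ _ _ _ _ _ _ P P0 G (X j) X0 h 1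
  (@measurable_data_past j) (fun A B => @X_past j A B j0) (X_law j0) mh h1.
pose C (w : T) : R := \int[P0]_v cos (partial_phase j w + xi * b n j w * X0 v).
have mc (w : T) : measurable_fun setT
    (fun v => cos (partial_phase j w + xi * b n j w * X0 v)).
  apply: (measurableT_comp mcosR); apply: measurable_funD => //.
  exact: measurable_funM.
have EC w : \int[P0]_v h (w, X0 v) = C w * partial_damping j.+1 w.
  rewrite /h /= RintegralZr//; apply: (@bounded_integrable _ _ _ P0 _ 1) => // v.
  exact: cos_max.
have E1 : hybrid j.+1 = \int[P]_w (C w * partial_damping j.+1 w).
  transitivity (\int[P]_w h (w, X j w)).
    apply: eq_Rintegral => w _; rewrite /h /partial_phase /=.
    by rewrite big_nat_recr//= mulrDr addrA mulrA.
  by rewrite EI; apply: eq_Rintegral => w _; rewrite EC.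
pose E w := cos (partial_phase j w) * expR (- (s2 * (xi * b n j w) ^+ 2 / 2)).
have E2 : hybrid j = \int[P]_w (E w * partial_damping j.+1 w).
  apply: eq_Rintegral => w _; rewrite /E -mulrA -expRD /partial_damping.
  by rewrite [in LHS]big_ltn//; congr (_ * expR _); ring.
have mD := GT (mdamping j.+1).
have mCD : measurable_fun setT (fun w => C w * partial_damping j.+1 w).
  by under eq_fun do rewrite -EC.
have mED : measurable_fun setT (fun w => E w * partial_damping j.+1 w).
  apply: measurable_funM => //; apply: measurable_funM.
    by apply: (measurableT_comp mcosR); exact: GT.
  under eq_fun do rewrite -mulrA; apply: measurable_expR_lin.
  apply: measurable_funM => //; apply: measurable_funX; apply: measurable_funM => //.
  exact: measurable_beta_rv.
have d01 w := damping_bounds j.+1 w.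
have CD1 w : `|C w * partial_damping j.+1 w| <= 1.
  have /andP[a1 a2] := d01 w.
  rewrite normrM mulr_ile1// ?(ger0_norm a1)//.
  by apply: norm_Rintegral_le => // v; exact: cos_max.
have ED1 w : `|E w * partial_damping j.+1 w| <= 1.
  have /andP[a1 a2] := d01 w.
  rewrite normrM mulr_ile1// ?(ger0_norm a1)// normrM mulr_ile1// ?cos_max//.
  rewrite ger0_norm ?expR_ge0// -expR0 ler_expR oppr_le0 divr_ge0// mulr_ge0//.
    exact: variance_ge0 X0_sq.
  exact: sqr_ge0.
rewrite E1 E2 -RintegralB//; last 2 first.
- exact: (@bounded_integrable _ _ _ P _ 1).
- exact: (@bounded_integrable _ _ _ P _ 1).
apply: (@norm_Rintegral_le_integral _ _ _ P _ _ 2).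
- exact: measurable_funB.
- have mxb : measurable_fun setT (fun w => xi * b n j w).
    by apply: measurable_funM => //; exact: measurable_beta_rv.
  apply: measurable_funD; apply: measurable_funM => //; first exact: measurable_funX.
  exact: (measurableT_comp (measurable_abs_powR s)).
- by move=> w; rewrite (_ : 2 = 1 + 1)// (le_trans (ler_normB _ _))// lerD.
- move=> w; rewrite -mulrBl normrM; apply: le_trans (He (partial_phase j w) _).
  by have /andP[a1 a2] := d01 w; rewrite ler_piMr// ger0_norm.
Qed.
End step.

Lemma hybrid_last : hybrid n.+1 = \int[P]_w cos (theta + xi * W X LR I n w).
Proof.
apply: eq_Rintegral => w _.
by rewrite /partial_damping big_geq// mulr0 oppr0 expR0 mulr1.
Qed.

Lemma hybrid_first : hybrid 1 =
  cos theta * \int[P]_w expR (- (s2 * xi ^+ 2 / 2 * powsum 2 (leaves_rv LR I n w))).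
Proof.
have E w : partial_damping 1 w =
    expR (- (s2 * xi ^+ 2 / 2 * powsum 2 (leaves_rv LR I n w))).
  rewrite /partial_damping powsumE; congr expR; congr (- (_ * _)).
  by apply: eq_bigr => i _; rewrite powR_mulrn// real_normK ?num_real.
rewrite -RintegralZl//; last first.
  apply: (@bounded_integrable _ _ _ P _ 1) => [|w].
    apply: measurable_expR_lin; apply: measurable_leaves_rv.
    exact: measurable_powsum.
  by rewrite -E; have /andP[a1 a2] := damping_bounds 1 w; rewrite ger0_norm.
apply: eq_Rintegral => w _.
by rewrite /partial_phase big_geq// mulr0 addr0 E.
Qed.

End hybrid.

(** The sum of the one-step errors is [e xi^2] times the mean mass, which is
one, plus [K |xi|^s] times the mean power sum of order [s]. *)
Lemma clt_error (theta xi e s K a : R) n : (0 < n)%N -> 0 <= e -> 0 <= K ->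
  (forall y a, `|\int[P0]_v cos (y + a * X0 v) - cos y * expR (- (s2 * a ^+ 2 / 2))|
     <= e * a ^+ 2 + K * `|a| `^ s) ->
  branching LR0 2 = 1%E -> branching LR0 s = a%:E ->
  `|\int[P]_w cos (theta + xi * W X LR I n w) -
    cos theta * \int[P]_w expR (- (s2 * xi ^+ 2 / 2 * powsum 2 (leaves_rv LR I n w)))|
  <= e * xi ^+ 2 + K * `|xi| `^ s * mean_powsum LR I s n.
Proof.
move=> n0 e0 K0 He b2 bs.
rewrite -hybrid_first -hybrid_last -(telescope_sumr _ (ltn0Sn n)).
have mps t : measurable_fun setT (fun w => (powsum t (leaves_rv LR I n w))%:E).
  by apply/measurable_EFinP; apply: measurable_leaves_rv; exact: measurable_powsum.
rewrite -lee_fin; apply: (@le_trans _ _ (\sum_(1 <= j < n.+1)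
  (`|hybrid theta xi n j.+1 - hybrid theta xi n j|)%:E)%E).
  by rewrite sumEFin lee_fin ler_norm_sum.
apply: (@le_trans _ _ (\sum_(1 <= j < n.+1)
   \int[P]_w (e * (xi * b n j w) ^+ 2 + K * `|xi * b n j w| `^ s)%:E)%E).
  rewrite !big_nat; apply: lee_sum => j jn; exact: hybrid_step.
rewrite -ge0_integral_sum//; last 2 first.
- move=> j; apply/measurable_EFinP.
  have mxb : measurable_fun setT (fun w => xi * b n j w).
    by apply: measurable_funM => //; exact: measurable_beta_rv.
  apply: measurable_funD; apply: measurable_funM => //; first exact: measurable_funX.
  exact: (measurableT_comp (measurable_abs_powR s)).
- by move=> j w _; rewrite lee_fin addr_ge0// mulr_ge0 ?sqr_ge0 ?powR_ge0.
rewrite (eq_integral (fun w => ((e * xi ^+ 2)%:E * (powsum 2 (leaves_rv LR I n w))%:E +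
  (K * `|xi| `^ s)%:E * (powsum s (leaves_rv LR I n w))%:E)%E)); last first.
  move=> w _; rewrite sumEFin -!EFinM -EFinD; congr EFin.
  rewrite !powsumE !mulr_sumr -big_split/=; apply: eq_bigr => j _.
  rewrite powR_mulrn// real_normK ?num_real// normrM powRM//; ring.
rewrite ge0_integralD//; last 4 first.
- by move=> w _; rewrite -EFinM lee_fin mulr_ge0 ?powsum_ge0// mulr_ge0// sqr_ge0.
- exact: measurable_funeM.
- by move=> w _; rewrite -EFinM lee_fin mulr_ge0 ?powsum_ge0// mulr_ge0// powR_ge0.
- exact: measurable_funeM.
rewrite !ge0_integralZl//; last 4 first.
- by move=> w _; rewrite lee_fin powsum_ge0.
- by rewrite lee_fin mulr_ge0// powR_ge0.
- by move=> w _; rewrite lee_fin powsum_ge0.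
- by rewrite lee_fin mulr_ge0// sqr_ge0.
rewrite (mean_powsumE SP b2)// (mean_powsumE SP bs)// (mean_powsum_const SP b2)//.
by rewrite mule1.
Qed.

Variable Minf : {RV P >-> R}.
Hypothesis Minf_cvg :
  {ae P, forall w, powsum 2 (leaves_rv LR I n w) @[n --> \oo] --> Minf w}.

(** In the error bound [e] is arbitrary, and for fixed [e] the second term
tends to zero with the mean power sum of order [s]. *)
Theorem central_limit (theta xi s a : R) :
  branching LR0 2 = 1%E -> 0 < s -> branching LR0 s = a%:E -> a < 1 ->
  \int[P]_w cos (theta + xi * W X LR I n w) @[n --> \oo] -->
  cos theta * \int[P]_w expR (- (s2 * xi ^+ 2 / 2 * `|Minf w|)).
Proof.
move=> b2 s0 bs a1.
pose v n := cos theta *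
  \int[P]_w expR (- (s2 * xi ^+ 2 / 2 * powsum 2 (leaves_rv LR I n w))).
have cv : v n @[n --> \oo] -->
    cos theta * \int[P]_w expR (- (s2 * xi ^+ 2 / 2 * `|Minf w|)).
  apply: cvgM; first exact: cvg_cst.
  apply: cvg_expectation_exp => //.
  by rewrite divr_ge0// mulr_ge0 ?sqr_ge0// (variance_ge0 X0_sq).
rewrite -[X in _ --> X]add0r.
rewrite (_ : (fun n => _) = (fun n =>
  (\int[P]_w cos (theta + xi * W X LR I n w) - v n) + v n)); last first.
  by apply/funext => n; rewrite subrK.
apply: cvgD => //; apply/cvgrPdist_le => e e0.
have q0 : 0 < 2 * (xi ^+ 2 + 1) by rewrite mulr_gt0// ltr_wpDl// sqr_ge0.
have e10 : 0 < e / (2 * (xi ^+ 2 + 1)) by rewrite divr_gt0.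
have [K [K0 HK]] := lindeberg_error X0_mean X0_sq e10 s0.
pose L := K * `|xi| `^ s.
have L0 : 0 <= L by rewrite mulr_ge0 ?powR_ge0.
have cm : L * mean_powsum LR I s n @[n --> \oo] --> (0 : R).
  rewrite -[X in _ --> X](mulr0 L); apply: cvgM; first exact: cvg_cst.
  exact: cvg_mean_powsum bs a1.
have e20 : 0 < e / 2 by rewrite divr_gt0.
have /cvgrPdist_le/(_ _ e20)[N _ HN] := cm.
exists N.+1 => // n /= Nn; rewrite sub0r normrN.
have n0 : (0 < n)%N by exact: leq_trans Nn.
apply: le_trans (@clt_error theta xi _ s K a n n0 (ltW e10) K0 HK b2 bs) _.
have := HN n (ltnW Nn); rewrite sub0r normrN => /(le_trans (ler_norm _)) h1.
have h2 : e / (2 * (xi ^+ 2 + 1)) * xi ^+ 2 <= e / 2.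
  have q1 : 0 < xi ^+ 2 + 1 by rewrite ltr_wpDl// sqr_ge0.
  have -> : e / (2 * (xi ^+ 2 + 1)) * xi ^+ 2 =
    e / 2 * (xi ^+ 2 / (xi ^+ 2 + 1)) by field; rewrite gt_eqF.
  by rewrite ler_piMr ?(ltW e20)// ler_pdivrMr// mul1r lerDl.
by move: h1 h2; rewrite -/L; lra.
Qed.

End central_limit.

(** * Sampling at an independent random time *)

Section random_index.
Context {d : measure_display} {T : measurableType d} {R : realType}
  (P : probability T R) (nu : R -> {RV P >-> nat}) (G : set (set T)).
Hypothesis nu_law : forall (t : R) n, 0 <= t -> (0 < n)%N ->
  P (nu t @^-1` [set n]) = (expR (- t) * (1 - expR (- t)) ^+ n.-1)%:E.
Hypothesis G_measurable : G `<=` measurable.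
Hypothesis nu_indep : forall (t : R) A B, 0 <= t -> <<s G >> A ->
  (P (A `&` nu t @^-1` B) = P A * P (nu t @^-1` B))%E.

Let mnu t (B : set nat) : measurable (nu t @^-1` B).
Proof. by rewrite -[_ @^-1` _]setTI; exact: measurable_funP. Qed.

(** The event has probability [1 - (1 - exp (- t))^N], a geometric tail. *)
Lemma index_tail (t : R) (N : nat) : 0 < t ->
  (P (nu t @^-1` [set n | (n < N.+1)%N]) <= (1 - (1 - expR (- t)) ^+ N)%:E)%E.
Proof.
move=> t0; set q := 1 - expR (- t).
have et : expR (- t) = 1 - q by rewrite /q opprB addrC subrK.
have q0 : 0 <= q by rewrite subr_ge0 -expR0 ler_expR oppr_le0 ltW.
have q1 : q < 1 by rewrite gtrBl expR_gt0.
set A := nu t @^-1` _; have mA : measurable A by exact: mnu.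
have PA : P A \is a fin_num by exact: fin_num_measure.
suff H M : fine (P A) <= 1 - q ^+ N + q ^+ M.
  rewrite -(fineK PA) lee_fin; apply/ler_addgt0Pr => e e0.
  have /cvgrPdist_lt/(_ _ e0)[M _ HM] : q ^+ M @[M --> \oo] --> (0 : R).
    by apply: cvg_expr; rewrite ger0_norm.
  apply: le_trans (H M) _; rewrite lerD2l.
  have := HM M (leqnn _); rewrite sub0r normrN => /ltW.
  exact: le_trans (ler_norm _).
pose B := \big[setU/set0]_(k < M) (nu t @^-1` [set (N + k).+1]).
have mB : measurable B by apply: bigsetU_measurable => k _; exact: mnu.
have PB : P B = (q ^+ N * (1 - q ^+ M))%:E.
  rewrite /B measure_semi_additive_ord//; last first.
    by move=> i j _ _ [w [/= -> [/addnI/ord_inj]]].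
  rewrite (eq_bigr (fun k : 'I_M => (q ^+ N * ((1 - q) * q ^+ k))%:E)); last first.
    move=> k _; apply: etrans (nu_law (ltW t0) (ltn0Sn (N + k))) _.
    by rewrite /= -/q et exprD; congr EFin; ring.
  rewrite sumEFin -mulr_sumr -mulr_sumr; congr (_ * _)%:E.
  by have := subrX1 q M; lra.
have : (P A + P B <= 1)%E.
  rewrite -measureU//.
    by apply: probability_le1; exact: measurableU.
  apply/seteqP; split => // w [/= Aw]; rewrite /B -(bigcup_mkord M
    (fun k => nu t @^-1` [set (N + k).+1])) => -[k /= _ E].
  by move: Aw; rewrite /A /= E; lia.
rewrite PB -(fineK PA) -EFinD lee_fin.
have : q ^+ N * q ^+ M <= q ^+ M.
  by rewrite ler_piMl ?exprn_ge0// exprn_ile1// ltW.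
by lra.
Qed.

Lemma cvg_index (N : nat) :
  fine (P (nu t @^-1` [set n | (n < N.+1)%N])) @[t --> +oo] --> (0 : R).
Proof.
have c : 1 - (1 - expR (- t)) ^+ N @[t --> +oo] --> (0 : R).
  rewrite -[X in _ --> X](subrr (1 : R)); apply: cvgB; first exact: cvg_cst.
  rewrite -[X in _ --> X](expr1n R N).
  have c1 : 1 - expR (- t) @[t --> +oo] --> (1 : R).
    rewrite -[X in _ --> X]subr0; apply: cvgB; first exact: cvg_cst.
    exact: cvgr_expR.
  apply: (cvg_comp (fun t => 1 - expR (- t)) (fun x => x ^+ N) c1).
  exact: exprn_continuous.
apply: (squeeze_cvgr _ (cvg_cst 0) c); near=> t.
have t0 : 0 < t by near: t; exact: nbhs_pinfty_gt.
rewrite fine_ge0//= -lee_fin fineK ?index_tail//.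
exact/fin_num_measure/mnu.
Unshelve. all: by end_near. Qed.

Variable f : nat -> T -> R.
Hypothesis mf : forall n, measurable_fun setT (f n : g_sigma_algebraType G -> R).
Hypothesis f1 : forall n w, `|f n w| <= 1.

Let mfT n : measurable_fun setT (f n).
Proof.
move=> _ B mB; have := mf n measurableT mB.
by apply: smallest_sub; [exact: sigma_algebra_measurable|exact: G_measurable].
Qed.

(** By independence the index may be frozen. *)
Lemma random_index_expectation (t : R) : 0 <= t ->
  \int[P]_w f (nu t w) w = \int[P]_w \int[P]_v f (nu t w) v.
Proof.
move=> t0.
have sG A : <<s G >> A -> measurable A.
  by apply: smallest_sub => //; exact: sigma_algebra_measurable.
pose idG : T -> g_sigma_algebraType G := fun w => w.
have midG : measurable_fun setT idG by move=> _ A mA; rewrite setTI; exact: sG.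
pose idG' : {mfun T >-> g_sigma_algebraType G} :=
  HB.pack idG (isMeasurableFun.Build _ _ _ _ idG midG).
pose N := sigma_of (nu t).
have sigmaN A : <<s N >> A -> exists B, A = nu t @^-1` B.
  suff : <<s N >> `<=` [set A | exists B, A = nu t @^-1` B] by exact.
  apply: smallest_sub.
  - split => //.
    + by exists set0; rewrite preimage_set0.
    + by move=> _ [B ->]; exists (~` B); rewrite setTD preimage_setC.
    + move=> F HF; have [B HB] := choice HF.
      exists (\bigcup_k B k); rewrite preimage_bigcup.
      by apply: eq_bigcupr => k _; rewrite HB.
  - by move=> _ [B _ <-]; exists B; rewrite setTI.
have mN : measurable_fun setT (nu t : g_sigma_algebraType N -> nat).
  by apply: measurable_wrt; exact: sub_sigma_algebra.
pose h (x : g_sigma_algebraType N * g_sigma_algebraType G) := f (nu t x.1) x.2.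
have mh : measurable_fun setT h.
  move=> _ B mB; rewrite setTI.
  rewrite (_ : h @^-1` B = \bigcup_n ((nu t @^-1` [set n]) `*` (f n @^-1` B))).
    apply: bigcup_measurable => n _; apply: measurableX.
      by rewrite -[_ @^-1` _]setTI; exact: mN.
    by rewrite -[_ @^-1` _]setTI; exact: mf.
  apply/seteqP; split => [[w v] /= Bwv|[w v] [n _ [/= <-]]//].
  by exists (nu t w).
have indep A B : <<s N >> A -> measurable B ->
    (P (A `&` idG' @^-1` B) = P A * P (idG' @^-1` B))%E.
  by move=> /sigmaN[C ->] mB; rewrite setIC nu_indep// muleC.
have h1 x : `|h x| <= 1 by exact: f1.
have law : eq_in_law P P idG' idG' by [].
have NT : N `<=` measurable by exact: measurable_sigma_of.
have [_ E] := @Rintegral_freeze _ _ _ _ _ _ _ P P N idG' idG' h 1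
  NT indep law mh h1.
exact: E.
Qed.

(** The index leaves every bounded set with probability tending to one; on the
complement the means are close to their limit, elsewhere they are bounded. *)
Theorem cvg_random_index (l : R) : \int[P]_w f n w @[n --> \oo] --> l ->
  \int[P]_w f (nu t w) w @[t --> +oo] --> l.
Proof.
move=> fl; pose u n := \int[P]_w f n w.
have u1 n : `|u n| <= 1 by exact: norm_Rintegral_le.
have l1 : `|l| <= 1.
  rewrite -(cvg_lim _ (cvg_norm fl))//; apply: limr_le; first exact: cvgP (cvg_norm fl).
  exact: nearW.
apply/cvgrPdist_le => e e0; have {}e0 : 0 < (e : R) by [].
have e20 : 0 < e / 2 by rewrite divr_gt0.
have /cvgrPdist_le/(_ _ e20)[N _ HN] := fl.
have e40 : 0 < e / 4 by rewrite divr_gt0.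
have /cvgrPdist_le/(_ _ e40) HA := cvg_index N.
near=> t.
have tA : `|0 - fine (P (nu t @^-1` [set n | (n < N.+1)%N]))| <= e / 4.
  by near: t; exact: HA.
have t0 : 0 <= t by near: t; exact: nbhs_pinfty_ge.
rewrite random_index_expectation// distrC.
pose A := nu t @^-1` [set n | (n < N.+1)%N].
have mu : measurable_fun setT (fun w => u (nu t w)).
  by apply: (@measurableT_comp _ _ _ _ _ _ u) => //; exact: measurable_funP.
have bnd w : `|u (nu t w) - l| <= e / 2 + 2 * \1_A w.
  have [Nn|nN] := leqP N.+1 (nu t w).
    rewrite -[leLHS]addr0 lerD// ?mulr_ge0// distrC; apply: HN => /=; exact: ltnW.
  rewrite indicE mem_set//= mulr1 -[leLHS]add0r lerD ?(ltW e20)//.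
  by rewrite (le_trans (ler_normB _ _))// (_ : 2 = 1 + 1)// lerD.
have -> : \int[P]_w (u (nu t w)) - l = \int[P]_w (u (nu t w) - l).
  rewrite RintegralB// ?Rintegral_prob_cst//.
  - exact: (@bounded_integrable _ _ _ P _ 1).
  - exact: finite_measure_integrable_cst.
have mA : measurable A by exact: mnu.
have PA : P A \is a fin_num by exact: fin_num_measure.
rewrite -lee_fin; apply: (@le_trans _ _ (\int[P]_w (e / 2 + 2 * \1_A w)%:E)%E).
  apply: (@norm_Rintegral_le_integral _ _ _ P _ _ 2) => //.
  - exact: measurable_funB.
  - by apply: measurable_funD => //; apply: measurable_funM => //; exact: measurable_indic.
  - by move=> w; rewrite (le_trans (ler_normB _ _))// (_ : 2 = 1 + 1)// lerD.
have m1A : measurable_fun setT (fun w => (\1_A w : R)%:E).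
  by apply/measurable_EFinP; exact: measurable_indic.
have m2A : measurable_fun setT (fun w => (2 * (\1_A w : R))%:E).
  by apply/measurable_EFinP; apply: measurable_funM => //; exact: measurable_indic.
have e2 : (0 <= (e / 2)%:E)%E by rewrite lee_fin ltW.
have A2 w : (0 <= (2 * (\1_A w : R))%:E)%E by rewrite lee_fin mulr_ge0.
under eq_integral do rewrite EFinD.
rewrite ge0_integralD//.
under [X in (_ + X)%E]eq_integral do rewrite EFinM.
rewrite integral_cst//= probability_setT mule1 ge0_integralZl//.
have -> : (\int[P]_w (\1_A w : R)%:E = (fine (P A))%:E)%E.
  by rewrite integral_indic// setIT fineK.
rewrite -EFinM -EFinD lee_fin.
have : fine (P A) <= e / 4.
  by move: tA; rewrite sub0r normrN; apply: le_trans; exact: ler_norm.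
by lra.
Unshelve. all: by end_near. Qed.

End random_index.

(** * Gaussian integrals *)

Section density.
Context {d : measure_display} {T : measurableType d} {R : realType}
  (mu nu : {measure set T -> \bar R}) (p : T -> R).
Hypothesis mp : measurable_fun setT p.
Hypothesis p_ge0 : forall x, 0 <= p x.
Hypothesis nuE : forall A, measurable A -> nu A = (\int[mu]_(x in A) (p x)%:E)%E.
Local Open Scope ereal_scope.
Import HBNNSimple.

Let mpE : measurable_fun setT (EFin \o p).
Proof. exact/measurable_EFinP. Qed.

Let integral_density_indic A : measurable A ->
  \int[nu]_x (\1_A x)%:E = \int[mu]_x ((\1_A x)%:E * (p x)%:E).
Proof.
move=> mA; rewrite integral_indic// setIT nuE// integral_mkcond/=.
apply: eq_integral => x _; rewrite patchE indicE.
by case: ifPn => xA; rewrite ?mul1e ?mul0e.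
Qed.

Let integral_density_nnsfun (f : {nnsfun T >-> R}) :
  \int[nu]_x (f x)%:E = \int[mu]_x ((f x)%:E * (p x)%:E).
Proof.
under [LHS]eq_integral do rewrite fimfunE -fsumEFin//.
rewrite [LHS]ge0_integral_fsum//; last 2 first.
  - by move=> r; exact/measurable_EFinP/measurableT_comp.
  - by move=> n x _; rewrite EFinM nnfun_muleindic_ge0.
under [RHS]eq_integral.
  move=> x xD; rewrite fimfunE -fsumEFin// ge0_mule_fsuml; last first.
    by move=> r; rewrite EFinM nnfun_muleindic_ge0.
  over.
rewrite [RHS]ge0_integral_fsum//; last 2 first.
  - move=> r; apply: emeasurable_funM => //.
    by apply/measurable_EFinP; do 2 apply/measurableT_comp => //.
  - by move=> n x _; apply: mule_ge0; last (by rewrite lee_fin);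
      rewrite EFinM nnfun_muleindic_ge0.
apply: eq_fsbigr => r; rewrite inE /= => -[y _ ry].
have r0 : (0 <= r)%R by rewrite -ry.
have mI : measurable (f @^-1` [set r]) by exact: measurable_funPTI.
under eq_integral do rewrite EFinM.
rewrite ge0_integralZl//; last by apply/measurable_EFinP; exact: measurable_indic.
under [RHS]eq_integral do rewrite EFinM -muleA.
rewrite [RHS]ge0_integralZl//; last 2 first.
  - apply: emeasurable_funM => //.
    by apply/measurable_EFinP; exact: measurable_indic.
  - by move=> x _; rewrite mule_ge0 ?lee_fin.
by rewrite integral_density_indic.
Qed.

(** Monotone convergence, from simple functions. *)
Lemma integral_density (f : T -> \bar R) : measurable_fun setT f ->
  (forall x, 0 <= f x) -> \int[nu]_x f x = \int[mu]_x (f x * (p x)%:E).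
Proof.
move=> mf f0; pose f_ := nnsfun_approx measurableT mf.
transitivity (lim (\int[nu]_x (f_ n x)%:E @[n --> \oo])).
  rewrite -monotone_convergence//=.
  - apply: eq_integral => ? /[!inE] xD; apply/esym/cvg_lim => //=.
    exact: cvg_nnsfun_approx.
  - by move=> n; exact/measurable_EFinP/measurable_funTS.
  - by move=> n ? _; rewrite lee_fin.
  - by move=> ? _ ? ? mn; rewrite lee_fin; exact/lefP/nd_nnsfun_approx.
transitivity (lim (\int[mu]_x ((f_ n x)%:E * (p x)%:E) @[n --> \oo])).
  by congr (limn _); apply/funext => n; exact: integral_density_nnsfun.
rewrite -monotone_convergence//=.
- apply: eq_integral => x _; apply/cvg_lim => //=.
  by apply: cvgeZr => //; exact: cvg_nnsfun_approx.
- by move=> n; apply: emeasurable_funM => //; exact/measurable_EFinP.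
- by move=> n x _; rewrite mule_ge0 ?lee_fin.
- move=> x _ m n mn; rewrite lee_pmul ?lee_fin//.
  exact/lefP/nd_nnsfun_approx.
Qed.

End density.

(** A quadratic remainder is the form in which differentiation under the
integral sign is easiest to justify. *)
Lemma is_derive_quadratic {R : realType} (f : R -> R) (x l M : R) :
  (forall h, `|f (x + h) - f x - h * l| <= M * h ^+ 2) -> is_derive x 1 f l.
Proof.
move=> H; have M0 : 0 <= M.
  by have := H 1; rewrite expr1n mulr1; apply: le_trans.
have c : h^-1 *: ((f \o shift x) (h *: 1) - f x) @[h --> (0 : R)^'] --> l.
  apply/cvgrPdist_le => e e0; near=> h.
  have h0 : h != 0 by near: h; exact: nbhs_dnbhs_neq.
  have hM : `|h| <= e / (M + 1).
    near: h; apply: dnbhs0_le; rewrite divr_gt0// ltr_wpDl//.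
  rewrite /= /shift/= [h *: 1]mulr1 addrC [h + x]addrC.
  have -> : - (h^-1 *: (f (x + h) - f x)) + l =
    - (h^-1 * (f (x + h) - f x - h * l)).
    by rewrite mulrBr mulrA mulVf// mul1r opprB addrC.
  rewrite normrN normrM normfV ler_pdivrMl ?normr_gt0//.
  apply: le_trans (H h) _; rewrite -real_normK ?num_real// expr2 mulrA mulrC.
  rewrite ler_wpM2l//; apply: (@le_trans _ _ (M * (e / (M + 1)))).
    by rewrite ler_wpM2l.
  by rewrite mulrCA ler_piMr ?(ltW e0)// ler_pdivrMr ?ltr_wpDl// mul1r lerDl.
by split; [exact: cvgP c|exact: cvg_lim c].
Unshelve. all: by end_near. Qed.

Lemma cvg_Rintegral_itv {R : realType} (k : R -> R) : (@lebesgue_measure R).-integrable setT (EFin \o k) ->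
  (\int[(@lebesgue_measure R)]_(z in `[- n%:R, n%:R]) k z)%R @[n --> \oo] --> (\int[(@lebesgue_measure R)]_z k z)%R.
Proof.
move=> ki; have mk : measurable_fun setT k by apply/measurable_EFinP; exact: measurable_int ki.
have [] := @dominated_convergence _ _ _ (@lebesgue_measure R) setT measurableT
  (fun n z => ((k \_ `[- n%:R, n%:R]) z)%:E) (EFin \o k) (fun z => (`|k z|)%:E).
- move=> n; apply/measurable_EFinP.
  by apply/(measurable_restrictT k) => //; exact: measurable_funTS.
- exact/measurable_EFinP.
- apply: aeW => z _; apply: cvg_near_cst; near=> n.
  rewrite patchE mem_set//; rewrite /= in_itv/= -ler_norml.
  by near: n; exact: nbhs_infty_ger.
- exact: integrable_norm ki.
- apply: aeW => z n _; rewrite lee_fin patchE; case: ifP => // _.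
  by rewrite normr0.
move=> _ _ H.
have E (n : nat) : (\int[(@lebesgue_measure R)]_z ((k \_ `[- n%:R, n%:R]) z)%:E =
    \int[(@lebesgue_measure R)]_(z in `[(- n%:R)%R, (n%:R)%R]) (k z)%:E)%E.
  by rewrite [RHS]integral_mkcond/=; apply: eq_integral => z _; rewrite !patchE; case: ifP.
rewrite /Rintegral; apply: fine_cvg; rewrite fineK//; last exact: integrable_fin_num.
by under eq_cvg do rewrite -E; exact: H.
Unshelve. all: by end_near. Qed.

Section gaussian.
Context {R : realType}.
Variable s : R.
Hypothesis s_neq0 : s != 0.
Local Notation mu := (@lebesgue_measure R).
Local Notation pdf := (normal_pdf (0 : R) s).
Local Notation N := (normal_prob (0 : R) s).

Let pdfE z : pdf z = normal_peak s * expR (- (z ^+ 2 / (2 * s ^+ 2))).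
Proof.
rewrite normal_pdfE// -[LHS]/(normal_peak s * normal_fun 0 s z) /normal_fun subr0 mulNr; congr (_ * expR (- (_ / _))).
by rewrite mulr2n mulrDl mul1r.
Qed.

Let s2_gt0 : 0 < s ^+ 2. Proof. by rewrite exprn_even_gt0. Qed.

Let mpdf : measurable_fun setT pdf. Proof. exact: measurable_normal_pdf. Qed.

Lemma integral_normal_prob (f : R -> \bar R) : measurable_fun setT f ->
  (forall x, 0 <= f x)%E -> (\int[N]_x f x = \int[mu]_x (f x * (pdf x)%:E))%E.
Proof.
move=> mf f0; exact: (@integral_density _ (measurableTypeR R) R mu N pdf mpdf
  (normal_pdf_ge0 0 s) (fun A _ => erefl) f mf f0).
Qed.

Lemma powR_le_expR (p x : R) : 0 < p -> 0 <= x -> x `^ p <= expR (p * x).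
Proof.
move=> p0; rewrite le_eqVlt => /predU1P[<-|x0].
  by rewrite powR0 ?expR_ge0// gt_eqF.
rewrite /powR gt_eqF// ler_expR ler_wpM2l ?(ltW p0)//.
rewrite -ler_expR lnK ?posrE//; apply: le_trans (expR_ge1Dx x).
by rewrite lerDr.
Qed.

Lemma gaussian_moment_bound (p : R) : 0 < p -> exists2 C : R, 0 <= C &
  forall z, `|z| `^ p * pdf z <= C * expR (- (1 * `|z|)).
Proof.
move=> p0; exists (normal_peak s * expR ((p + 1) ^+ 2 * s ^+ 2 / 2)).
  by rewrite mulr_ge0 ?expR_ge0// normal_peak_ge0.
move=> z; rewrite pdfE [leLHS]mulrCA -[leRHS]mulrA.
rewrite ler_wpM2l ?normal_peak_ge0//.
apply: (@le_trans _ _ (expR (p * `|z|) * expR (- (z ^+ 2 / (2 * s ^+ 2))))).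
  by rewrite ler_wpM2r ?expR_ge0// powR_le_expR.
rewrite -!expRD ler_expR mul1r -lerBrDr -lerBlDl.
have -> : z ^+ 2 / (2 * s ^+ 2) = `|z| ^+ 2 / (2 * s ^+ 2).
  by rewrite real_normK ?num_real.
move: `|z| => x; rewrite -subr_ge0.
have -> : forall A, A = (x / s - (p + 1) * s) ^+ 2 / 2 -> 0 <= A.
  by move=> A ->; rewrite divr_ge0// sqr_ge0.
  by [].
field; exact: s_neq0.
Qed.

Lemma integrable_moment (p : R) : 0 < p ->
  mu.-integrable setT (EFin \o (fun z => `|z| `^ p * pdf z)).
Proof.
move=> p0; have [C C0 HC] := gaussian_moment_bound p0.
have m1 : measurable_fun setT (fun z : R => `|z| `^ p * pdf z).
  by apply: measurable_funM => //; exact: measurable_abs_powR.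
apply/integrableP; split; first exact/measurable_EFinP.
have p1 (z : R) : 0 <= `|z| `^ p * pdf z by rewrite mulr_ge0 ?powR_ge0 ?normal_pdf_ge0.
apply: (@le_lt_trans _ _ (\int[mu]_z (C%:E * (expR (- (1 * `|z|)))%:E))%E).
  apply: ge0_le_integral => //.
  - by apply/measurable_EFinP; exact: measurableT_comp.
  - by apply: measurable_funeM; apply/measurable_EFinP; exact: measurable_expR_lin.
  - by move=> z _; rewrite -EFinM lee_fin ger0_norm.
rewrite ge0_integralZl//; last first.
  by apply/measurable_EFinP; exact: measurable_expR_lin.
by rewrite lte_mul_pinfty// integral_exp_abs.
Qed.

Lemma gaussian_moment_fin (p : R) : 0 < p -> (\int[N]_z (`|z| `^ p)%:E < +oo)%E.
Proof.
move=> p0; rewrite integral_normal_prob; last 2 first.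
- by apply/measurable_EFinP; exact: measurable_abs_powR.
- by move=> z; rewrite lee_fin powR_ge0.
have /integrableP[_] := integrable_moment p0.
under eq_integral.
  move=> z _; rewrite /= ger0_norm; last by rewrite mulr_ge0 ?powR_ge0 ?normal_pdf_ge0.
  over.
by under eq_integral do rewrite EFinM.
Qed.

End gaussian.

Lemma abs_powR2 {R : realType} (x : R) : `|x| `^ 2 = x ^+ 2.
Proof. by rewrite powR_mulrn// real_normK ?num_real. Qed.

Section gaussian_charfun.
Context {R : realType}.
Variables s theta : R.
Hypothesis s_neq0 : s != 0.
Local Notation mu := (@lebesgue_measure R).
Local Notation pdf := (normal_pdf (0 : R) s).
Local Notation N := (normal_prob (0 : R) s).

Let pdfE : pdf = fun z => normal_peak s * expR (- (z ^+ 2 / (2 * s ^+ 2))).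
Proof.
apply/funext => z.
rewrite normal_pdfE// -[LHS]/(normal_peak s * normal_fun 0 s z) /normal_fun subr0.
by rewrite mulNr; congr (_ * expR (- (_ / _))); rewrite mulr2n mulrDl mul1r.
Qed.

Let mpdf : measurable_fun setT pdf. Proof. exact: measurable_normal_pdf. Qed.
Let pdf0 z : 0 <= pdf z. Proof. exact: normal_pdf_ge0. Qed.
Let mcosR : measurable_fun setT (@cos R).
Proof. exact: continuous_measurable_fun (@continuous_cos R). Qed.
Let msinR : measurable_fun setT (@sin R).
Proof. exact: continuous_measurable_fun (@continuous_sin R). Qed.

Let mcos (xi : R) : measurable_fun setT (fun z : R => cos (theta + xi * z)).
Proof.
by apply: (measurableT_comp mcosR); apply: measurable_funD => //; exact: measurable_funM.
Qed.
Let msin (xi : R) : measurable_fun setT (fun z : R => sin (theta + xi * z)).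
Proof.
by apply: (measurableT_comp msinR); apply: measurable_funD => //; exact: measurable_funM.
Qed.

Let icos xi : mu.-integrable setT (EFin \o (fun z => cos (theta + xi * z) * pdf z)).
Proof.
apply: (le_integrable measurableT _ _ (integrable_normal_pdf 0 s)).
- by apply/measurable_EFinP; apply: (measurable_funM (mcos xi)); exact: mpdf.
- move=> z _; by rewrite /= lee_fin normrM ler_piMl// cos_max.
Qed.

Let isin xi : mu.-integrable setT (EFin \o (fun z => z * sin (theta + xi * z) * pdf z)).
Proof.
have i1 := integrable_moment s_neq0 (@ltr01 R).
apply: (le_integrable _ _ _ i1) => //.
- have m : measurable_fun setT (fun z : R => z * sin (theta + xi * z)).
    by apply: measurable_funM => //; exact: msin.
  by apply/measurable_EFinP; apply: (measurable_funM m); exact: mpdf.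
- move=> z _; rewrite /= lee_fin !normrM powRr1// normr_id ler_wpM2r//.
  by rewrite ler_piMr// sin_max.
Qed.

Let gauss_cos (xi : R) : R := \int[mu]_z (cos (theta + xi * z) * pdf z).
Let gauss_sin (xi : R) : R := \int[mu]_z (z * sin (theta + xi * z) * pdf z).

Let gauss_cos_taylor xi h : `|gauss_cos (xi + h) - gauss_cos xi - h * - gauss_sin xi|
  <= 4 * (\int[mu]_z (`|z| `^ 2 * pdf z)) * h ^+ 2.
Proof.
rewrite /gauss_cos /gauss_sin.
have i2 := integrable_moment s_neq0 (ltr0n R 2).
have iB := integrableB measurableT (icos (xi + h)) (icos xi).
have iH := integrableZl measurableT h (isin xi).
rewrite mulrN opprK -RintegralZl// -RintegralB// -RintegralD//.
have iD := integrableD measurableT iB iH.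
apply: le_trans (le_normr_Rintegral _ iD) _ => //.
rewrite mulrAC -RintegralZl//.
apply: le_Rintegral => //.
- exact: integrable_norm iD.
- exact: (integrableZl measurableT (4 * h ^+ 2) i2).
move=> z _.
have -> : cos (theta + (xi + h) * z) * pdf z - cos (theta + xi * z) * pdf z +
    h * (z * sin (theta + xi * z) * pdf z) =
  (cos (theta + xi * z + h * z) - (cos (theta + xi * z) - h * z * sin (theta + xi * z) -
     (h * z) ^+ 2 / 2 * cos (theta + xi * z)) - (h * z) ^+ 2 / 2 * cos (theta + xi * z)) * pdf z.
  by rewrite [(xi + h) * z]mulrDl [theta + (_ + _)]addrA; ring.
rewrite normrM (ger0_norm (pdf0 z)) [leRHS]mulrA ler_wpM2r//.
apply: le_trans (ler_normB _ _) _.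
have : 3 * taylor_gap (h * z) <= 3 * (h * z) ^+ 2.
  by rewrite ler_wpM2l// /taylor_gap ler_piMr ?sqr_ge0// ge_min lexx.
move=> /(le_trans (cos_taylor (theta + xi * z) (h * z))) g1.
have g2 : `|(h * z) ^+ 2 / 2 * cos (theta + xi * z)| <= (h * z) ^+ 2 / 2.
  have a0 : 0 <= (h * z) ^+ 2 / 2 by rewrite divr_ge0// sqr_ge0.
  by rewrite normrM (ger0_norm a0) ler_piMr// cos_max.
have E (a b : R) : 4 * a ^+ 2 * `|b| `^ 2 = 4 * (a * b) ^+ 2.
  by rewrite abs_powR2; ring.
rewrite (E h z).
have : 0 <= (h * z) ^+ 2 by rewrite sqr_ge0.
by move: g1 g2; move: ((h * z) ^+ 2) => u; lra.
Qed.

Let deriv_pdf (z : R) : is_derive z 1 (pdf : R -> R) (- (z / s ^+ 2) * pdf z).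
Proof.
have D1 : is_derive z 1 (fun z : R => - (z ^+ 2 / (2 * s ^+ 2))) (- (z / s ^+ 2)).
  rewrite (_ : (fun _ => _) = (fun z : R => - (2 * s ^+ 2)^-1 * z ^+ 2)); last first.
    by apply/funext => y; rewrite mulNr mulrC.
  apply: trigger_derive; rewrite /GRing.scale/=.
  by field; exact: s_neq0.
have D2 := @is_derive1_comp _ expR (fun z : R => - (z ^+ 2 / (2 * s ^+ 2))) z _ _
  (is_derive_expR _) D1.
rewrite pdfE.
have D3 := is_deriveZ (normal_peak s) D2.
apply: is_derive_eq; rewrite /GRing.scale/=; ring.
Qed.

Let parts (xi z : R) : is_derive z 1 (fun z : R => sin (theta + xi * z) * pdf z)
  (xi * (cos (theta + xi * z) * pdf z) - (s ^+ 2)^-1 * (z * sin (theta + xi * z) * pdf z)).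
Proof.
have D0 : is_derive z 1 (fun z : R => xi * z) xi.
  by apply: trigger_derive; rewrite /GRing.scale/= mulr1.
have D1 : is_derive z 1 (fun z : R => theta + xi * z) xi.
  by have := is_deriveD (is_derive_cst theta z 1) D0; rewrite add0r.
have D2 := @is_derive1_comp _ sin (fun z : R => theta + xi * z) z _ _ (is_derive_sin _) D1.
have D3 := is_deriveM D2 (deriv_pdf z).
apply: is_derive_eq; rewrite /GRing.scale/=; field; exact: s_neq0.
Qed.

Let gauss_parts xi : gauss_sin xi = s ^+ 2 * xi * gauss_cos xi.
Proof.
pose k z := xi * (cos (theta + xi * z) * pdf z) - (s ^+ 2)^-1 * (z * sin (theta + xi * z) * pdf z).
have ki : mu.-integrable setT (EFin \o k).
  exact: (integrableB measurableT (integrableZl measurableT xi (icos xi))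
    (integrableZl measurableT (s ^+ 2)^-1 (isin xi))).
have cpdf : continuous pdf by exact: continuous_normal_pdf.
have clin : continuous (fun z : R => theta + xi * z).
  move=> z; apply: cvgD; first exact: cvg_cst.
  by apply: cvgM; [exact: cvg_cst|exact: cvg_id].
have csin : continuous (fun z : R => sin (theta + xi * z)).
  by move=> z; apply: (cvg_comp _ _ (clin z)); exact: continuous_sin.
have ccos : continuous (fun z : R => cos (theta + xi * z)).
  by move=> z; apply: (cvg_comp _ _ (clin z)); exact: continuous_cos.
have ck : continuous k.
  move=> z; apply: cvgB; apply: cvgM; try exact: cvg_cst.
    by apply: cvgM; [exact: ccos|exact: cpdf].
  by apply: cvgM; [apply: cvgM; [exact: cvg_id|exact: csin]|exact: cpdf].
have pdfN (z : R) : pdf (- z) = pdf z by rewrite pdfE sqrrN.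
pose G z := sin (theta + xi * z) * pdf z.
have cG : continuous G.
  by move=> z; apply: cvgM; [exact: csin|exact: cpdf].
have E n : \int[mu]_(z in `[- n.+1%:R, n.+1%:R]) k z =
    (sin (theta + xi * n.+1%:R) - sin (theta - xi * n.+1%:R)) * pdf n.+1%:R.
  rewrite /Rintegral (@continuous_FTC2 _ k G).
  - by rewrite /= /G pdfN mulrN mulrBl.
  - by rewrite gtrN.
  - exact: continuous_subspaceT.
  - split.
    + by move=> z _; have [] := parts xi z.
    + exact/cvg_at_right_filter/cG.
    + exact/cvg_at_left_filter/cG.
  - by move=> z _; rewrite derive1E; apply: derive_val; exact: parts.
have L0 : \int[mu]_(z in `[- n%:R, n%:R]) k z @[n --> \oo] --> (0 : R).
  rewrite -cvg_shiftS.
  have [C C0 HC] := gaussian_moment_bound s_neq0 (@ltr01 R).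
  apply/norm_cvg0P.
  have c0 : 2 * C * n.+1%:R^-1 @[n --> \oo] --> (0 : R).
    rewrite -[X in _ --> X](mulr0 (2 * C)); apply: cvgM; first exact: cvg_cst.
    exact: cvg_harmonic.
  apply: (squeeze_cvgr _ (cvg_cst 0) c0); apply: nearW => n.
  rewrite normr_ge0/= E ler_pdivlMr// !normrM (ger0_norm (pdf0 _)).
  have := HC n.+1%:R; rewrite powRr1// normr_nat mul1r => h1.
  have h2 : C * expR (- n.+1%:R) <= C.
    by rewrite ler_piMr// -expR0 ler_expR oppr_le0.
  rewrite -!mulrA; apply: ler_pM => //; first by rewrite mulr_ge0.
    apply: le_trans (ler_normB _ _) _; rewrite (_ : 2 = 1 + 1)// lerD//; exact: sin_max.
  by rewrite mulrC; exact: le_trans h1 h2.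
have kE : \int[mu]_z k z = 0.
  by rewrite -(cvg_lim _ (cvg_Rintegral_itv ki))// (cvg_lim _ L0).
have : \int[mu]_z k z = xi * gauss_cos xi - (s ^+ 2)^-1 * gauss_sin xi.
  rewrite /k RintegralB// ?RintegralZl//.
  - exact: (integrableZl measurableT xi (icos xi)).
  - exact: (integrableZl measurableT (s ^+ 2)^-1 (isin xi)).
rewrite kE => /esym/eqP; rewrite subr_eq0 => /eqP h.
have : s ^+ 2 * (xi * gauss_cos xi) = s ^+ 2 * ((s ^+ 2)^-1 * gauss_sin xi).
  by rewrite h.
by rewrite mulrA => ->; rewrite mulVKf// expf_neq0.
Qed.

(** The transform satisfies the differential equation [f = - s^2 xi f], where
the derivative under the integral sign is rewritten by integration by parts;
hence [f xi * exp (s^2 xi^2 / 2)] is constant. *)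
Lemma gauss_cosE xi : gauss_cos xi = cos theta * expR (- (s ^+ 2 * xi ^+ 2 / 2)).
Proof.
have D (x : R) : is_derive x 1 gauss_cos (- gauss_sin x).
  exact: is_derive_quadratic (gauss_cos_taylor x).
have De (x : R) : is_derive x 1 (fun x : R => expR (s ^+ 2 / 2 * x ^+ 2))
    (s ^+ 2 * x * expR (s ^+ 2 / 2 * x ^+ 2)).
  have D1 : is_derive x 1 (fun x : R => s ^+ 2 / 2 * x ^+ 2) (s ^+ 2 * x).
    by apply: trigger_derive; rewrite /GRing.scale/=; field.
  have D2 := @is_derive1_comp _ expR (fun x : R => s ^+ 2 / 2 * x ^+ 2) x _ _
    (is_derive_expR _) D1.
  by apply: is_derive_eq; rewrite mulrC.
pose H x := gauss_cos x * expR (s ^+ 2 / 2 * x ^+ 2).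
have H0 (x : R) : is_derive x 1 H 0.
  have D3 := is_deriveM (D x) (De x).
  apply: is_derive_eq; rewrite /GRing.scale/= gauss_parts; ring.
have : H xi = H 0 by exact: is_derive_0_is_cst.
rewrite /H expr0n mulr0 expR0 mulr1.
have -> : gauss_cos 0 = cos theta.
  rewrite /gauss_cos; under eq_Rintegral do rewrite mul0r addr0.
  rewrite RintegralZl//; last exact: integrable_normal_pdf.
  by rewrite [X in _ * X]/Rintegral integral_normal_pdf mulr1.
have -> : s ^+ 2 * xi ^+ 2 / 2 = s ^+ 2 / 2 * xi ^+ 2 by rewrite mulrAC.
move=> h; apply: (mulIf (_ : expR (s ^+ 2 / 2 * xi ^+ 2) != 0)).
  by rewrite gt_eqF ?expR_gt0.
by rewrite h -[RHS]mulrA -expRD addNr expR0 mulr1.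
Qed.

Theorem gaussian_charfun xi :
  \int[N]_z cos (theta + xi * z) = cos theta * expR (- (s ^+ 2 * xi ^+ 2 / 2)).
Proof.
have c1 z : 0 <= 1 + cos (theta + xi * z) by have := cos_geN1 (theta + xi * z); lra.
have m0 : measurable_fun setT (fun z : R => 1 + cos (theta + xi * z)).
  exact: measurable_funD.
have m1 : measurable_fun setT (fun z : R => (1 + cos (theta + xi * z))%:E).
  exact/measurable_EFinP.
have iN : N.-integrable setT (EFin \o (fun z => cos (theta + xi * z))).
  by apply: (@bounded_integrable _ _ _ N _ 1) => [|z];
    [exact: mcos|exact: cos_max].
have i1 : mu.-integrable setT (EFin \o pdf) by exact: integrable_normal_pdf.
have : (\int[N]_z (1 + cos (theta + xi * z))%:E =
    (\int[mu]_z (pdf z + cos (theta + xi * z) * pdf z))%:E)%E.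
  rewrite integral_normal_prob// /Rintegral fineK.
    by apply: eq_integral => z _; rewrite -EFinM mulrDl mul1r.
  apply: integrable_fin_num => //.
  exact: (integrableD measurableT i1 (icos xi)).
rewrite (@bounded_RintegralE _ _ _ N _ 2); last 2 first.
- exact: m0.
- by move=> z; rewrite ger0_norm//; have := cos_le1 (theta + xi * z); lra.
move=> []; rewrite RintegralD//; last first.
  exact: finite_measure_integrable_cst.
rewrite Rintegral_prob_cst RintegralD//.
have -> : \int[mu]_z pdf z = 1 by rewrite /Rintegral integral_normal_pdf.
by rewrite -gauss_cosE => /addrI.
Qed.

End gaussian_charfun.

(** * Continuity theorem by Gaussian smoothing *)

Lemma Rintegral_swap {d1 d2 : measure_display} {S1 : measurableType d1}
    {S2 : measurableType d2} {R : realType} (Q1 : probability S1 R)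
    (Q2 : probability S2 R) (f : S1 * S2 -> R) (C : R) :
  measurable_fun setT f -> (forall x, `|f x| <= C) ->
  measurable_fun setT (fun y => \int[Q1]_x f (x, y)) /\
  \int[Q1]_x \int[Q2]_y f (x, y) = \int[Q2]_y \int[Q1]_x f (x, y).
Proof.
move=> mf fC; pose h x := (f x + C)%:E.
have mh : measurable_fun setT h by apply/measurable_EFinP; exact: measurable_funD.
have h0 x : (0 <= h x)%E.
  by rewrite lee_fin; have := fC x; rewrite ler_norml => /andP[]; lra.
have m1 y : measurable_fun setT (fun x => f (x, y)).
  exact: (measurableT_comp mf (pair2_measurable y)).
have m2 x : measurable_fun setT (fun y => f (x, y)).
  exact: (measurableT_comp mf (pair1_measurable x)).
have bC (z : S1 * S2) : `|f z + C| <= C + C.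
  by have := fC z; rewrite !ler_norml => /andP[a b]; apply/andP; split; lra.
have i1 y : (\int[Q1]_x h (x, y) = (\int[Q1]_x f (x, y) + C)%:E)%E.
  rewrite /h (@bounded_RintegralE _ _ _ Q1 _ (C + C)) => [||x]; last exact: bC.
    rewrite RintegralD// ?Rintegral_prob_cst//.
      exact: (@bounded_integrable _ _ _ Q1 _ C).
    exact: finite_measure_integrable_cst.
  exact: measurable_funD.
have i2 x : (\int[Q2]_y h (x, y) = (\int[Q2]_y f (x, y) + C)%:E)%E.
  rewrite /h (@bounded_RintegralE _ _ _ Q2 _ (C + C)) => [||y]; last exact: bC.
    rewrite RintegralD// ?Rintegral_prob_cst//.
      exact: (@bounded_integrable _ _ _ Q2 _ C).
    exact: finite_measure_integrable_cst.
  exact: measurable_funD.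
have M1 : measurable_fun setT (fun y => \int[Q1]_x f (x, y)).
  rewrite (_ : (fun y => _) = (fun y => fine (\int[Q1]_x h (x, y))%E - C)); last first.
    by apply/funext => y; rewrite i1/= addrK.
  apply: measurable_funB => //; apply: measurableT_comp => //.
  exact: (measurable_fun_fubini_tonelli_G (m1 := Q1) h).
have M2 : measurable_fun setT (fun x => \int[Q2]_y f (x, y)).
  rewrite (_ : (fun x => _) = (fun x => fine (\int[Q2]_y h (x, y))%E - C)); last first.
    by apply/funext => x; rewrite i2/= addrK.
  apply: measurable_funB => //; apply: measurableT_comp => //.
  exact: (measurable_fun_fubini_tonelli_F (m2 := Q2) h).
split=> //.
have b1 y : `|\int[Q1]_x f (x, y)| <= C by exact: norm_Rintegral_le.
have b2 x : `|\int[Q2]_y f (x, y)| <= C by exact: norm_Rintegral_le.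
have := fubini_tonelli (m1 := Q1) (m2 := Q2) h mh h0.
under eq_integral do rewrite i2; under [RHS]eq_integral do rewrite i1.
rewrite (@bounded_RintegralE _ _ _ Q1 _ (C + C)) => [||x]; last 2 first.
- exact: measurable_funD.
- by have := b2 x; rewrite !ler_norml => /andP[a b]; apply/andP; split; lra.
rewrite (@bounded_RintegralE _ _ _ Q2 _ (C + C)) => [||y]; last 2 first.
- exact: measurable_funD.
- by have := b1 y; rewrite !ler_norml => /andP[a b]; apply/andP; split; lra.
rewrite !RintegralD ?Rintegral_prob_cst//; last 4 first.
- exact: (@bounded_integrable _ _ _ Q2 _ C).
- exact: finite_measure_integrable_cst.
- exact: (@bounded_integrable _ _ _ Q1 _ C).
- exact: finite_measure_integrable_cst.
by move=> -[/addIr ->].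
Qed.

Section gaussian_window.
Context {R : realType}.
Local Notation mu := (@lebesgue_measure R).

Lemma normal_pdf_shiftE (v e a : R) : e != 0 ->
  normal_pdf v e a = normal_peak e * expR (- ((e^-1) ^+ 2 * (a - v) ^+ 2 / 2)).
Proof.
move=> e0; rewrite normal_pdfE// -[LHS]/(normal_peak e * normal_fun v e a) /normal_fun.
congr (_ * expR _); rewrite mulNr; congr (- _).
by rewrite -[e ^+ 2 *+ 2]mulr_natr invfM exprVn; ring.
Qed.

Lemma normal_peak_double (e : R) : normal_peak e = 2 * normal_peak (2 * e).
Proof.
rewrite /normal_peak (_ : (2 * e) ^+ 2 * pi *+ 2 = 2 ^+ 2 * (e ^+ 2 * pi *+ 2)); last first.
  by ring.
by rewrite sqrtrM ?sqr_ge0// sqrtr_sqr ger0_norm// invfM mulrA mulfV// mul1r.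
Qed.

(** Outside of the window the density of standard deviation [e] is at most a
small constant times the density of standard deviation [2 e], whose total mass
is one. *)
Lemma normal_tail (v e del : R) (A : set R) : e != 0 -> 0 <= del -> measurable A ->
  (forall a, A a -> del <= `|a - v|) ->
  (normal_prob v e A <= (2 * expR (- (3 / 8 * (e^-1) ^+ 2 * del ^+ 2)))%:E)%E.
Proof.
move=> e0 d0 mA Ad; set eta := 2 * _.
have e20 : 2 * e != 0 by rewrite mulf_neq0.
have eta0 : 0 <= eta by rewrite mulr_ge0 ?expR_ge0.
have mpdf s : measurable_fun setT (fun a : R => (normal_pdf v s a)%:E).
  by apply/measurable_EFinP; exact: measurable_normal_pdf.
have key (a : R) : del <= `|a - v| ->
    normal_pdf v e a <= eta * normal_pdf v (2 * e) a.
  move=> dA; rewrite !normal_pdf_shiftE// /eta normal_peak_double.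
  rewrite (_ : 2 * expR _ * _ = 2 * normal_peak (2 * e) *
    (expR (- (3 / 8 * e^-1 ^+ 2 * del ^+ 2)) *
     expR (- ((2 * e)^-1 ^+ 2 * (a - v) ^+ 2 / 2)))); last by ring.
  rewrite ler_wpM2l ?mulr_ge0 ?normal_peak_ge0//.
  rewrite -expRD ler_expR invfM exprMn -opprD lerN2.
  have : del ^+ 2 <= (a - v) ^+ 2.
    by rewrite -[leRHS]real_normK ?num_real// lerXn2r ?nnegrE.
  have := sqr_ge0 e^-1; move: ((a - v) ^+ 2) (del ^+ 2) (e^-1 ^+ 2) => x y z z0 yx.
  have -> : (2^-1 : R) ^+ 2 = 1 / 4 by rewrite exprVn -natrX; field.
  by have := ler_wpM2l z0 yx; lra.
apply: (@le_trans _ _ (\int[mu]_(a in A) (eta%:E * (normal_pdf v (2 * e) a)%:E))%E).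
  apply: ge0_le_integral => //.
  - by move=> a _; rewrite lee_fin normal_pdf_ge0.
  - by apply: measurable_funTS; exact: mpdf.
  - by apply: measurable_funeM; apply: measurable_funTS; exact: mpdf.
  - by move=> a Aa; rewrite -EFinM lee_fin; exact: key (Ad a Aa).
rewrite ge0_integralZl//; last 2 first.
- by apply: measurable_funTS; exact: mpdf.
- by move=> a _; rewrite lee_fin normal_pdf_ge0.
rewrite -[leRHS]mule1 lee_wpmul2l ?lee_fin//.
exact: (@probability_le1 _ _ _ (normal_prob v (2 * e)) A mA).
Qed.

(** Smoothing with a Gaussian of small variance approximates the indicator of
an interval from both sides, up to a margin; the same [e] serves for all
intervals and all centres. *)
Lemma gaussian_window (del eps : R) : 0 < del -> 0 < eps -> exists2 e : R, e != 0 &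
  forall c d v : R,
    (~ (c < v < d) -> (normal_prob v e `[(c + del)%R, (d - del)%R] <= eps%:E)%E) /\
    (c + 2 * del <= v <= d - 2 * del ->
      (1 <= normal_prob v e `[(c + del)%R, (d - del)%R] + eps%:E)%E).
Proof.
move=> d0 p0; have q0 : 0 < 3 * del ^+ 2 * eps / 16.
  by rewrite divr_gt0// mulr_gt0// mulr_gt0// exprn_gt0.
(* chosen so that the tail bound is 2 exp (- 2 / eps), which is at most eps *)
pose e := Num.sqrt (3 * del ^+ 2 * eps / 16).
have e0 : 0 < e by rewrite sqrtr_gt0.
have en0 : e != 0 by rewrite gt_eqF.
have bnd : 2 * expR (- (3 / 8 * (e^-1) ^+ 2 * del ^+ 2)) <= eps.
  have -> : 3 / 8 * e^-1 ^+ 2 * del ^+ 2 = 2 / eps.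
    rewrite exprVn sqr_sqrtr ?(ltW q0)//; field.
    by rewrite !gt_eqF// .
  have u0 : 0 < 2 / eps by rewrite divr_gt0.
  have : expR (- (2 / eps)) * (2 / eps) <= 1.
    apply: (@le_trans _ _ (expR (- (2 / eps)) * expR (2 / eps))).
      rewrite ler_wpM2l ?expR_ge0//; apply: le_trans (expR_ge1Dx _).
      by rewrite lerDr.
    by rewrite -expRD addNr expR0.
  by rewrite mulrA ler_pdivrMr// mul1r mulrC.
exists e => // c d v; split=> [vcd|/andP[cv vd]].
  apply: le_trans (normal_tail (del := del) en0 (ltW d0) _ _) _ => //.
  move=> a; rewrite /= in_itv/= => /andP[ca ad].
  have [cv|cv] := leP v c; first by rewrite ger0_norm; lra.
  have [dv|dv] := leP d v; first by rewrite ler0_norm; lra.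
  by exfalso; apply: vcd; rewrite cv dv.
have mI : measurable (`[c + del, d - del]%classic : set R) by [].
have := @normal_tail v e del (~` `[c + del, d - del]%classic) en0 (ltW d0) (measurableC mI).
move=> /(_ _)/wrap[|].
  move=> a; rewrite /= in_itv/= => /negP; rewrite negb_and -!ltNge => /orP[h|h].
    by rewrite ler0_norm; lra.
  by rewrite ger0_norm; lra.
rewrite probability_setC// => /le_trans/(_ (_ : _ <= eps%:E)%E)/wrap[|].
  by rewrite lee_fin.
have fI : normal_prob v e `[(c + del)%R, (d - del)%R] \is a fin_num by exact: fin_num_measure.
by move=> h; have := h; rewrite leeBlDr ?fin_num_measure// addeC.
Qed.

End gaussian_window.

Section window_expectation.
Context {d : measure_display} {T : measurableType d} {R : realType}
  (P : probability T R) (Y : {RV P >-> R}).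
Variable e : R.
Hypothesis e_neq0 : e != 0.
Local Notation mu := (@lebesgue_measure R).

(** The Gaussian density at [a] is itself a Gaussian average of cosines, by
[gaussian_charfun] with the inverse standard deviation; the order of
integration is then exchanged. *)
Lemma smoothed_density (a : R) :
  \int[P]_w normal_pdf (Y w) e a =
  normal_peak e * \int[normal_prob 0 e^-1]_z \int[P]_w cos (- (z * a) + z * Y w).
Proof.
have mc : measurable_fun setT (@cos R) by exact: continuous_measurable_fun (@continuous_cos R).
have ei : e^-1 != 0 by rewrite invr_eq0.
pose f (x : T * R) := cos (- (x.2 * a) + x.2 * Y x.1).
have mf : measurable_fun setT f.
  apply: (measurableT_comp mc); apply: measurable_funD.
    by apply: measurableT_comp => //; apply: measurable_funM => //; exact: measurable_snd.
  apply: measurable_funM; first exact: measurable_snd.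
  by apply: measurableT_comp => //; exact: measurable_fst.
have f1 x : `|f x| <= 1 by exact: cos_max.
have [_ <-] := Rintegral_swap P (normal_prob 0 e^-1) mf f1.
have E w : \int[normal_prob 0 e^-1]_z f (w, z) =
    expR (- (e^-1 ^+ 2 * (a - Y w) ^+ 2 / 2)).
  rewrite (_ : (a - Y w) ^+ 2 = (Y w - a) ^+ 2); last by rewrite -sqrrN opprB.
  rewrite -[RHS]mul1r -[X in X * _]cos0 -gaussian_charfun//.
  by apply: eq_Rintegral => z _; rewrite /f/=; congr cos; ring.
have mE : measurable_fun setT (fun w => expR (- (e^-1 ^+ 2 * (a - Y w) ^+ 2 / 2))).
  apply: measurableT_comp => //; apply: measurableT_comp => //.
  apply: measurable_funM => //; apply: measurable_funM => //.
  by apply: measurable_funX; exact: measurable_funB.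
transitivity (\int[P]_w (normal_peak e *
    expR (- (e^-1 ^+ 2 * (a - Y w) ^+ 2 / 2)))).
  by apply: eq_Rintegral => w _; rewrite normal_pdf_shiftE.
rewrite RintegralZl//.
  by congr (_ * _); apply: eq_Rintegral => w _; rewrite E.
apply: (@bounded_integrable _ _ _ P _ 1) => // w.
rewrite ger0_norm ?expR_ge0// -expR0 ler_expR oppr_le0 divr_ge0// mulr_ge0//.
  exact: sqr_ge0.
exact: sqr_ge0.
Qed.

Lemma measurable_normal_pdf_mean : measurable_fun setT
  (fun x : T * R => normal_pdf (Y x.1) e x.2).
Proof.
rewrite (_ : (fun x => _) = (fun x : T * R => normal_peak e *
   expR (- ((e^-1) ^+ 2 * (x.2 - Y x.1) ^+ 2 / 2)))); last first.
  by apply/funext => x; rewrite normal_pdf_shiftE.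
apply: measurable_funM => //; apply: measurableT_comp => //.
apply: measurableT_comp => //; apply: measurable_funM => //; apply: measurable_funM => //.
apply: measurable_funX; apply: measurable_funB; first exact: measurable_snd.
by apply: measurableT_comp => //; exact: measurable_fst.
Qed.

Lemma measurable_window (A : set R) : measurable A ->
  measurable_fun setT (fun w => normal_prob (Y w) e A).
Proof.
move=> mA; pose g (x : T * R) := (normal_pdf (Y x.1) e x.2 * \1_A x.2)%:E.
have mg : measurable_fun setT g.
  apply/measurable_EFinP; apply: measurable_funM; first exact: measurable_normal_pdf_mean.
  have m1 : measurable_fun setT (\1_A : R -> R) by exact: measurable_indic.
  exact: (measurableT_comp m1 (@measurable_snd _ _ _ _)).
have := measurable_fun_fubini_tonelli_F (m2 := mu) g mg.
move=> /(_ _)/wrap[|]; first by move=> x; rewrite lee_fin mulr_ge0// normal_pdf_ge0.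
apply: eq_measurable_fun => w _; rewrite /fubini_F /g/= /normal_prob [RHS]integral_mkcond/=.
by apply: eq_integral => a _; rewrite patchE indicE; case: ifP => _; rewrite ?mulr1 ?mulr0.
Qed.

(** Tonelli: the mean probability that the smoothed variable lies in [A] is
the integral over [A] of its density. *)
Lemma window_expectation (A : set R) : measurable A ->
  (\int[P]_w normal_prob (Y w) e A =
   \int[mu]_(a in A) (\int[P]_w normal_pdf (Y w) e a)%R%:E)%E.
Proof.
move=> mA; pose g (x : T * R) := (normal_pdf (Y x.1) e x.2 * \1_A x.2)%:E.
have mg : measurable_fun setT g.
  apply/measurable_EFinP; apply: measurable_funM; first exact: measurable_normal_pdf_mean.
  have m1 : measurable_fun setT (\1_A : R -> R) by exact: measurable_indic.
  exact: (measurableT_comp m1 (@measurable_snd _ _ _ _)).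
have g0 x : (0 <= g x)%E by rewrite lee_fin mulr_ge0// normal_pdf_ge0.
transitivity (\int[P]_w \int[mu]_a g (w, a))%E.
  apply: eq_integral => w _; rewrite /g/= /normal_prob [LHS]integral_mkcond/=.
  by apply: eq_integral => a _; rewrite patchE indicE; case: ifP => _; rewrite ?mulr1 ?mulr0.
rewrite (fubini_tonelli (m1 := P) (m2 := mu) g)// [RHS]integral_mkcond/=.
apply: eq_integral => a _; rewrite patchE /g/= indicE; case: ifP => _.
  under eq_integral do rewrite mulr1.
  rewrite (@bounded_RintegralE _ _ _ P _ (normal_peak e))//.
    exact: (measurableT_comp measurable_normal_pdf_mean (pair2_measurable a)).
  by move=> w; rewrite ger0_norm ?normal_pdf_ge0// normal_pdf_ub.
by under eq_integral do rewrite mulr0; rewrite integral0.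
Qed.

End window_expectation.

Section continuity_theorem.
Context {d d' : measure_display} {T : measurableType d} {T' : measurableType d'}
  {R : realType} (P : probability T R) (P' : probability T' R).
Variables (V : nat -> {RV P >-> R}) (V0 : {RV P' >-> R}).
Hypothesis cvg_cos : forall theta xi : R,
  \int[P]_w cos (theta + xi * V n w) @[n --> \oo] -->
  \int[P']_w cos (theta + xi * V0 w).
Local Notation mu := (@lebesgue_measure R).

Let mcosY {d2 : measure_display} {S : measurableType d2} (Y : S -> R) (a b : R) :
  measurable_fun setT Y -> measurable_fun setT (fun w => cos (a + b * Y w)).
Proof.
move=> mY; apply: (measurableT_comp (continuous_measurable_fun (@continuous_cos R))).
by apply: measurable_funD => //; exact: measurable_funM.
Qed.

Let measurable_mean_cos {d2 : measure_display} {S : measurableType d2}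
    (Q : probability S R) (Y : {RV Q >-> R}) (a : R) :
  measurable_fun setT (fun z : R => \int[Q]_w cos (- (z * a) + z * Y w)).
Proof.
pose f (x : S * R) := cos (- (x.2 * a) + x.2 * Y x.1).
have mfx : measurable_fun setT f.
  apply: (measurableT_comp (continuous_measurable_fun (@continuous_cos R))).
  apply: measurable_funD.
    by apply: measurableT_comp => //; apply: measurable_funM => //; exact: measurable_snd.
  apply: measurable_funM; first exact: measurable_snd.
  by apply: measurableT_comp => //; exact: measurable_fst.
have f1 x : `|f x| <= 1 by exact: cos_max.
by have [] := Rintegral_swap Q (normal_prob 0 1) mfx f1.
Qed.

(** Dominated convergence under the Gaussian average of cosines. *)
Lemma cvg_smoothed_density (e a : R) : e != 0 ->
  \int[P]_w normal_pdf (V n w) e a @[n --> \oo] -->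
  \int[P']_w normal_pdf (V0 w) e a.
Proof.
move=> e0; rewrite smoothed_density//.
under eq_cvg do rewrite smoothed_density//.
apply: cvgM; first exact: cvg_cst.
apply: (@bounded_cvg_Rintegral _ _ _ (normal_prob 0 e^-1) _ _ 1).
- by move=> n; exact: measurable_mean_cos.
- exact: measurable_mean_cos.
- by move=> n z; apply: norm_Rintegral_le => [|w]; [exact: mcosY|exact: cos_max].
- by apply: aeW => z; exact: cvg_cos.
Qed.

Let mean_pdf {d2 : measure_display} {S : measurableType d2} (Q : probability S R)
    (Y : {RV Q >-> R}) (e a : R) : e != 0 ->
  (`|\int[Q]_w normal_pdf (Y w) e a| <= normal_peak e) /\
  (\int[Q]_w (normal_pdf (Y w) e a)%:E = (\int[Q]_w normal_pdf (Y w) e a)%R%:E)%E.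
Proof.
move=> e0.
have m : measurable_fun setT (fun w => normal_pdf (Y w) e a).
  exact: (measurableT_comp (measurable_normal_pdf_mean Y e0) (pair2_measurable a)).
have b w : `|normal_pdf (Y w) e a| <= normal_peak e.
  by rewrite ger0_norm ?normal_pdf_ge0// normal_pdf_ub.
by split; [exact: norm_Rintegral_le|exact: bounded_RintegralE m b].
Qed.

Let measurable_mean_pdf {d2 : measure_display} {S : measurableType d2}
    (Q : probability S R) (Y : {RV Q >-> R}) (e : R) : e != 0 ->
  measurable_fun setT (fun a : R => (\int[Q]_w normal_pdf (Y w) e a)%:E).
Proof.
move=> e0; pose g (x : S * R) := (normal_pdf (Y x.1) e x.2)%:E.
have mg : measurable_fun setT g.
  by apply/measurable_EFinP; exact: measurable_normal_pdf_mean.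
have g0 x : (0 <= g x)%E by rewrite lee_fin normal_pdf_ge0.
have := measurable_fun_fubini_tonelli_G (m1 := Q) g mg g0.
apply: eq_measurable_fun => a _; rewrite /fubini_G /g/=.
by have [_] := mean_pdf Y a e0.
Qed.

(** The smoothed densities converge pointwise and are bounded, and the window
is bounded. *)
Lemma cvg_window (e c d0 : R) : e != 0 ->
  (\int[P]_w normal_prob (V n w) e `[c, d0] @[n --> \oo] -->
   \int[P']_w normal_prob (V0 w) e `[c, d0])%E.
Proof.
move=> e0; have mI : measurable (`[c, d0]%classic : set R) by [].
rewrite window_expectation//; under eq_cvg do rewrite window_expectation//.
have [] := @dominated_convergence _ _ _ mu `[c, d0]%classic mI
  (fun n a => (\int[P]_w normal_pdf (V n w) e a)%:E)
  (fun a => (\int[P']_w normal_pdf (V0 w) e a)%:E) (EFin \o cst (normal_peak e)).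
- by move=> n; apply: measurable_funTS; exact: measurable_mean_pdf.
- by apply: measurable_funTS; exact: measurable_mean_pdf.
- by apply: aeW => a _; apply: cvg_EFin; [exact: nearW|exact: cvg_smoothed_density].
- apply: continuous_compact_integrable; first exact: segment_compact.
  by apply: continuous_subspaceT; exact: cst_continuous.
- by apply: aeW => a n _; rewrite lee_fin; have [] := mean_pdf (V n) a e0.
by [].
Qed.

Let window_fin {d2 : measure_display} {S : measurableType d2} (Q : probability S R)
    (Y : {RV Q >-> R}) (e : R) (J : set R) : e != 0 -> measurable J ->
  (\int[Q]_w normal_prob (Y w) e J)%E \is a fin_num.
Proof.
move=> e0 mJ; rewrite ge0_fin_numE ?integral_ge0//.
apply: (@le_lt_trans _ _ (\int[Q]_w 1)%E).
  apply: ge0_le_integral => //; first exact: measurable_window.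
  by move=> w _; exact: (@probability_le1 _ _ _ (normal_prob (Y w) e)).
by rewrite integral_cst//= probability_setT mule1 ltry.
Qed.

(** A Gaussian window lies, up to [eps], below the indicator of the open
interval and above that of a smaller closed one. The one-sided estimate
suffices, since it is applied on both sides of a continuity point. *)
Lemma le_interval_probability (c d0 del eps : R) : 0 < del -> 0 < eps ->
  \forall n \near \oo, fine (P' (V0 @^-1` `[c + 2 * del, d0 - 2 * del])) <=
    fine (P (V n @^-1` `]c, d0[)) + 3 * eps.
Proof.
move=> del0 eps0; have [e e0 He] := gaussian_window del0 eps0.
pose J := (`[c + del, d0 - del]%classic : set R).
have mJ : measurable J by exact: measurable_itv.
have upper n : (\int[P]_w normal_prob (V n w) e J <=
    P (V n @^-1` `]c, d0[) + eps%:E)%E.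
  have mA : measurable (V n @^-1` `]c, d0[) by exact: measurable_funPTI.
  apply: (@le_trans _ _ (\int[P]_w ((\1_(V n @^-1` `]c, d0[) w : R)%:E + eps%:E))%E).
    apply: ge0_le_integral => //.
    - exact: measurable_window.
    - apply/measurable_EFinP; apply: measurable_funD => //; exact: measurable_indic.
    - move=> w _; have [h1 _] := He c d0 (V n w).
      have [vw|vw] := pselect (c < V n w < d0).
        have wA : (V n @^-1` `]c, d0[) w by rewrite /= in_itv.
        rewrite indicE mem_set//.
        apply: (@le_trans _ _ 1%E); last by rewrite -EFinD lee_fin lerDl ltW.
        exact: (@probability_le1 _ _ _ (normal_prob (V n w) e)).
      have wA : ~ (V n @^-1` `]c, d0[) w by rewrite /= in_itv.
      by rewrite indicE memNset// add0e; exact: h1.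
  rewrite ge0_integralD//; last 2 first.
  - by apply/measurable_EFinP; exact: measurable_indic.
  - by move=> w _; rewrite lee_fin ltW.
  by rewrite integral_indic// setIT integral_cst//= probability_setT mule1.
have lower : (P' (V0 @^-1` `[(c + 2 * del)%R, (d0 - 2 * del)%R]) <=
    \int[P']_w normal_prob (V0 w) e J + eps%:E)%E.
  set B := V0 @^-1` _.
  have mB : measurable B by exact: measurable_funPTI.
  have mw := measurable_window V0 e0 mJ.
  apply: (@le_trans _ _ (\int[P']_w (normal_prob (V0 w) e J + eps%:E))%E); last first.
    rewrite ge0_integralD//; last by move=> w _; rewrite lee_fin ltW.
    by rewrite integral_cst//= probability_setT mule1.
  have -> : P' B = (\int[P']_w (\1_B w : R)%:E)%E by rewrite integral_indic// setIT.
  apply: ge0_le_integral => //.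
  - by apply/measurable_EFinP; exact: measurable_indic.
  - exact: emeasurable_funD.
  - move=> w _; have [_ h2] := He c d0 (V0 w).
    rewrite indicE; case: (boolP (w \in B)) => [|_].
      by rewrite inE /B /= in_itv/= => /h2.
    by rewrite adde_ge0// lee_fin ltW.
have cw := @cvg_window e (c + del) (d0 - del) e0.
have fw := window_fin V0 e0 mJ.
have : fine (\int[P]_w normal_prob (V n w) e J)%E @[n --> \oo] -->
    fine (\int[P']_w normal_prob (V0 w) e J)%E.
  by apply: fine_cvg; rewrite fineK.
move=> /cvgrPdist_le/(_ _ eps0); apply: filterS => n.
rewrite ler_norml => /andP[_ h].
have PA : P (V n @^-1` `]c, d0[) \is a fin_num.
  by apply: fin_num_measure; exact: measurable_funPTI.
have PB : P' (V0 @^-1` `[(c + 2 * del)%R, (d0 - 2 * del)%R]) \is a fin_num.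
  by apply: fin_num_measure; exact: measurable_funPTI.
move: (upper n) lower h; rewrite -(fineK PA) -(fineK PB).
rewrite -(fineK fw) -(fineK (window_fin (V n) e0 mJ)) -!EFinD !lee_fin /=.
by lra.
Qed.

Let cdf_fin {d2 : measure_display} {S : measurableType d2} (Q : probability S R)
  (Y : {RV Q >-> R}) x : cdf Y x \is a fin_num.
Proof. by apply: fin_num_measure. Qed.

Let cdf_gap (a b : R) (A : set R) : measurable A ->
  (forall y, y <= b -> y <= a \/ A y) ->
  fine (cdf V0 b) <= fine (cdf V0 a) + fine (P' (V0 @^-1` A)).
Proof.
move=> mA H.
have mVA : measurable (V0 @^-1` A) by exact: measurable_funPTI.
have PA : P' (V0 @^-1` A) \is a fin_num by exact: fin_num_measure.
rewrite -lee_fin EFinD !fineK//.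
have ma : measurable (V0 @^-1` `]-oo, a]) by exact: measurable_funPTI.
have mb : measurable (V0 @^-1` `]-oo, b]) by exact: measurable_funPTI.
apply: (@le_trans _ _ (P' ((V0 @^-1` `]-oo, a]) `|` (V0 @^-1` A)))); last exact: measureU2.
rewrite -[leLHS]/(P' (V0 @^-1` `]-oo, b])).
apply: le_measure; rewrite ?inE//; first exact: measurableU.
by move=> w /=; rewrite !in_itv/= => /H.
Qed.

(** Take [c] and [z] far out, where the limit law leaves mass at most [e]. The
estimate on an interval that ends at [x] bounds the distribution functions
from below; the estimate on one that starts at [x] bounds them from above by
complementation. *)
Theorem continuity_theorem (x : R) : {for x, continuous (cdf V0)} ->
  cdf (V n) x @[n --> \oo] --> cdf V0 x.
Proof.
move=> cx; suff : fine (cdf (V n) x) @[n --> \oo] --> fine (cdf V0 x).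
  move=> /(cvg_EFin (nearW _ (fun n => cdf_fin (V n) x))).
  by rewrite fineK//; apply: cvg_trans; apply: near_eq_cvg; apply: nearW => n;
    rewrite /= fineK.
apply/cvgrPdist_le => e0 e00; have {}e00 : 0 < (e0 : R) by [].
pose e : R := e0 / 5; have e_gt0 : 0 < e by rewrite divr_gt0.
have cfx : fine (cdf V0 y) @[y --> x] --> fine (cdf V0 x).
  by apply: fine_cvg; rewrite fineK//; exact: cx.
have /cvgrPdist_le/(_ _ e_gt0)/nbhs_ballP[rho /= rho0 Hrho] := cfx.
have cN : fine (cdf V0 y) @[y --> -oo] --> (0 : R).
  by apply: fine_cvg; exact: cvg_cdfNy0.
have cY : fine (cdf V0 y) @[y --> +oo] --> (1 : R).
  by apply: fine_cvg; exact: cvg_cdfy1.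
have [c [cx1 Fc]] : exists c : R, c <= x /\ fine (cdf V0 c) <= e.
  have /cvgrPdist_le/(_ _ e_gt0) HN := cN.
  have : \forall y \near -oo, y <= x /\ fine (cdf V0 y) <= e.
    near=> y; split; first by near: y; apply: nbhs_ninfty_le; exact: num_real.
    have : `|0 - fine (cdf V0 y)| <= e by near: y; exact: HN.
    by rewrite sub0r normrN; apply: le_trans; exact: ler_norm.
  by move=> /filter_ex.
have [z [zx Fz]] : exists z : R, x <= z /\ 1 - e <= fine (cdf V0 z).
  have /cvgrPdist_le/(_ _ e_gt0) HY := cY.
  have : \forall y \near +oo, x <= y /\ 1 - e <= fine (cdf V0 y).
    near=> y; split; first by near: y; apply: nbhs_pinfty_ge; exact: num_real.
    have : `|1 - fine (cdf V0 y)| <= e by near: y; exact: HY.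
    by rewrite ler_norml => /andP[_]; lra.
  by move=> /filter_ex.
(* the margin 2 del = rho / 2 stays within the modulus of continuity at x *)
pose del := rho / 4; have del0 : 0 < del by rewrite divr_gt0.
have near_x y : `|x - y| < rho -> `|fine (cdf V0 x) - fine (cdf V0 y)| <= e.
  by move=> h; exact: Hrho.
have F1 : fine (cdf V0 x) - e <= fine (cdf V0 (x - 2 * del)).
  have /near_x : `|x - (x - 2 * del)| < rho.
    by rewrite (_ : x - (x - 2 * del) = 2 * del) ?ger0_norm /del; lra.
  by rewrite ler_norml => /andP[_]; lra.
have F2 : fine (cdf V0 (x + 2 * del)) <= fine (cdf V0 x) + e.
  have /near_x : `|x - (x + 2 * del)| < rho.
    by rewrite (_ : x - (x + 2 * del) = - (2 * del)) ?normrN ?ger0_norm /del; lra.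
  by rewrite ler_norml => /andP[+ _]; lra.
have N1 := @le_interval_probability (c - 2 * del) x del e del0 e_gt0.
have N2 := @le_interval_probability x (z + 2 * del) del e del0 e_gt0.
apply: filterS2 N1 N2 => n n1 n2.
have mV (A : set R) : measurable A -> measurable (V n @^-1` A).
  by move=> mA; exact: measurable_funPTI.
have PV (A : set R) : measurable A -> P (V n @^-1` A) \is a fin_num.
  by move=> mA; apply: fin_num_measure; exact: mV.
have G1 : fine (P (V n @^-1` `]c - 2 * del, x[)) <= fine (cdf (V n) x).
  apply: fine_le; [exact: PV|exact: cdf_fin|].
  apply: le_measure; rewrite ?inE//; [exact: mV|exact: mV|].
  by move=> w /=; rewrite !in_itv/= => /andP[_ /ltW].
have G2 : fine (cdf (V n) x) + fine (P (V n @^-1` `]x, z + 2 * del[)) <= 1.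
  rewrite -lee_fin EFinD !fineK//; last exact: PV.
  have D0 : V n @^-1` `]-oo, x] `&` V n @^-1` `]x, z + 2 * del[ = set0.
    apply/seteqP; split => // w [/=]; rewrite !in_itv/= => w1 /andP[w2 _].
    by move: w1; rewrite leNgt w2.
  have m1 : measurable (V n @^-1` `]-oo, x]) by exact: mV.
  have m2 : measurable (V n @^-1` `]x, z + 2 * del[) by exact: mV.
  have := probability_le1 P (measurableU _ _ m1 m2).
  by rewrite measureU.
have G3 : fine (cdf V0 (x - 2 * del)) <= fine (cdf V0 c) +
    fine (P' (V0 @^-1` `[c - 2 * del + 2 * del, x - 2 * del])).
  apply: cdf_gap => // y yx; have [yc|cy] := leP y c; first by left.
  by right; rewrite /= in_itv/= yx andbT subrK ltW.
have G4 : fine (cdf V0 z) <= fine (cdf V0 (x + 2 * del)) +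
    fine (P' (V0 @^-1` `[x + 2 * del, z + 2 * del - 2 * del])).
  apply: cdf_gap => // y yx; have [yc|cy] := leP y (x + 2 * del); first by left.
  by right; rewrite /= in_itv/= addrK yx andbT ltW.
have e5 : e0 = 5 * e by rewrite /e; field.
by rewrite e5 ler_norml; apply/andP; split; lra.
Unshelve. all: by end_near. Qed.

End continuity_theorem.

(** * Gaussian mixtures *)

Lemma ae_impl {d : measure_display} {T : measurableType d} {R : realType}
    (P : probability T R) (A B : T -> Prop) :
  {ae P, forall w, A w} -> (forall w, A w -> B w) -> {ae P, forall w, B w}.
Proof. by move=> PA AB; apply: filterS PA. Qed.

Lemma Rintegral_product {d1 d2 : measure_display} {S1 : measurableType d1}
    {S2 : measurableType d2} {R : realType} (Q1 : probability S1 R)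
    (Q2 : probability S2 R) (f : S1 * S2 -> R) (C : R) :
  measurable_fun setT f -> (forall x, `|f x| <= C) ->
  \int[(Q1 \x Q2 : probability (S1 * S2)%type R)%E]_z f z = \int[Q1]_x \int[Q2]_y f (x, y).
Proof.
move=> mf fC; pose h x := (f x + C)%:E.
have mh : measurable_fun setT h by apply/measurable_EFinP; exact: measurable_funD.
have h0 x : (0 <= h x)%E.
  by rewrite lee_fin; have := fC x; rewrite ler_norml => /andP[]; lra.
have m2 x : measurable_fun setT (fun y => f (x, y)).
  exact: (measurableT_comp mf (pair1_measurable x)).
have bC (z : S1 * S2) : `|f z + C| <= C + C.
  by have := fC z; rewrite !ler_norml => /andP[a b]; apply/andP; split; lra.
have i2 x : (\int[Q2]_y h (x, y) = (\int[Q2]_y f (x, y) + C)%:E)%E.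
  rewrite /h (@bounded_RintegralE _ _ _ Q2 _ (C + C)) => [||y]; last exact: bC.
    rewrite RintegralD// ?Rintegral_prob_cst//.
      exact: (@bounded_integrable _ _ _ Q2 _ C).
    exact: finite_measure_integrable_cst.
  exact: measurable_funD.
have M2 : measurable_fun setT (fun x => \int[Q2]_y f (x, y)).
  rewrite (_ : (fun x => _) = (fun x => fine (\int[Q2]_y h (x, y))%E - C)); last first.
    by apply/funext => x; rewrite i2/= addrK.
  apply: measurable_funB => //; apply: measurableT_comp => //.
  exact: (measurable_fun_fubini_tonelli_F (m2 := Q2) h).
have b2 x : `|\int[Q2]_y f (x, y)| <= C by exact: norm_Rintegral_le.
have := fubini_tonelli1 (m1 := Q1) (m2 := Q2) h mh h0.
rewrite /fubini_F; under [RHS]eq_integral do rewrite i2.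
rewrite (@bounded_RintegralE _ _ _ (Q1 \x Q2 : probability (S1 * S2)%type R)%E _ (C + C)); last 2 first.
- exact: measurable_funD.
- exact: bC.
rewrite (@bounded_RintegralE _ _ _ Q1 _ (C + C)) => [||x]; last 2 first.
- exact: measurable_funD.
- by have := b2 x; rewrite !ler_norml => /andP[a b]; apply/andP; split; lra.
rewrite !RintegralD ?Rintegral_prob_cst//; last 4 first.
- exact: (@bounded_integrable _ _ _ Q1 _ C).
- exact: finite_measure_integrable_cst.
- exact: (@bounded_integrable _ _ _ (Q1 \x Q2 : probability (S1 * S2)%type R)%E _ C).
- exact: finite_measure_integrable_cst.
by move=> -[/addIr ->].
Qed.

Section gaussian_mixture.
Context {d : measure_display} {T : measurableType d} {R : realType}
  (P : probability T R) (M : {RV P >-> R}) (sigma : R).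

(** A normal law of zero standard deviation is not a point mass here, so the
noise is given scale [1] when [sigma = 0] and the mixture is set to zero in
that case. *)
Definition scale_or1 : R := if sigma == 0 then 1 else `|sigma|.

Lemma scale_or1_neq0 : scale_or1 != 0.
Proof. by rewrite /scale_or1; case: (eqVneq sigma 0) => [_|s0]; rewrite ?oner_eq0 ?normr_eq0. Qed.

Definition noise : probability (measurableTypeR R) R := normal_prob 0 scale_or1.

Definition mixture_prob : probability (T * measurableTypeR R)%type R := (P \x noise)%E.

Definition mixture (x : T * measurableTypeR R) : R :=
  if sigma == 0 then 0 else Num.sqrt `|M x.1| * x.2.

Lemma measurable_mixture : measurable_fun setT mixture.
Proof.
rewrite /mixture; case: (sigma == 0) => //; apply: measurable_funM; last exact: measurable_snd.
apply: (measurableT_comp (continuous_measurable_fun (@sqrt_continuous R))).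
by apply: measurableT_comp => //; apply: measurableT_comp => //; exact: measurable_fst.
Qed.

HB.instance Definition _ := isMeasurableFun.Build _ _ _ _ mixture measurable_mixture.

Definition mixture_rv : {RV mixture_prob >-> R} := mixture.

(** Fubini: given [M], the mixture is a centred Gaussian of variance [sigma^2
M]. *)
Lemma mixture_cos (theta xi : R) :
  \int[mixture_prob]_x cos (theta + xi * mixture x) =
  cos theta * \int[P]_w expR (- (sigma ^+ 2 * xi ^+ 2 / 2 * `|M w|)).
Proof.
have mc : measurable_fun setT (fun x : T * measurableTypeR R => cos (theta + xi * mixture x)).
  apply: (measurableT_comp (continuous_measurable_fun (@continuous_cos R))).
  by apply: measurable_funD => //; apply: measurable_funM => //; exact: measurable_mixture.
rewrite (@Rintegral_product _ _ _ _ _ P noise _ 1)//; last first.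
  by move=> x; exact: cos_max.
have e1 w : `|expR (- (sigma ^+ 2 * xi ^+ 2 / 2 * `|M w|))| <= 1.
  rewrite ger0_norm ?expR_ge0// -[leRHS]expR0 ler_expR oppr_le0.
  by rewrite mulr_ge0// divr_ge0// mulr_ge0 ?sqr_ge0.
rewrite -RintegralZl//; last first.
  apply: (@bounded_integrable _ _ _ P _ 1) => //.
  by apply: measurable_expR_lin; exact: measurableT_comp.
apply: eq_Rintegral => w _; rewrite /mixture /=.
have [s0|s0] := eqVneq sigma 0.
  under eq_Rintegral do rewrite mulr0 addr0.
  by rewrite Rintegral_prob_cst s0 expr0n !mul0r oppr0 expR0 mulr1.
under eq_Rintegral do rewrite mulrA.
rewrite gaussian_charfun ?scale_or1_neq0// /scale_or1 (negPf s0).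
congr (_ * expR (- _)); rewrite exprMn sqr_sqrtr// real_normK ?num_real//.
ring.
Qed.

Let mMq (p : R) : measurable_fun setT (fun w => `|M w| `^ p).
Proof. exact: (measurableT_comp (measurable_abs_powR p)). Qed.

Lemma gaussian_moment_gt0 (s p : R) : s != 0 -> 0 < p ->
  (0 < \int[normal_prob 0 s]_z (`|z| `^ p)%:E)%E.
Proof.
move=> s0 p0; rewrite lt0e integral_ge0 ?andbT; last by move=> z _; rewrite lee_fin powR_ge0.
apply/negP => /eqP m0; pose N : probability (measurableTypeR R) R := normal_prob 0 s.
have z0 : {ae N, forall z, z = 0}.
  by apply: (@ae_eq0_powR _ _ _ N id p p0) => //; rewrite m0.
have := @gaussian_charfun _ s 0 s0 1; rewrite cos0 mul1r.
have -> : \int[N]_z cos (0 + 1 * z) = 1.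
  rewrite -[RHS](Rintegral_prob_cst N) /Rintegral; congr fine.
  apply: ae_eq_integral => //.
  - apply/measurable_EFinP.
    apply: (measurableT_comp (continuous_measurable_fun (@continuous_cos R))).
    by apply: measurable_funD => //; exact: measurable_funM.
  - have [A [mA A0 AQ]] := z0; exists A; split => // z nz; apply: AQ => /= zz.
    by apply: nz => _; rewrite zz mulr0 addr0 cos0.
move=> h; have : - (s ^+ 2 * 1 ^+ 2 / 2) = 0 by apply: expR_inj; rewrite expR0 -h.
move=> /eqP.
by rewrite oppr_eq0 expr1n mulr1 mulf_eq0 expf_eq0/= (negPf s0) invr_eq0 pnatr_eq0.
Qed.

Lemma mixture_moment (p : R) : sigma != 0 -> 0 < p ->
  (\int[mixture_prob]_x (`|mixture x| `^ p)%:E =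
   \int[P]_w (`|M w| `^ (p / 2))%:E *
   \int[noise]_z (`|z| `^ p)%:E)%E.
Proof.
move=> s0 p0; rewrite -integral_product_mul//; last first.
  exact: measurable_abs_powR.
apply: eq_integral => x _; rewrite /mixture (negPf s0); congr EFin.
rewrite normrM powRM// ger0_norm ?sqrtr_ge0//; congr (_ * _).
by rewrite -powR12_sqrt// -powRrM mulrC.
Qed.

Lemma ae_fst (Q : T -> Prop) : {ae P, forall w, Q w} ->
  {ae mixture_prob, forall x, Q x.1}.
Proof.
move=> [A [mA A0 AQ]]; exists (A `*` setT); split.
- exact: measurableX.
- apply: etrans (product_measure1E P noise mA measurableT) _.
  exact: etrans (congr1 (fun z => z * _)%E A0) (mul0e _).
- by move=> x /= nQ; split => //; exact: AQ.
Qed.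

Lemma mixture_eq0 : {ae P, forall w, M w = 0} -> {ae mixture_prob, forall x, mixture x = 0}.
Proof.
move=> /ae_fst[A [mA A0 AQ]]; exists A; split => // x nx; apply: AQ => M0; apply: nx.
by rewrite /= /mixture M0 normr0 sqrtr0 mul0r; case: ifP.
Qed.

(** If the mixture is a constant [c], its transform has modulus one. Comparing
the phases [0] and [pi / 2] at [xi = 1] gives [sin c = 0], so the Laplace
transform of [M], which is positive and at most one, equals one; hence
[sigma^2 M = 0]. *)
Lemma mixture_nondegenerate : degenerate mixture_prob mixture ->
  sigma = 0 \/ {ae P, forall w, M w = 0}.
Proof.
move=> [c Mc]; have [s0|s0] := eqVneq sigma 0; [by left|right].
have Ec (theta xi : R) : cos theta *
    \int[P]_w expR (- (sigma ^+ 2 * xi ^+ 2 / 2 * `|M w|)) = cos (theta + xi * c).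
  rewrite -mixture_cos -[RHS](Rintegral_prob_cst mixture_prob) /Rintegral; congr fine.
  apply: ae_eq_integral => //.
  - apply/measurable_EFinP.
    apply: (measurableT_comp (continuous_measurable_fun (@continuous_cos R))).
    by apply: measurable_funD => //; apply: measurable_funM => //; exact: measurable_mixture.
  - have [A [mA A0 AQ]] := Mc; exists A; split => // x nx; apply: AQ => Mx.
    by apply: nx => _; rewrite /= Mx.
pose f w := expR (- (sigma ^+ 2 / 2 * `|M w|)).
have mf : measurable_fun setT f by apply: measurable_expR_lin; exact: measurableT_comp.
have f1 w : f w <= 1.
  by rewrite -[leRHS]expR0 ler_expR oppr_le0 mulr_ge0// divr_ge0// sqr_ge0.
have fE : \int[P]_w expR (- (sigma ^+ 2 * 1 ^+ 2 / 2 * `|M w|)) = \int[P]_w f w.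
  by apply: eq_Rintegral => w _; rewrite expr1n mulr1.
have := Ec 0 1; have := Ec (pi / 2) 1; rewrite fE cos_pihalf mul0r cos0 !mul1r add0r.
rewrite [pi / 2 + c]addrC cosDpihalf => /esym/eqP; rewrite oppr_eq0 => /eqP sc cc.
have If1 : \int[P]_w f w = 1.
  have i0 : 0 <= \int[P]_w f w by apply: Rintegral_ge0 => w _; exact: expR_ge0.
  by have := sin0cos1 sc; rewrite -cc ger0_norm.
have : {ae P, forall w, f w = 1}.
  have fn w : `|f w| <= 1 by rewrite ger0_norm ?expR_ge0.
  apply: (@ae_eq_of_integral_le _ _ _ P f (cst 1)) => //.
  - by move=> w; exact: expR_ge0.
  - by rewrite (@bounded_RintegralE _ _ _ P _ 1)// ltry.
  - rewrite (@bounded_RintegralE _ _ _ P f 1)// If1.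
    rewrite (@bounded_RintegralE _ _ _ P (cst 1) 1)//.
      by rewrite Rintegral_prob_cst.
    by move=> w; rewrite /= normr1.
move=> fw1; apply: (ae_impl fw1) => w fw.
have : - (sigma ^+ 2 / 2 * `|M w|) = 0 by apply: expR_inj; rewrite expR0.
have s20 : 0 < sigma ^+ 2 / 2 by rewrite divr_gt0// exprn_even_gt0.
by move=> /eqP; rewrite oppr_eq0 mulf_eq0 (gt_eqF s20)/= normr_eq0 => /eqP.
Qed.

Lemma mixture_gaussian : {ae P, forall w, M w = 1} -> is_gaussian mixture_rv.
Proof.
move=> /ae_fst M1; exists 0, `|sigma| => A mA; rewrite normr_eq0.
have mU : measurable (mixture @^-1` A).
  by rewrite -[_ @^-1` _]setTI; apply: measurable_mixture.
rewrite -[LHS]/(mixture_prob (mixture @^-1` A)).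
have [s0|s0] := eqVneq sigma 0.
  have -> : mixture @^-1` A = if 0 \in A then setT else set0.
    apply/seteqP; split => x; rewrite /= /mixture s0 eqxx.
      by move=> A0; rewrite mem_set.
    by case: ifPn => // /set_mem.
  rewrite diracE; case: ifP => _; last by rewrite measure0.
  by rewrite probability_setT.
transitivity (\int[mixture_prob]_x (\1_A (mixture x) : R)%:E)%E.
  have := integral_indic mixture_prob measurableT mU; rewrite setIT => <-.
  by apply: eq_integral.
transitivity (\int[mixture_prob]_x (\1_A x.2 : R)%:E)%E.
  apply: ge0_ae_eq_integral => //.
  - apply/measurable_EFinP; apply: (measurableT_comp (f := \1_A : R -> R)).
      exact: measurable_indic.
    exact: measurable_mixture.
  - apply/measurable_EFinP; apply: (measurableT_comp (f := \1_A : R -> R)).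
      exact: measurable_indic.
    exact: measurable_snd.
  - have [B [mB B0 BQ]] := M1; exists B; split => // x nx; apply: BQ => Mx.
    by apply: nx => _; rewrite /= /mixture (negPf s0) Mx normr1 sqrtr1 mul1r.
rewrite /mixture_prob (integral_product_snd P noise (g := \1_A))//.
by rewrite integral_indic// setIT /noise /scale_or1 (negPf s0).
Qed.

End gaussian_mixture.

(** * The independence that the families provide *)

Section families.
Context {d : measure_display} {T : measurableType d} {R : realType}
  (P : probability T R).
Variables (X : nat -> {RV P >-> R}) (LR : nat -> {RV P >-> (R * R)%type})
  (I : nat -> {RV P >-> nat}) (nu : R -> {RV P >-> nat}).

Definition family_of (k : 'I_4) : set (set T) :=
  nth set0 [:: sigma_of_family [set n | (0 < n)%N] X;
               sigma_of_family [set n | (0 < n)%N] LR;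
               sigma_of_family [set n | (0 < n)%N] I;
               sigma_of_family [set t | 0 <= t] nu] k.

Hypothesis X_indep : mutually_independent P [set n | (0 < n)%N]
  (fun n => sigma_of (X n)).
Hypothesis LR_indep : mutually_independent P [set n | (0 < n)%N]
  (fun n => sigma_of (LR n)).
Hypothesis I_indep : mutually_independent P [set n | (0 < n)%N]
  (fun n => sigma_of (I n)).
Hypothesis families_indep : mutually_independent P [set: 'I_4] family_of.

Let iX : 'I_4 := @Ordinal 4 0 isT.
Let iLR : 'I_4 := @Ordinal 4 1 isT.
Let iI : 'I_4 := @Ordinal 4 2 isT.
Let inu : 'I_4 := @Ordinal 4 3 isT.

Lemma sigma_of_setI {d' : measure_display} {S : measurableType d'}
    (Y : {mfun T >-> S}) : setI_closed (sigma_of Y).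
Proof.
move=> _ _ [B mB <-] [C mC <-]; exists (B `&` C); first exact: measurableI.
by rewrite preimage_setI setIACA setIid.
Qed.

Lemma sigma_of_setT {d' : measure_display} {S : measurableType d'}
    (Y : {mfun T >-> S}) : sigma_of Y setT.
Proof. by exists setT => //; rewrite preimage_setT setIT. Qed.

Lemma sigma_setI (G : set (set T)) : setI_closed <<s G >>.
Proof. by move=> A B sA sB; exact: (@measurableI _ (g_sigma_algebraType G)). Qed.

Lemma sigma_setT (G : set (set T)) : <<s G >> setT.
Proof. exact: (@measurableT _ (g_sigma_algebraType G)). Qed.

Lemma sigma_mono (F G : set (set T)) : F `<=` <<s G >> -> <<s F >> `<=` <<s G >>.
Proof. by move=> FG; apply: smallest_sub => //; exact: smallest_sigma_algebra. Qed.

Lemma measurable_sigma_family {J : Type} {d' : measure_display} {S : measurableType d'}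
    (D : set J) (Y : J -> {mfun T >-> S}) : sigma_of_family D Y `<=` measurable.
Proof.
apply: smallest_sub; first exact: sigma_algebra_measurable.
by move=> A [j _]; exact: measurable_sigma_of.
Qed.

Lemma family_of_setI k : setI_closed (family_of k).
Proof. by case: k => [[|[|[|[|]]]]]//= ?; exact: sigma_setI. Qed.

Lemma family_of_setT k : family_of k setT.
Proof. by case: k => [[|[|[|[|]]]]]//= ?; exact: sigma_setT. Qed.

Lemma family_of_measurable k : family_of k `<=` measurable.
Proof. by case: k => [[|[|[|[|]]]]]//= ?; exact: measurable_sigma_family. Qed.

Definition variable_of (i : 'I_4 * nat) : set (set T) :=
  nth (sigma_of (X i.2)) [:: sigma_of (X i.2); sigma_of (LR i.2); sigma_of (I i.2)] i.1.

Definition variables : set ('I_4 * nat) :=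
  [set i : 'I_4 * nat | (i.1 < 3)%N /\ (0 < i.2)%N].

Lemma variables_independent : mutually_independent P variables variable_of.
Proof.
pose D (k : 'I_4) : set nat := [set n | (k < 3)%N /\ (0 < n)%N].
pose F (k : 'I_4) (n : nat) := variable_of (k, n).
have HFS k n : D k n -> F k n `<=` family_of k.
  case: k => [[|[|[|[|]]]]]//= kP [k3 n0] A FA; last by case: (notF k3).
  - by apply: sub_sigma_algebra; exists n.
  - by apply: sub_sigma_algebra; exists n.
  - by apply: sub_sigma_algebra; exists n.
have HFE k : mutually_independent P (D k) (F k).
  case: k => [[|[|[|[|]]]]]//= kP J A JD FA.
  - by apply: X_indep => // i iJ; have [] := JD i iJ.
  - by apply: LR_indep => // i iJ; have [] := JD i iJ.
  - by apply: I_indep => // i iJ; have [] := JD i iJ.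
  - have J0 : J = fset0.
      apply/eqP; apply: contraT => /fset0Pn[i iJ].
      by have [k3 _] := JD i iJ; case: (notF k3).
    rewrite J0 big_seq_fset0 (_ : \bigcap_(i in _) _ = setT) ?probability_setT//.
    by apply/seteqP; split => // w _ i /=; rewrite inE.
have := hierarchical_independence families_indep family_of_setI family_of_setT HFS HFE.
by [].
Qed.

(** The past, the environment and the data are all groups of such variables,
so this covers every independence that the cascade needs. *)
Lemma variable_independent (D : set ('I_4 * nat)) i0 (A B : set T) :
  D `<=` variables -> variables i0 -> ~ D i0 ->
  <<s \bigcup_(i in D) variable_of i >> A -> variable_of i0 B ->
  (P (A `&` B) = P A * P B)%E.
Proof.
move=> DV i0V nD sA vB.
apply: (mutually_independent_grouping variables_independent DV i0V nD) => //.
- by move=> [[[|[|[|[|]]]]]]//= ? n; exact: measurable_sigma_of.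
- by move=> [[[|[|[|[|]]]]]]//= ? n; exact: sigma_of_setI.
- by move=> [[[|[|[|[|]]]]]]//= ? n; exact: sigma_of_setT.
Qed.

Let preim {d' : measure_display} {S : measurableType d'} (Y : {mfun T >-> S})
  (B : set S) : measurable B -> sigma_of Y (Y @^-1` B).
Proof. by move=> mB; exists B => //; rewrite setTI. Qed.

Lemma LR_past_independent n A B : (0 < n)%N -> <<s past LR I n >> A ->
  measurable B -> (P (A `&` LR n @^-1` B) = P A * P (LR n @^-1` B))%E.
Proof.
move=> n0 sA mB.
pose D := [set i : 'I_4 * nat | (i.1 = iLR \/ i.1 = iI) /\ (0 < i.2 < n)%N].
apply: (@variable_independent D (iLR, n)) => //.
- by move=> [i k] [/= [->|->] /andP[k0 _]].
- by move=> [_ /=]; rewrite ltnn andbF.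
- apply: sigma_mono sA => C [k kn [CL|CI]]; apply: sub_sigma_algebra.
  + by exists (iLR, k) => //; split => //; left.
  + by exists (iI, k) => //; split => //; right.
- exact: preim.
Qed.

Lemma I_past_independent n A B : (0 < n)%N ->
  <<s past LR I n `|` sigma_of (LR n) >> A ->
  measurable B -> (P (A `&` I n @^-1` B) = P A * P (I n @^-1` B))%E.
Proof.
move=> n0 sA mB.
pose D := [set i : 'I_4 * nat | (i.1 = iLR /\ (0 < i.2 <= n)%N) \/
  (i.1 = iI /\ (0 < i.2 < n)%N)].
apply: (@variable_independent D (iI, n)) => //.
- by move=> [i k] [[/= -> /andP[k0 _]]|[/= -> /andP[k0 _]]].
- by move=> [[/(congr1 val)//]|[_ /=]]; rewrite ltnn andbF.
- apply: sigma_mono sA => C [[k /= /andP[k0 kn] [CL|CI]]|CL]; apply: sub_sigma_algebra.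
  + by exists (iLR, k) => //; left; split => //=; rewrite k0 ltnW.
  + by exists (iI, k) => //; right; split => //=; rewrite k0.
  + by exists (iLR, n) => //; left; split => //=; rewrite n0 leqnn.
- exact: preim.
Qed.

Lemma X_past_independent m A B : (0 < m)%N -> <<s data_past X LR I m >> A ->
  measurable B -> (P (A `&` X m @^-1` B) = P A * P (X m @^-1` B))%E.
Proof.
move=> m0 sA mB.
pose D := [set i : 'I_4 * nat | (i.1 = iX /\ (0 < i.2 < m)%N) \/
  ((i.1 = iLR \/ i.1 = iI) /\ (0 < i.2)%N)].
apply: (@variable_independent D (iX, m)) => //.
- by move=> [i k] [[/= -> /andP[k0 _]]|[/= [->|->] k0]].
- by move=> [[_ /=]|[[/(congr1 val)//|/(congr1 val)//]]]; rewrite ltnn andbF.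
- apply: sigma_mono sA => C [[k /= km CX]|[k /= k0 [CL|CI]]]; apply: sub_sigma_algebra.
  + by exists (iX, k) => //; left.
  + by exists (iLR, k) => //; right; split => //; left.
  + by exists (iI, k) => //; right; split => //; right.
- exact: preim.
Qed.

Definition all_data : set (set T) :=
  \bigcup_(i in [set i | (0 < i)%N]) sigma_of (X i) `|` environment LR I.

Lemma nu_independent (t : R) A (B : set nat) : 0 <= t -> <<s all_data >> A ->
  (P (A `&` nu t @^-1` B) = P A * P (nu t @^-1` B))%E.
Proof.
move=> t0 sA; pose D := [set k : 'I_4 | (k < 3)%N].
apply: (@mutually_independent_grouping _ _ _ _ _ [set: 'I_4] D family_of inu) => //.
- exact: family_of_measurable.
- exact: family_of_setI.
- exact: family_of_setT.
- apply: sigma_mono sA => C [[k /= k0 CX]|[k /= k0 [CL|CI]]]; apply: sub_sigma_algebra.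
  + by exists iX => //; apply: sub_sigma_algebra; exists k.
  + by exists iLR => //; apply: sub_sigma_algebra; exists k.
  + by exists iI => //; apply: sub_sigma_algebra; exists k.
- by apply: sub_sigma_algebra; exists t => //; exact: preim.
Qed.

End families.

(** * Conservative splitting and the branching function *)

Section conservative.
Context {d d1 : measure_display} {T : measurableType d} {T1 : measurableType d1}
  {R : realType} (P : probability T R) (P1 : probability T1 R).
Variables (LR : nat -> {RV P >-> (R * R)%type}) (I : nat -> {RV P >-> nat})
  (LR0 : {RV P1 >-> (R * R)%type}) (Minf : {RV P >-> R}).
Hypothesis SP : splitting_process LR I LR0.
Hypothesis Minf_cvg :
  {ae P, forall w, powsum 2 (leaves_rv LR I n w) @[n --> \oo] --> Minf w}.

(** Each split preserves the sum of squares, so the mass equals one at every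
stage. *)
Lemma conservative_limit :
  {ae P1, forall v, (LR0 v).1 ^+ 2 + (LR0 v).2 ^+ 2 = 1} ->
  {ae P, forall w, Minf w = 1}.
Proof.
move=> LR1.
pose B := [set x : R * R | x.1 ^+ 2 + x.2 ^+ 2 = 1].
have mB : measurable B.
  have ms : measurable_fun setT (fun x : R * R => x.1 ^+ 2 + x.2 ^+ 2).
    by apply: measurable_funD; apply: measurable_funX; [exact: measurable_fst|exact: measurable_snd].
  rewrite (_ : B = (fun x : R * R => x.1 ^+ 2 + x.2 ^+ 2) @^-1` [set 1]).
    by rewrite -[_ @^-1` _]setTI; exact: ms.
  by apply/seteqP; split => x.
have LRn n : (0 < n)%N -> {ae P, forall w, B (LR n w)}.
  move=> n0; exists (LR n @^-1` (~` B)); split.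
  - by apply: measurable_funPTI; exact: measurableC.
  - have := SP.(LR_law) n0 (measurableC mB).
    rewrite /distribution /pushforward /= => ->.
    case: LR1 => A [mA A0 AB].
    apply/eqP; rewrite -measure_le0 -A0; apply: le_measure; rewrite ?inE//.
      by apply: measurable_funPTI; exact: measurableC.
  - by move=> w.
have step n : {ae P, forall w, powsum 2 (leaves_rv LR I n.+1 w) = 1}.
  elim: n => [|n IH].
    apply: aeW => w; rewrite /leaves_rv leaves1 /powsum big_seq1 normr1.
    by rewrite powR1.
  have IR := I_range SP.(I_law) (ltn0Sn n).
  have H := LRn n.+1 isT.
  apply: filterS3 IH IR H => w w1 [k kn Ik] Bw.
  rewrite /leaves_rv (leavesS _ _ kn Ik) -/(leaves_rv LR I n.+1 w).
  rewrite /powsum sum_split_leaf ?size_leaves//.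
  move: w1; rewrite /powsum => ->; rewrite !normrM !powRM// !abs_powR2.
  move: Bw; rewrite /B/=; set b := (leaves_rv LR I n.+1 w)`_k.
  by rewrite -mulrDl => ->; rewrite mul1r subrK.
have : {ae P, forall w, forall n, powsum 2 (leaves_rv LR I n.+1 w) = 1}.
  exact/ae_foralln.
move=> H; apply: filterS2 H Minf_cvg => w w1.
rewrite -cvg_shiftS /=; under eq_cvg do rewrite w1.
by move=> /cvg_lim => <-//; rewrite lim_cst.
Qed.

End conservative.

Section branching_function.
Context {d1 : measure_display} {T1 : measurableType d1} {R : realType}
  (P1 : probability T1 R) (LR0 : {RV P1 >-> (R * R)%type}).
Hypothesis LR0_ge0 : {ae P1, forall w, 0 <= (LR0 w).1 /\ 0 <= (LR0 w).2}.

(** Almost surely [L, R >= 0], and for [s > 0] the convention on [0^0] is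
immaterial. *)
Lemma calS_branching (s : R) : 0 < s -> (calS LR0 s = branching LR0 s - 1)%E.
Proof.
move=> s0; rewrite /calS unlock; congr (_ - 1)%E.
have mp : measurable_fun setT (fun x : R => pow0 x s).
  rewrite /pow0; apply: measurable_fun_ifT => //.
  exact: measurable_fun_eqr.
have pow0E (x : R) : 0 <= x -> pow0 x s = `|x| `^ s.
  move=> x0; rewrite /pow0 ger0_norm//; case: eqVneq => // ->.
  by rewrite powR0// gt_eqF.
have pow0_ge0 (x : R) : 0 <= pow0 x s by rewrite /pow0; case: ifP => // _; exact: powR_ge0.
apply: ge0_ae_eq_integral => //.
- apply/measurable_EFinP; apply: measurable_funD.
    exact: (measurableT_comp mp (measurable_fst_RV LR0)).
  exact: (measurableT_comp mp (measurable_snd_RV LR0)).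
- by apply/measurable_EFinP; exact: measurable_branching.
- by move=> w _; rewrite lee_fin addr_ge0.
- by apply: filterS LR0_ge0 => w [l0 r0] _; rewrite !pow0E.
Qed.

Lemma calS_lt0 (s : R) : 0 < s -> (calS LR0 s < 0)%E <-> (branching LR0 s < 1)%E.
Proof.
by move=> s0; rewrite calS_branching// lteBlDr// add0e.
Qed.

Lemma branching_real (s : R) : (branching LR0 s < 1)%E ->
  exists2 a : R, branching LR0 s = a%:E & a < 1.
Proof.
move=> b1; have b0 := branching_ge0 LR0 s.
have bf : branching LR0 s \is a fin_num.
  by rewrite ge0_fin_numE// (lt_trans b1)// ltry.
exists (fine (branching LR0 s)); first by rewrite fineK.
by rewrite -lte_fin fineK.
Qed.

Lemma branching2E :
  ('E_P1[(fun w => ((LR0 w).1 ^+ 2 + (LR0 w).2 ^+ 2)%R)] = 1)%E -> branching LR0 2 = 1%E.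
Proof.
by rewrite unlock => <-; apply: eq_integral => v _; rewrite !abs_powR2.
Qed.

End branching_function.

Section selection.
Context {d d0 d1 : measure_display} {T : measurableType d}
  {T0 : measurableType d0} {T1 : measurableType d1} {R : realType}
  (P : probability T R) (P0 : probability T0 R) (P1 : probability T1 R).
Variables (X : nat -> {RV P >-> R}) (LR : nat -> {RV P >-> (R * R)%type})
  (I : nat -> {RV P >-> nat}) (nu : R -> {RV P >-> nat}).

Lemma measurable_all_data : all_data X LR I `<=` measurable.
Proof. by move=> A [[k _]|[k _ []]]; exact: measurable_sigma_of. Qed.

Lemma measurable_W_all_data n : measurable_fun setT
  (W X LR I n : g_sigma_algebraType (all_data X LR I) -> R).
Proof.
pose G := all_data X LR I.
pose g (w : g_sigma_algebraType G) := \sum_(1 <= i < n.+1)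
  (if (0 < i)%N then beta_rv LR I n i w * X i w else 0).
have mg : measurable_fun setT g.
  apply: measurable_sum => i; case: (boolP (0 < i)%N) => // i0.
  apply: measurable_funM.
    apply: measurable_beta_wrt; apply: subset_trans (@past_environment _ _ _ _ LR I n) _.
    by move=> A eA; apply: sub_sigma_algebra; right.
  apply: measurable_wrt => A sA; apply: sub_sigma_algebra; left.
  by exists i.
apply: eq_measurable_fun mg => w _.
by apply: eq_big_nat => i /andP[-> _].
Qed.

End selection.

(** * Convergence to a Gaussian mixture *)

Theorem theorem3p4 (R : realType)
  (* the fixed random vector (L, R) *)
  (d1 : measure_display) (T1 : measurableType d1) (P1 : probability T1 R)
  (LR0 : {RV P1 >-> (R * R)%type})
  (LR0_ge0 : {ae P1, forall w, 0 <= (LR0 w).1 /\ 0 <= (LR0 w).2})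
  (* the initial datum X_0 *)
  (d0 : measure_display) (T0 : measurableType d0) (P0 : probability T0 R)
  (X0 : {RV P0 >-> R})
  (* the probability space and the families on it *)
  (d : measure_display) (T : measurableType d) (P : probability T R)
  (X : nat -> {RV P >-> R}) (LR : nat -> {RV P >-> (R * R)%type})
  (I : nat -> {RV P >-> nat}) (nu : R -> {RV P >-> nat})
  (X_law : forall n, (0 < n)%N -> eq_in_law P P0 (X n) X0)
  (LR_law : forall n, (0 < n)%N -> eq_in_law P P1 (LR n) LR0)
  (I_law : forall n k, (1 <= k <= n)%N ->
     P (I n @^-1` [set k]) = (n%:R^-1)%:E)
  (nu_law : forall (t : R) n, 0 <= t -> (0 < n)%N ->
     P (nu t @^-1` [set n]) = (expR (- t) * (1 - expR (- t)) ^+ n.-1)%:E)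
  (X_indep : mutually_independent P [set n | (0 < n)%N]
     (fun n => sigma_of (X n)))
  (LR_indep : mutually_independent P [set n | (0 < n)%N]
     (fun n => sigma_of (LR n)))
  (I_indep : mutually_independent P [set n | (0 < n)%N]
     (fun n => sigma_of (I n)))
  (families_indep : mutually_independent P [set: 'I_4]
     (fun k : 'I_4 => nth set0
        [:: sigma_of_family [set n | (0 < n)%N] X;
            sigma_of_family [set n | (0 < n)%N] LR;
            sigma_of_family [set n | (0 < n)%N] I;
            sigma_of_family [set t | 0 <= t] nu] k))
  (* M_oo^(2), the almost sure limit of M_n^(2) *)
  (Minf : {RV P >-> R})
  (M2_cvg : {ae P, forall w, M2 LR I n w @[n --> \oo] --> Minf w})
  (* the assumptions of the theorem *)
  (LR0_sq : ('E_P1[(fun w => ((LR0 w).1 ^+ 2 + (LR0 w).2 ^+ 2)%R)] = 1)%E)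
  (gamma : R) (gamma_gt0 : 0 < gamma) (S_gamma : (calS LR0 gamma < 0)%E)
  (X0_mean : ('E_P0[X0] = 0)%E)
  (sigma : R) (X0_sq : ('E_P0[(fun w => (X0 w ^+ 2)%R)] = (sigma ^+ 2)%:E)%E) :
  exists (d' : measure_display) (T' : measurableType d')
      (P' : probability T' R) (Vinf : {RV P' >-> R}),
    cvg_in_distribution (V_rv X LR I nu) Vinf /\
    (forall xi : R, charfun P' Vinf xi =
       ((fine 'E_P[(fun w =>
           expR (- (xi ^+ 2 * (sigma ^+ 2 / 2) * Minf w)))]%E)%:C)%C) /\
    (2 < gamma -> 0 < sigma ^+ 2 -> ~ degenerate P' Vinf) /\
    (gamma < 2 -> {ae P', forall w, Vinf w = 0}) /\
    ({ae P1, forall w, (LR0 w).1 ^+ 2 + (LR0 w).2 ^+ 2 = 1} ->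
       is_gaussian Vinf) /\
    (~ degenerate P' Vinf -> forall p : R, 2 < p ->
       ('E_P'[(fun w => (`|Vinf w| `^ p)%R)] < +oo)%E <->
       (calS LR0 p < 0)%E).
Proof.
have LRp := LR_past_independent X_indep LR_indep I_indep families_indep.
have Ip := I_past_independent X_indep LR_indep I_indep families_indep.
have Xp := X_past_independent X_indep LR_indep I_indep families_indep.
have nup := nu_independent families_indep.
have SP : splitting_process LR I LR0 by split.
have b2 : branching LR0 2 = 1%E by exact: branching2E.
have Mc : {ae P, forall w, powsum 2 (leaves_rv LR I n w) @[n --> \oo] --> Minf w}.
  apply: filterS M2_cvg => w.
  rewrite (_ : (fun n => M2 LR I n w) = (fun n => powsum 2 (leaves_rv LR I n w)))//.
  apply/funext => n; rewrite powsumE; apply: eq_bigr => j _.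
  by rewrite abs_powR2.
have [a ga a1] := branching_real ((calS_lt0 LR0_ge0 gamma_gt0).1 S_gamma).
have cphi (theta xi : R) :
    \int[P]_w cos (theta + xi * V_rv X LR I nu t w) @[t --> +oo] -->
    \int[mixture_prob P sigma]_x cos (theta + xi * mixture Minf sigma x).
  rewrite mixture_cos.
  have mcos := continuous_measurable_fun (@continuous_cos R).
  apply: (cvg_random_index (f := fun n w => cos (theta + xi * W X LR I n w))
    nu_law (@measurable_all_data _ _ _ _ X LR I) nup).
  - move=> n; apply: (measurableT_comp mcos); apply: measurable_funD => //.
    by apply: measurable_funM => //; exact: measurable_W_all_data.
  - by move=> n w; exact: cos_max.
  - exact: (central_limit SP X_law Xp X0_mean X0_sq Mc b2 gamma_gt0 ga a1).
exists _, (T * measurableTypeR R)%type, (mixture_prob P sigma), (mixture_rv Minf sigma).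
have nondeg : ~ degenerate (mixture_prob P sigma) (mixture Minf sigma) ->
    sigma != 0 /\ ~ {ae P, forall w, Minf w = 0}.
  move=> nd; split.
    apply/eqP => s0; apply: nd; exists 0; apply: aeW => x.
    by rewrite /mixture s0 eqxx.
  by move=> M0; apply: nd; exists 0; exact: mixture_eq0.
split; [|split; [|split; [|split; [|split]]]].
(* continuous time is reduced to sequences tending to infinity *)
- move=> x cx; apply/cvge_pinftyP => u uy.
  apply: (continuity_theorem (V := fun n => V_rv X LR I nu (u n)) _ cx) => theta xi.
  by have /cvg_pinftyP := cphi theta xi; apply.
- move=> xi; rewrite /charfun /cexpectation !unlock.
  have -> : fine (\int[mixture_prob P sigma]_w
      (complex.Re (expi (xi * mixture_rv Minf sigma w)))%:E)%E =
      \int[mixture_prob P sigma]_x cos (0 + xi * mixture Minf sigma x).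
    by congr fine; apply: eq_integral => x _; rewrite add0r.
  (* the sine is the cosine with phase - pi / 2 *)
  have -> : fine (\int[mixture_prob P sigma]_w
      (complex.Im (expi (xi * mixture_rv Minf sigma w)))%:E)%E =
      \int[mixture_prob P sigma]_x cos (- (pi / 2) + xi * mixture Minf sigma x).
    by congr fine; apply: eq_integral => x _; rewrite addrC cosBpihalf.
  (* both parts carry the same Laplace transform, with factors 1 and 0 *)
  rewrite !mixture_cos cosN cos_pihalf mul0r cos0 mul1r.
  congr (_ +i* _)%C; rewrite /Rintegral; congr fine.
  apply: ge0_ae_eq_integral => //.
  + apply/measurable_EFinP; apply: measurable_expR_lin; exact: measurableT_comp.
  + by apply/measurable_EFinP; exact: measurable_expR_lin.
  + apply: filterS (Minf_ge0 Mc) => w Mw _; rewrite ger0_norm//.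
    suff -> : sigma ^+ 2 * xi ^+ 2 / 2 = xi ^+ 2 * (sigma ^+ 2 / 2) by [].
    by rewrite mulrA [xi ^+ 2 * _]mulrC.
- move=> g2 s2 /mixture_nondegenerate[s0|].
    by move: s2; rewrite s0 expr0n ltxx.
  exact: (limit_nonzero SP b2 Mc g2 ga a1).
- move=> g2; apply: mixture_eq0; apply: (limit_zero SP Mc _ ga a1).
  by rewrite gamma_gt0.
- by move=> LR1; apply: mixture_gaussian; exact: (conservative_limit SP Mc LR1).
- move=> /nondeg[s0 M0] p p2; have p0 : 0 < p by exact: lt_trans p2.
  rewrite (calS_lt0 LR0_ge0 p0) unlock (mixture_moment _ s0 p0).
  have sn0 := scale_or1_neq0 sigma.
  have zf := gaussian_moment_fin sn0 p0.
  have z0 := gaussian_moment_gt0 sn0 p0.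
  have zfin : (\int[noise sigma]_z (`|z| `^ p)%:E)%E \is a fin_num.
    by rewrite ge0_fin_numE// ltW.
  have M20 : (0 <= \int[P]_w (`|Minf w| `^ (p / 2))%:E)%E.
    by apply: integral_ge0 => w _; rewrite lee_fin powR_ge0.
  split=> [Mfin|bp].
    apply: (branching_lt1 SP b2 Mc p2 _ M0 gamma_gt0 ga a1).
    move: Mfin; case: (\int[P]_w _)%E M20 => [r| |]// _; rewrite ?ltry//.
    by rewrite gt0_mulye// ltxx.
  have [b bE b1] := branching_real bp.
  by rewrite lte_mul_pinfty// ?ge0_fin_numE//; exact: (limit_moment_finite SP b2 Mc p2 bE b1).
Qed.
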